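(* Let $k$ be an algebraically closed field of characteristic zero, $R=k[x,y,z]$, and let $X=V(f)\subset\mathbb P^2_k$ be an irreducible curve of degree $d+1$, $d\geq 1$ ($f\in R$ an irreducible form of degree $d+1$). Then $\operatorname{Bour}(X)=d^2-1$ if and only if $X$ has a unique singular point and this is a nodal point.
   Context: A nodal point is a simple node (ordinary double point, i.e. with completed local ring isomorphic to $k[[u,v]]/(uv)$). $J_f=(f_x,f_y,f_z)\subset R$ is the gradient ideal. $\operatorname{Syz}(J_f)=\{(a,b,c)\in R^3: af_x+bf_y+cf_z=0\}$ is graded as a submodule of $R^3$ (a syzygy has degree $n$ if its coordinates are forms of degree $n$). For a graded module $M=\bigoplus_{i\ge 0}M_i$, $\operatorname{indeg}(M)=\min\{i: M_i\ne 0\}$. The curve $X$ (or $f$) is a free divisor if $\operatorname{Syz}(J_f)$ is a free $R$-module. Bourbaki degree: let $e=\operatorname{indeg}(\operatorname{Syz}(J_f))$. If $f$ is a free divisor, set $\operatorname{Bour}(X)=0$. Otherwise choose a minimal generator $\epsilon\in\operatorname{Syz}(J_f)$ of degree $e$; the cokernel of $R(-e)\stackrel{\epsilon}{\to}\operatorname{Syz}(J_f)$ is isomorphic, by a degree-zero graded isomorphism, to $I_\epsilon(e-d)$ for a proper homogeneous ideal $I_\epsilon\subset R$ of codimension two, and $\operatorname{Bour}(X):=\deg(R/I_\epsilon)$ (algebraic multiplicity), which does not depend on the choice of $\epsilon$ of degree $e$. *)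

(* Defs.v *)
From HB Require Import structures.
From mathcomp Require Import all_boot all_order all_algebra.
From mathcomp Require Import boolp mpoly.

Set Implicit Arguments.
Unset Strict Implicit.
Unset Printing Implicit Defensive.

Import GRing.Theory.

Local Open Scope ring_scope.

Section CommutativeAlgebra.
Context {A : comPzRingType}.
Implicit Types I P : A -> Prop.

Definition is_ideal I :=
  [/\ I 0, forall a b, I a -> I b -> I (a + b) & forall a b, I b -> I (a * b)].

Definition is_prime_ideal P :=
  [/\ is_ideal P, ~ P 1 & forall a b, P (a * b) -> P a \/ P b].

(* There is a strict chain of n + 1 prime ideals with P at the top. *)
Fixpoint height_ge (n : nat) P : Prop :=
  if n is m.+1 then
    exists Q : A -> Prop, [/\ is_prime_ideal Q, forall a, Q a -> P a,
      exists2 a, P a & ~ Q a & height_ge m Q]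
  else True.

(* ht I is the minimum of the heights of the primes containing I. *)
Definition has_codim I (n : nat) :=
  (forall P, is_prime_ideal P -> (forall a, I a -> P a) -> height_ge n P) /\
  (exists P, [/\ is_prime_ideal P, forall a, I a -> P a & ~ height_ge n.+1 P]).

(* m ^ n for an ideal m of a subring S of A; for n = 0 it is S. *)
Definition ideal_pow (S m : A -> Prop) (n : nat) (x : A) :=
  exists (r : nat) (s : 'I_r -> A) (t : 'I_r -> 'I_n -> A),
    [/\ forall i, S (s i), forall i j, m (t i j)
      & x = \sum_(i < r) s i * \prod_(j < n) t i j].

End CommutativeAlgebra.

Definition is_free_module (A : pzRingType) (M : lmodType A) :=
  exists (n : nat) (b : 'I_n -> M),
    forall s : M, exists! c : 'rV[A]_n, s = \sum_(i < n) c 0 i *: b i.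

Definition irreducible_elt (A : idomainType) (p : A) :=
  [/\ p != 0, p \isn't a GRing.unit
    & forall g h : A, p = g * h -> g \is a GRing.unit \/ h \is a GRing.unit].

Section Graded.
Context {k : fieldType} {n : nat}.
Implicit Types (I : {mpoly k[n]} -> Prop).

Definition zhomog (z : int) (p : {mpoly k[n]}) : bool :=
  if z is Posz m then p \is m.-homog else p == 0.

Definition is_homog_ideal I :=
  is_ideal I /\ (forall (p : {mpoly k[n]}) (d : nat), I p -> I (pihomog mdeg d p)).

(* h = dim_k (R/I)_d: the residues of the forms b i are a k-basis of (R/I)_d. *)
Definition hilbert_value I (d h : nat) :=
  exists b : 'I_h -> {mpoly k[n]},
    (forall i, b i \is d.-homog) /\
    (forall p : {mpoly k[n]}, p \is d.-homog ->
      exists! c : 'rV[k]_h, I (p - \sum_(i < h) c 0 i *: b i)).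

Definition hilbert_poly I (P : {poly rat}) :=
  exists N : nat, forall d, (N <= d)%N ->
    exists2 h : nat, hilbert_value I d h & P.[d%:R] = h%:R.

(* deg (R/I) = (deg P)! * lead_coef P, for P the Hilbert polynomial; this is
   the multiplicity of R/I as soon as P != 0, i.e. dim R/I > 0. *)
Definition has_degree I (m : nat) :=
  exists2 P : {poly rat}, hilbert_poly I P
    & m%:R = ((size P).-1)`!%:R * lead_coef P.

End Graded.

Section Syzygies.
Context {k : fieldType}.
Local Notation R := {mpoly k[3]}.

Definition syz_pred (f : R) : pred 'rV[R]_3 :=
  fun s => \sum_(i < 3) s 0 i * f^`M(i) == 0.

Fact syz_submod_closed f : submod_closed (syz_pred f).
Proof.
split=> [|a s t]; rewrite /in_mem /= /syz_pred.
  by rewrite big1 // => i _; rewrite mxE mul0r.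
move=> /eqP hs /eqP ht; under eq_bigr do rewrite !mxE mulrDl -mulrA.
by rewrite big_split /= -mulr_sumr hs ht mulr0 addr0.
Qed.

HB.instance Definition _ f :=
  GRing.isSubmodClosed.Build R 'rV[R]_3 (syz_pred f) (syz_submod_closed f).

Record syz (f : R) := Syz { syz_val :> 'rV[R]_3; _ : syz_val \in syz_pred f }.

HB.instance Definition _ f := [isSub of syz f for @syz_val f].
HB.instance Definition _ f := [Choice of syz f by <:].
HB.instance Definition _ f := [SubChoice_isSubLmodule of syz f by <:].

Definition syz_homog f (d : nat) (s : syz f) :=
  forall j : 'I_3, syz_val s 0 j \is d.-homog.

Definition syz_indeg (f : R) (e : nat) :=
  (exists2 s : syz f, s != 0 & syz_homog e s) /\
  (forall (i : nat) (s : syz f), (i < e)%N -> syz_homog i s -> s = 0).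

(* By graded Nakayama: eps is not in (x, y, z) Syz(J_f). *)
Definition syz_min_generator f (eps : syz f) :=
  ~ exists t : 'I_3 -> syz f, eps = \sum_(i < 3) 'X_i *: t i.

(* Bour(V(f)) = m, where deg f = d + 1. The map phi induces the isomorphism
   Syz(J_f) / R eps ~ I(e - d); since I(e - d)_n = I_(n + e - d), it sends
   syzygies of degree n to forms of degree n + e - d. *)
Definition bourbaki_degree (f : R) (d m : nat) :=
  (is_free_module (syz f) /\ m = 0%N) \/
  (~ is_free_module (syz f) /\
   exists (e : nat) (eps : syz f) (I : R -> Prop)
          (phi : {linear syz f -> R^o}),
     [/\ [/\ syz_indeg f e, syz_homog e eps & syz_min_generator eps],
         [/\ is_homog_ideal I, ~ I 1 & has_codim I 2],
         [/\ forall p : R, I p <-> exists s : syz f, phi s = p,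
             forall s : syz f, phi s = 0 <-> exists a : R, s = a *: eps
           & forall (n : nat) (s : syz f), syz_homog n s ->
               zhomog (n%:Z + e%:Z - d%:Z) (phi s : R)]
       & has_degree I m]).

End Syzygies.

(* Formal power series R[[u_1, .., u_n]], as families of coefficients. *)
Section PowerSeries.
Context {n : nat} {R : comNzRingType}.

Definition mpowser (n : nat) (R : Type) := 'X_{1..n} -> R.
Local Notation S := (mpowser n R).
Implicit Types (a b c : S) (m : 'X_{1..n}).

HB.instance Definition _ := gen_eqMixin S.
HB.instance Definition _ := gen_choiceMixin S.

Definition mps_const (x : R) : S := fun m => if m == 0%MM then x else 0.
Definition mps_var (i : 'I_n) : S := fun m => (m == U_(i)%MM)%:R.
Definition mps_opp a : S := fun m => - a m.
Definition mps_add a b : S := fun m => a m + b m.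
Definition mps_mul a b : S := fun m =>
  \sum_(h : 'X_{1..n < (mdeg m).+1, (mdeg m).+1} | m == (h.1 + h.2)%MM)
    a h.1 * b h.2.

Definition mps_trunc (d : nat) a : {mpoly R[n]} :=
  \sum_(m : 'X_{1..n < d}) a m *: 'X_[m].

Lemma mps_truncE d a m : (mdeg m < d)%N -> (mps_trunc d a)@_m = a m.
Proof. exact: mcoeff_mpoly. Qed.

Lemma mps_mulE d a b m : (mdeg m < d)%N ->
  mps_mul a b m = (mps_trunc d a * mps_trunc d b)@_m.
Proof.
move=> lt_md; rewrite mcoeffM; apply: eq_bigr => h _.
by rewrite !mps_truncE //; apply: leq_trans (bmdeg _) lt_md.
Qed.

Lemma mcoeffM_eq (p p' q q' : {mpoly R[n]}) m :
    (forall i, (mdeg i <= mdeg m)%N -> p@_i = p'@_i) ->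
    (forall i, (mdeg i <= mdeg m)%N -> q@_i = q'@_i) ->
  (p * q)@_m = (p' * q')@_m.
Proof.
move=> hp hq; rewrite !mcoeffM; apply: eq_bigr => h _.
by rewrite hp ?hq // -ltnS bmdeg.
Qed.

Fact mps_addA : associative mps_add.
Proof. by move=> a b c; apply/funext => m; apply: addrA. Qed.
Fact mps_addC : commutative mps_add.
Proof. by move=> a b; apply/funext => m; apply: addrC. Qed.
Fact mps_add0 : left_id (mps_const 0) mps_add.
Proof.
by move=> a; apply/funext => m; rewrite /mps_add /mps_const if_same add0r.
Qed.
Fact mps_addN : left_inverse (mps_const 0) mps_opp mps_add.
Proof.
move=> a; apply/funext => m.
by rewrite /mps_add /mps_opp /mps_const if_same addNr.
Qed.

HB.instance Definition _ :=
  GRing.isZmodule.Build S mps_addA mps_addC mps_add0 mps_addN.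

Fact mps_mulA : associative mps_mul.
Proof.
move=> a b c; apply/funext => m; rewrite !(mps_mulE (d := (mdeg m).+1)) //.
transitivity ((mps_trunc (mdeg m).+1 a * mps_trunc (mdeg m).+1 b
               * mps_trunc (mdeg m).+1 c)@_m).
  rewrite -mulrA; apply: mcoeffM_eq => // i le_im.
  by rewrite mps_truncE // (mps_mulE (d := (mdeg m).+1)).
apply: mcoeffM_eq => // i le_im.
by rewrite mps_truncE // (mps_mulE (d := (mdeg m).+1)).
Qed.

Fact mps_mulC : commutative mps_mul.
Proof.
move=> a b; apply/funext => m.
by rewrite !(mps_mulE (d := (mdeg m).+1)) // mulrC.
Qed.

Fact mps_mul1 : left_id (mps_const 1) mps_mul.
Proof.
move=> a; apply/funext => m; rewrite (mps_mulE (d := (mdeg m).+1)) //.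
transitivity ((1 * mps_trunc (mdeg m).+1 a)@_m).
  apply: mcoeffM_eq => // i le_im.
  by rewrite mps_truncE // mcoeff1 /mps_const; case: eqP.
by rewrite mul1r mps_truncE.
Qed.

Fact mps_mulDl : left_distributive mps_mul mps_add.
Proof.
move=> a b c; apply/funext => m; rewrite /mps_add /mps_mul -big_split /=.
by apply: eq_bigr => h _; rewrite mulrDl.
Qed.

Fact mps_oner_neq0 : mps_const 1 != mps_const 0.
Proof.
apply/eqP => /(congr1 (fun a : S => a 0%MM)).
by rewrite /mps_const eqxx; apply/eqP/oner_neq0.
Qed.

HB.instance Definition _ := GRing.Zmodule_isComNzRing.Build S
  mps_mulA mps_mulC mps_mul1 mps_mulDl mps_oner_neq0.

End PowerSeries.

Section PlaneCurve.
Context {k : fieldType}.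
Local Notation R := {mpoly k[3]}.
Local Notation K := {fraction R}.
Implicit Types (f : R) (v w : 'rV[k]_3).

(* A nonzero v : 'rV_3 stands for the point [v] of P^2; for nonzero v and w,
   [v] = [w] iff same_point v w. *)
Definition same_point v w := exists c : k, w = c *: v.

Definition singular_point f v :=
  [/\ v != 0, f.@[v 0] = 0 & forall i : 'I_3, (f^`M(i)).@[v 0] = 0].

(* Fractions a / b of forms of the same degree, b not vanishing at v and a
   satisfying N. *)
Definition local_fraction v (N : R -> Prop) (x : K) :=
  exists (d : nat) (a b : R),
    [/\ a \is d.-homog, b \is d.-homog, b.@[v 0] != 0, N a
      & x = tofrac a / tofrac b].

(* The local ring O of P^2 at [v], its maximal ideal m, and the ideal of the
   curve V(f) in it. *)
Definition local_ring v := local_fraction v (fun=> True).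
Definition local_max v := local_fraction v (fun a => a.@[v 0] = 0).
Definition local_curve f v := local_fraction v (fun a => exists g, a = f * g).

(* The ideal local_curve f v + m ^ n, i.e. the kernel of
   O -> O_{X,[v]} / (max ideal) ^ n for X = V(f). *)
Definition local_nbhd f v (n : nat) (x : K) :=
  exists y z : K, [/\ local_curve f v y,
    ideal_pow (local_ring v) (local_max v) n z & x = y + z].

(* Representatives x : nat -> K of the elements of the completed local ring
   lim_n O_{X,[v]} / (max ideal) ^ n, and their equality there. *)
Definition completion_elt f v (x : nat -> K) :=
  (forall n, local_ring v (x n)) /\
  (forall n, local_nbhd f v n (x n.+1 - x n)).
Definition completion_eq f v (x y : nat -> K) :=
  forall n, local_nbhd f v n (x n - y n).

(* phi induces an isomorphism of k-algebras from k[[u, v]] / (u v) onto the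
   completed local ring. *)
Definition nodal_point f v :=
  exists phi : mpowser 2 k -> nat -> K,
    [/\ forall a, completion_elt f v (phi a),
        [/\ forall a b,
              completion_eq f v (phi (a + b)) (fun n => phi a n + phi b n),
            forall a b,
              completion_eq f v (phi (a * b)) (fun n => phi a n * phi b n)
          & forall c : k,
              completion_eq f v (phi (mps_const c)) (fun=> tofrac c%:MP)],
        forall x, completion_elt f v x ->
          exists a, completion_eq f v (phi a) x
      & forall a, completion_eq f v (phi a) (fun=> 0) <->
          exists b, a = mps_var ord0 * mps_var ord_max * b].

End PlaneCurve.

(* Main.v *)
(* Let J be the gradient ideal of f and e the initial degree of Syz(J).
   Counting dimensions in the complexes Syz_n -> R_n^3 -> J_(n+d) and
   R(-e) -> Syz -> I(e - d) gives Bour + deg R/J + e d = e^2 + d^2.  As e <= d,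
   Bour = d^2 - 1 forces deg R/J <= 1.  If J had no zero, then J would contain
   all forms of large degree, Syz would start in degree d and deg R/J would be
   1, not 0; so J defines exactly one reduced point [v].  Conversely, suppose
   that J defines one reduced point.  Two general combinations g1, g2 of the
   partials are a regular sequence.  If the third coefficient c of a syzygy of
   degree < d is nonzero, then c times the ideal of [v] lies in (g1, g2), which is
   impossible by degree except that c may divide g1 and g2, against regularity
   (conics, where deg c = 0, are treated apart).  Hence e = d, the Koszul syzygy
   of g1 and g2 is a generator, and the dimension count gives Bour = d^2 - 1.

   At a singular point, f = a X^2 + b X Y + c Y^2 with X, Y linear forms
   vanishing at v.  Both "J defines the reduced point [v]" and "[v] is a node"
   amount to b^2 - 4 a c <> 0 at v: for J because the partials along X and Y are,
   up to higher order, the derivatives of this quadratic form; for nodes by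
   Hensel lifting of the factorization of the tangent cone and, conversely, by
   comparing 2-jets. *)
Require Import Defs.
From HB Require Import structures.
From mathcomp Require Import all_boot all_order all_algebra.
From mathcomp Require Import boolp mpoly.
From mathcomp Require classical_sets.
From mathcomp Require Import ring zify.

Set Implicit Arguments.
Unset Strict Implicit.
Unset Printing Implicit Defensive.

Import GRing.Theory.
Local Open Scope ring_scope.

(** * Ideals and forms *)

(** The geometry is reached by linear algebra on forms. Zeros of ideals come from eigenvectors: let
    M be maximal among the homogeneous ideals containing no full space of forms of one degree, and
    X_i0 outside M; then multiplication by X_i / X_i0 acts on some (R/M)_N, and an eigenvalue is a
    coordinate of a zero. General combinations g1, g2 are chosen on a line X_i = 0 missing [v],
    where the partials become polynomials in one variable without common zero; (X_i, g1, g2) is then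
    regular, which gives both the Koszul property and saturation with respect to X_i. When e = d,
    the Bourbaki ideal is the colon ideal ((g1, g2) : f_z). Its codimension is at least two by the
    regular pair, and at most two because a longer chain of primes would produce four algebraically
    independent polynomials in three variables, which counting monomials excludes. Membership in m^n
    is refuted on lines through v, where an element of m^n vanishes to order n. Multiplicities are
    values of the Hilbert function: it is bounded, so the Hilbert polynomial is constant. *)

Lemma zorn_above (T : Type) (C : (T -> Prop) -> Prop) (I0 : T -> Prop) :
    C I0 ->
    (forall F : (T -> Prop) -> Prop, (exists X, F X) ->
       (forall X, F X -> C X) ->
       (forall X Y, F X -> F Y ->
          (forall a, X a -> Y a) \/ (forall a, Y a -> X a)) ->
       C (fun a => exists2 X, F X & X a)) ->
  exists M, [/\ C M, forall a, I0 a -> M a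
    & forall N, C N -> (forall a, M a -> N a) -> forall a, N a -> M a].
Proof.
move=> C0 Cchain.
pose S := {M : T -> Prop | C M /\ (forall a, I0 a -> M a)}.
pose s0 : S := exist _ I0 (conj C0 (fun a h => h)).
pose rle (X Y : S) : bool := `[< forall a, sval X a -> sval Y a >].
have [||F totF|M maxM] := @classical_sets.ZL_preorder S s0 rle.
- by move=> X; apply/asboolP.
- by move=> X Y Z /asboolP h1 /asboolP h2; apply/asboolP=> a /h1 /h2.
- case: (pselect (exists X, F X)) => [[X0 FX0]|nF]; last first.
    by exists s0 => s Fs; case: nF; exists s.
  pose G (X : T -> Prop) := exists2 s, F s & sval s = X.
  have CU : C (fun a => exists2 X, G X & X a).
    apply: Cchain; first by exists (sval X0), X0.
      by move=> X [s _ <-]; case: (svalP s).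
    move=> X Y [s Fs <-] [t Ft <-].
    by case: (totF _ _ Fs Ft) => /asboolP h; [left | right].
  have U0 a : I0 a -> exists2 X, G X & X a.
    by move=> h; exists (sval X0); [exists X0 | case: (svalP X0) => _; apply].
  by exists (exist (fun M => C M /\ forall a, I0 a -> M a) _ (conj CU U0)) => s Fs;
    apply/asboolP => a sa; exists (sval s) => //; exists s.
case: M maxM => M [CM IM] maxM; exists M; split=> // N CN MN.
have h := maxM (exist (fun M => C M /\ forall a, I0 a -> M a) N
  (conj CN (fun a Ia => MN a (IM a Ia)))).
by have /asboolP := h (introT (asboolP _) MN).
Qed.

Section Ideals.
Variable A : comPzRingType.
Implicit Types (I J : A -> Prop) (S : A -> Prop).

Lemma ideal_opp I a : is_ideal I -> I a -> I (- a).
Proof. by case=> _ _ hM h; rewrite -mulN1r; apply: hM. Qed.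

Lemma ideal_sub I a b : is_ideal I -> I a -> I b -> I (a - b).
Proof. by move=> hI ha hb; case: (hI) => _ hD _; apply: hD => //; apply: ideal_opp. Qed.

Lemma ideal_mulr I a b : is_ideal I -> I a -> I (a * b).
Proof. by case=> _ _ hM ha; rewrite mulrC; apply: hM. Qed.

Lemma ideal_sum I (T : Type) (r : seq T) (P : pred T) (F : T -> A) :
  is_ideal I -> (forall i, P i -> I (F i)) -> I (\sum_(i <- r | P i) F i).
Proof.
by case=> h0 hD _ hF; apply: (big_ind I) => // i Pi; apply: hF.
Qed.

Lemma chain_union_ideal (F : (A -> Prop) -> Prop) :
    (exists X, F X) -> (forall X, F X -> is_ideal X) ->
    (forall X Y, F X -> F Y ->
       (forall a, X a -> Y a) \/ (forall a, Y a -> X a)) ->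
  is_ideal (fun a => exists2 X, F X & X a).
Proof.
move=> [X0 FX0] FI tot; split.
- by exists X0 => //; case: (FI _ FX0).
- move=> a b [X FX Xa] [Y FY Yb].
  case: (tot _ _ FX FY) => h.
    by exists Y => //; case: (FI _ FY) => _ hD _; apply: hD => //; apply: h.
  by exists X => //; case: (FI _ FX) => _ hD _; apply: hD => //; apply: h.
- by move=> a b [X FX Xb]; exists X => //; case: (FI _ FX) => _ _; apply.
Qed.

Definition adjoin I a x := exists i c, I i /\ x = i + c * a.

Lemma adjoin_ideal I a : is_ideal I -> is_ideal (adjoin I a).
Proof.
move=> hI; case: (hI) => h0 hD hM; split.
- by exists 0, 0; rewrite mul0r addr0.
- move=> x y [i [c [Ii ->]]] [j [e [Ij ->]]].
  by exists (i + j), (c + e); split; [apply: hD | rewrite mulrDl addrACA].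
- move=> x y [i [c [Ii ->]]].
  by exists (x * i), (x * c); split; [apply: hM | rewrite mulrDr mulrA].
Qed.

Lemma adjoin_sub I a x : I x -> adjoin I a x.
Proof. by move=> h; exists x, 0; rewrite mul0r addr0. Qed.

Lemma adjoin_mem I a : is_ideal I -> adjoin I a a.
Proof. by case=> h0 _ _; exists 0, 1; rewrite mul1r add0r. Qed.

(* By Zorn: an ideal maximal among those avoiding S is prime. *)
Lemma prime_avoiding I S :
    is_ideal I -> S 1 -> (forall a b, S a -> S b -> S (a * b)) ->
    (forall a, S a -> ~ I a) ->
  exists P, [/\ is_prime_ideal P, forall a, I a -> P a
    & forall a, S a -> ~ P a].
Proof.
move=> hI S1 SM dis.
pose C X := is_ideal X /\ (forall a, S a -> ~ X a).
have Cchain F : (exists X, F X) -> (forall X, F X -> C X) ->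
    (forall X Y, F X -> F Y ->
       (forall a, X a -> Y a) \/ (forall a, Y a -> X a)) ->
    C (fun a => exists2 X, F X & X a).
  move=> exF FC tot; split; first by apply: chain_union_ideal => // X /FC[].
  by move=> a Sa [X FX Xa]; case: (FC _ FX) => _ /(_ a Sa).
have [P [[PI PS] IP maxP]] := zorn_above (conj hI dis : C I) Cchain.
exists P; split=> //; split=> //; first exact: PS.
move=> a b Pab.
have key c : ~ P c -> exists2 s, S s & adjoin P c s.
  move=> nPc; case: (pselect (exists2 s, S s & adjoin P c s)) => // nS.
  case: nPc; apply: (maxP (adjoin P c)) => //.
  - split; first exact: adjoin_ideal.
    by move=> s Ss Ps; apply: nS; exists s.
  - exact: adjoin_sub.
  - exact: adjoin_mem.
case: (pselect (P a)) => [|/key[s Ss [i [c [Pi es]]]]]; first by left.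
case: (pselect (P b)) => [|/key[t St [j [e [Pj et]]]]]; first by right.
case: (PS _ (SM _ _ Ss St)); rewrite es et.
case: (PI) => _ hD hM.
rewrite mulrDl mulrDr -addrA; apply: (hD); first exact: hM.
apply: (hD); first exact: ideal_mulr.
rewrite mulrDr; apply: (hD); first exact: hM.
by rewrite mulrACA; apply: hM.
Qed.

End Ideals.

Section VectorSpaces.
Variables (F : fieldType) (V : vectType F).

(** Ideals are [Prop]-valued predicates, whereas dimensions require a [{vspace V}]. A subspace of
    largest dimension inside [Q] contains every vector of [Q], since adjoining a missing one would
    enlarge it. *)
Lemma vspace_of_pred (Q : V -> Prop) :
    Q 0 -> (forall a u v, Q u -> Q v -> Q (a *: u + v)) ->
  exists U : {vspace V}, forall u, u \in U <-> Q u.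
Proof.
move=> Q0 QL.
pose C n := `[< exists2 U : {vspace V}, \dim U = n & forall u, u \in U -> Q u >].
have exC : exists n, C n.
  exists 0%N; apply/asboolP; exists 0%VS; first exact: dimv0.
  by move=> u; rewrite memv0 => /eqP ->.
have ubC n : C n -> (n <= dim V)%N.
  by move=> /asboolP[U <- _]; rewrite -dimvf dimvS ?subvf.
case: (ex_maxnP exC ubC) => n /asboolP[U dU UQ] maxn.
exists U => u; split; first exact: UQ.
move=> Qu; have : (U == U + <[u]>)%VS.
  rewrite eqEdim addvSl /= dU; apply: maxn; apply/asboolP.
  exists (U + <[u]>)%VS => // w /memv_addP[w1 w1U [w2 /vlineP[c ->] ->]].
  by rewrite addrC; apply: QL => //; apply: UQ.
by move/eqP->; rewrite -{1}[u]add0r memv_add ?mem0v ?memv_line.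
Qed.

End VectorSpaces.

Section Forms.
Variables (n : nat) (k : fieldType).
Local Notation R := {mpoly k[n]}.
Implicit Types (p q : R) (I : R -> Prop).

Lemma homog_ind (P : R -> Prop) d :
    P 0 -> (forall p q, P p -> P q -> P (p + q)) ->
    (forall c m, mdeg m = d -> P (c *: 'X_[m])) ->
  forall p, p \is d.-homog -> P p.
Proof.
move=> P0 PD PX p /dhomogP hp; rewrite [p]mpolyE big_seq.
by apply: (big_ind P) => // m /hp /PX.
Qed.

Lemma mpolyX_divX (m : 'X_{1..n}) i : m i != 0%N ->
  'X_[m] = 'X_i * 'X_[m - U_(i)] :> R.
Proof. by move=> h; rewrite -mpolyXD addmC submK // lep1mP. Qed.

Lemma mdeg_subU (m : 'X_{1..n}) i d : m i != 0%N -> mdeg m = d.+1 ->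
  mdeg (m - U_(i))%MM = d.
Proof.
move=> h e; have /(congr1 (@mdeg n)) : (m - U_(i) + U_(i))%MM = m.
  by rewrite submK // lep1mP.
by rewrite mdegD mdeg1 addn1 e => -[].
Qed.

Lemma mdegS_neq0 (m : 'X_{1..n}) d : mdeg m = d.+1 -> exists i, m i != 0%N.
Proof.
move=> e; case: (pickP (fun i => m i != 0%N)) => [i hi|h]; first by exists i.
move: e; rewrite mdegE big1 // => i _.
by have /= := h i; case: eqP.
Qed.

Lemma homog_split d p : p \is d.+1.-homog ->
  exists q : 'I_n -> R, (forall i, q i \is d.-homog) /\ p = \sum_i 'X_i * q i.
Proof.
move: p; apply: homog_ind.
- exists (fun=> 0); split; first by move=> i; rewrite rpred0.
  by rewrite big1 // => i _; rewrite mulr0.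
- move=> p q [a [ha ->]] [b [hb ->]]; exists (fun i => a i + b i); split.
    by move=> i; rewrite rpredD.
  by rewrite -big_split; apply: eq_bigr => i _; rewrite mulrDr.
- move=> c m e; case: (mdegS_neq0 e) => i hi.
  exists (fun j => if j == i then c *: 'X_[m - U_(i)] else 0); split.
    move=> j; case: eqP => _; last exact: rpred0.
    by rewrite rpredZ // dhomogX /= (mdeg_subU hi e).
  rewrite (bigD1 i) //= eqxx big1 ?addr0; last first.
    by move=> j /negPf ->; rewrite mulr0.
  by rewrite (mpolyX_divX hi) scalerAr.
Qed.

Lemma homog0_const p : p \is 0.-homog -> p = (p@_0%MM)%:MP.
Proof.
move=> hp; apply/mpolyP => m; rewrite mcoeffC.
case: (m =P 0%MM) => [->|/eqP h]; first by rewrite mulr1.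
by rewrite mulr0; apply: (dhomog_nemf_coeff hp); rewrite mdeg_eq0.
Qed.


Lemma dhomogC c : (c%:MP : R) \is 0.-homog.
Proof. by rewrite -[c]mulr1 mpolyCM mul_mpolyC rpredZ ?dhomog1. Qed.

Lemma dhomogU i : ('X_i : R) \is 1.-homog.
Proof. by rewrite dhomogX /= mdeg1. Qed.

Lemma mderiv_homog d p i : p \is d.+1.-homog -> p^`M(i) \is d.-homog.
Proof.
move: p; apply: homog_ind => [|p q|c m e]; first by rewrite raddf0 rpred0.
  by rewrite raddfD /=; apply: rpredD.
rewrite mderivZ mderivX scalerA.
case: (m i =P 0%N) => [->|/eqP hi]; first by rewrite mulr0 scale0r rpred0.
by rewrite rpredZ // dhomogX /= (mdeg_subU hi e).
Qed.

Lemma meval_scale d p (c : k) (v : 'I_n -> k) : p \is d.-homog ->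
  p.@[fun i => c * v i] = c ^+ d * p.@[v].
Proof.
move: p; apply: homog_ind => [|p q hp hq|a m e].
- by rewrite !meval0 mulr0.
- by rewrite !mevalD hp hq mulrDr.
- rewrite !mevalZ !mevalX mulrCA; congr (_ * _).
  under eq_bigr do rewrite exprMn.
  by rewrite big_split /= prodrXr -e mdegE.
Qed.

Lemma euler d p : p \is d.-homog -> \sum_i 'X_i * p^`M(i) = d%:R *: p.
Proof.
move: p; apply: homog_ind => [|p q hp hq|c m e].
- by rewrite scaler0 big1 // => i _; rewrite mderiv0 mulr0.
- rewrite scalerDr -hp -hq -big_split; apply: eq_bigr => i _.
  by rewrite mderivD mulrDr.
- rewrite (eq_bigr (fun i => (m i)%:R *: (c *: 'X_[m]))).
    by rewrite -scaler_suml -natr_sum -mdegE e.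
  move=> i _; rewrite mderivZ mderivX.
  case: (m i =P 0%N) => [->|/eqP hi]; first by rewrite !scale0r scaler0 mulr0.
  by rewrite (mpolyX_divX hi) -!scalerAr !scalerA mulrC.
Qed.

Lemma pihomog_sum_neq p (v : 'I_n -> k) : p.@[v] != 0 ->
  exists d, (pihomog mdeg d p).@[v] != 0.
Proof.
move=> h; case: (pselect (exists d, (pihomog mdeg d p).@[v] != 0)) => // nh.
move: h; rewrite [p](@pihomog_partitionE _ _ mdeg (msize p)) // raddf_sum.
rewrite big1 ?eqxx // => i _; apply/eqP/negPn/negP => h.
by apply: nh; exists i.
Qed.

Lemma pihomogM d e p q : q \is e.-homog ->
  pihomog mdeg (d + e) (p * q) = pihomog mdeg d p * q.
Proof.
move=> hq; rewrite {1}[p](@pihomog_partitionE _ _ mdeg (maxn (msize p) d.+1));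
  last by rewrite leq_maxl.
rewrite mulr_suml raddf_sum /=.
have ld : (d < maxn (msize p) d.+1)%N by rewrite leq_maxr.
rewrite (bigD1 (Ordinal ld)) //= big1 ?addr0.
  by rewrite pihomog_dE // dhomogM ?pihomogP.
move=> i ne; apply: (@pihomog_ne0 _ _ _ (i + e)%N).
  by rewrite eqn_add2r; apply: contraNneq ne => h; apply/eqP/val_inj.
by rewrite dhomogM ?pihomogP.
Qed.

Lemma pihomogM_lt d e p q : q \is e.-homog -> (d < e)%N ->
  pihomog mdeg d (p * q) = 0.
Proof.
move=> hq lt; rewrite {1}[p](@pihomog_partitionE _ _ mdeg (msize p)) //.
rewrite mulr_suml raddf_sum /= big1 // => i _.
apply: (@pihomog_ne0 _ _ _ (i + e)%N); last by rewrite dhomogM ?pihomogP.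
by rewrite gtn_eqF // ltn_addl.
Qed.

(** For an ideal, this means containing the d-th power of the irrelevant ideal. *)
Definition forms_in I d := forall p, p \is d.-homog -> I p.

Lemma forms_inS I d e : is_ideal I -> forms_in I d -> (d <= e)%N -> forms_in I e.
Proof.
move=> hI h /subnK <-; elim: (e - d)%N => [//|m IH] p.
rewrite addSn => /homog_split[q [hq ->]].
apply: ideal_sum => // i _; case: hI => _ _; apply; apply: IH; exact: hq.
Qed.

End Forms.

(** * The Hilbert function as the codimension of a space of forms *)

Section HilbertFunction.
Variables (n : nat) (k : fieldType).
Local Notation R := {mpoly k[n.+1]}.
Implicit Types (I : R -> Prop).

Lemma form_space_exists I d : is_ideal I ->
  exists U : {vspace dhomog n.+1 k d}, forall u, u \in U <-> I (val u).
Proof.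
move=> [I0 ID IM]; apply: vspace_of_pred => // a u v hu hv.
by rewrite /= -mul_mpolyC; apply: ID => //; apply: IM.
Qed.

Definition form_space I (hI : is_ideal I) d := projT1 (cid (form_space_exists d hI)).

Lemma form_spaceP I (hI : is_ideal I) d u : u \in form_space hI d <-> I (val u).
Proof. exact: (projT2 (cid (form_space_exists d hI))). Qed.

Lemma dim_forms d : \dim (fullv : {vspace dhomog n.+1 k d}) = 'C(d + n, d).
Proof. exact: dimvf. Qed.

(** The residues of the [b i] form a basis exactly when the [b i] span a complement of I_d in R_d
    and are independent; conversely a basis of the complement [U^C] serves as [b]. *)
Lemma hilbert_valueP I (hI : is_ideal I) d h :
  hilbert_value I d h <-> (\dim (form_space hI d) + h = 'C(d + n, d))%N.
Proof.
have D0 : (0 : R) \is d.-homog by rewrite rpred0.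
rewrite -dim_forms; set U := form_space hI d; split.
- case=> b [hb ub]; pose b' i : dhomog n.+1 k d := DHomog (hb i).
  have sumE (c : 'rV_h) : val (\sum_i c 0 i *: b' i) = \sum_i c 0 i *: b i.
    by rewrite (raddf_sum (@mpoly_of_dhomog n.+1 k d)).
  have zero_c (c : 'rV_h) : I (\sum_i c 0 i *: b i) -> c = 0.
    move=> hc; have [c0 [_ uc]] := ub 0 D0.
    rewrite -(uc c) ?sub0r; last exact: ideal_opp.
    apply/esym; rewrite -(uc 0) // sub0r big1 ?oppr0; first by case: (hI).
    by move=> i _; rewrite mxE scale0r.
  pose B := [tuple b' i | i < h].
  have spanB v : v \in <<B>>%VS -> exists c : 'rV_h, v = \sum_i c 0 i *: b' i.
    move=> /coord_span ->; exists (\row_i coord B i v).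
    by apply: eq_bigr => i _; rewrite mxE -tnth_nth tnth_mktuple.
  have freeB : free B.
    apply/freeP => c hc i.
    have : (\row_i c i : 'rV_h) = 0.
      apply: zero_c; rewrite -sumE.
      suff -> : \sum_i (\row_i0 c i0) 0 i *: b' i = 0 by case: (hI).
      rewrite -[RHS]hc; apply: eq_bigr => j _.
      by rewrite mxE -tnth_nth tnth_mktuple.
    by move/rowP/(_ i); rewrite !mxE.
  have dimB : \dim <<B>>%VS = h by move/eqP: freeB => ->; rewrite size_tuple.
  rewrite -{1}dimB -dimv_disjoint_sum.
    congr (\dim _); apply/eqP; rewrite eqEsubv subvf /=.
    apply/subvP => p _; have [c [hc _]] := ub (val p) (valP p).
    rewrite -(subrK (\sum_i c 0 i *: b' i) p) memv_add //.
      apply/form_spaceP; rewrite -sumE in hc; exact: hc.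
    apply: rpred_sum => i _; apply: rpredZ; apply: memv_span.
    by rewrite -(tnth_mktuple b' i) mem_tnth.
  apply/eqP; rewrite -subv0; apply/subvP => v /memv_capP[vU /spanB[c ec]].
  rewrite memv0 ec (zero_c c).
    by apply/eqP; rewrite big1 // => i _; rewrite mxE scale0r.
  by rewrite -sumE -ec; apply/form_spaceP.
- move=> dimU; have dW : \dim U^C = h by rewrite dimv_compl -dimU addKn.
  pose b' (i : 'I_h) : dhomog n.+1 k d := (vbasis (U^C)%VS)`_i.
  have hW v : v \in (U^C)%VS -> exists c : 'rV_h, v = \sum_i c 0 i *: b' i.
    move=> hv; rewrite /b' -dW; exists (\row_i coord (vbasis (U^C)%VS) i v).
    by rewrite {1}(coord_vbasis hv); apply: eq_bigr => i _; rewrite mxE.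
  have bW i : b' i \in (U^C)%VS.
    by apply: vbasis_mem; apply: mem_nth; rewrite size_tuple dW.
  have fb (c : 'rV_h) : \sum_i c 0 i *: b' i = 0 -> c = 0.
    rewrite /b'; move: c; rewrite -dW => c hc; apply/rowP => i; rewrite mxE.
    by have /freeP/(_ (fun i => c 0 i) hc i) := basis_free (vbasisP (U^C)%VS).
  have sumE (c : 'rV_h) :
      val (\sum_i c 0 i *: b' i) = \sum_i c 0 i *: (b' i : R).
    by rewrite (raddf_sum (@mpoly_of_dhomog n.+1 k d)).
  exists (fun i => b' i : R); split; first by move=> i; apply: valP.
  move=> p hp; pose p' : dhomog n.+1 k d := DHomog hp.
  have : p' \in (U + U^C)%VS by rewrite addv_complf memvf.
  case/memv_addP=> u uU [w /hW[c ec] ep]; exists c; split.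
    rewrite -sumE -ec -[p]/(val p') ep /= addrK; exact/form_spaceP.
  move=> c' hc'; apply/eqP; rewrite -subr_eq0; apply/eqP/fb.
  set w' := \sum_i _; apply/eqP; rewrite -memv0 -(capv_compl U) memv_cap.
  apply/andP; split; last by apply: rpred_sum => i _; apply: rpredZ.
  have -> : w' = (p' - \sum_i c' 0 i *: b' i) - u.
    rewrite ep ec addrAC [u + _]addrC addrK -sumrB; apply: eq_bigr => i _.
    by rewrite !mxE scalerBl.
  rewrite rpredB //; apply/form_spaceP; move: hc'; rewrite -sumE; exact.
Qed.

End HilbertFunction.

(** * Homogeneous ideals maximal among those containing no full space of forms *)

Section HomogIdeals.
Variables (n : nat) (k : fieldType).
Local Notation R := {mpoly k[n]}.
Implicit Types (I M : R -> Prop).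

Lemma ideal_scale I (c : k) p : is_ideal I -> I p -> I (c *: p).
Proof. by case=> _ _ h; rewrite -mul_mpolyC; apply: h. Qed.

(** Products of forms of degrees N and N' span the forms of degree N + N'. Peeling a variable off
    the first factor replaces [I] by the colon ideal (I : X_i), so the induction runs over all
    ideals. *)
Lemma forms_in_mul I N N' : is_ideal I ->
    (forall p q, p \is N.-homog -> q \is N'.-homog -> I (p * q)) ->
  forms_in I (N + N').
Proof.
elim: N I => [|N IH] I hI h p.
  by move=> hp; rewrite -[p]mul1r; apply: h => //; apply: dhomog1.
rewrite addSn => /homog_split[q [hq ->]]; apply: ideal_sum => // i _.
pose I' p := I ('X_i * p); have hI' : is_ideal I'.
  case: (hI) => h0 hD hM; split; first by rewrite /I' mulr0.
    by move=> a b; rewrite /I' mulrDr; apply: hD.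
  by move=> a b; rewrite /I' mulrCA; apply: hM.
apply: (IH I') => // p' q' hp' hq'; rewrite /I' mulrA; apply: h => //.
by rewrite -add1n dhomogM ?dhomogU.
Qed.

Lemma adjoin_homog I a e : is_homog_ideal I -> a \is e.-homog ->
  is_homog_ideal (adjoin I a).
Proof.
move=> [hI hH] ha; split; first exact: adjoin_ideal.
move=> p d [i [c [Ii ->]]]; rewrite pihomogD.
case: (leqP e d) => [led|ltd].
  exists (pihomog mdeg d i), (pihomog mdeg (d - e) c).
  by split; [apply: hH | rewrite -{2}(subnK led) pihomogM].
by rewrite (pihomogM_lt _ ha) // addr0; apply: adjoin_sub; apply: hH.
Qed.

Lemma adjoin_decomp I a e d p : is_homog_ideal I -> a \is e.-homog ->
    p \is (d + e).-homog -> adjoin I a p ->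
  exists2 c, c \is d.-homog & I (p - c * a).
Proof.
move=> [hI hH] ha hp [i [c [Ii ep]]].
exists (pihomog mdeg d c); first exact: pihomogP.
rewrite -(pihomogM _ _ ha) -(pihomog_dE hp) {1}ep -pihomogB addrK; exact: hH.
Qed.

Lemma chain_finite_mem (F : (R -> Prop) -> Prop) (s : seq R) :
    (exists X, F X) ->
    (forall X Y, F X -> F Y ->
       (forall a, X a -> Y a) \/ (forall a, Y a -> X a)) ->
    (forall a, a \in s -> exists2 X, F X & X a) ->
  exists2 X, F X & forall a, a \in s -> X a.
Proof.
move=> exF tot; elim: s => [|a s IH] h; first by case: exF => X; exists X.
have [X FX hX] : exists2 X, F X & forall b, b \in s -> X b.
  by apply: IH => b hb; apply: h; rewrite inE hb orbT.
have [Y FY Ya] : exists2 Y, F Y & Y a by apply: h; rewrite mem_head.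
case: (tot _ _ FX FY) => hXY.
  by exists Y => // b; rewrite inE => /orP[/eqP->|/hX/hXY].
by exists X => // b; rewrite inE => /orP[/eqP->|/hX//]; apply: hXY.
Qed.

(** Forms of degree N are spanned by finitely many monomials, and finitely many elements of the
    union of a chain lie in one member. So the property of containing no full degree passes to
    unions, as Zorn's lemma requires. *)
Lemma chain_forms_in (F : (R -> Prop) -> Prop) N :
    (exists X, F X) -> (forall X, F X -> is_ideal X) ->
    (forall X Y, F X -> F Y ->
       (forall a, X a -> Y a) \/ (forall a, Y a -> X a)) ->
    forms_in (fun a => exists2 X, F X & X a) N ->
  exists2 X, F X & forms_in X N.
Proof.
move=> exF FI tot h.
pose s : seq R := [seq 'X_[bmnm m]
    | m <- enum {: 'X_{1..n < N.+1}} & mdeg (bmnm m) == N].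
have [|X FX hX] := @chain_finite_mem F s exF tot.
  by move=> a /mapP[m]; rewrite mem_filter => /andP[/eqP e _] ->; apply: h;
    rewrite dhomogX /= e.
exists X => //; apply: homog_ind; first by case: (FI _ FX).
  by move=> p q; case: (FI _ FX) => _ h' _; apply: h'.
move=> c m e; apply: ideal_scale; first exact: FI.
have lt : (mdeg m < N.+1)%N by rewrite e.
apply: hX; apply/mapP; exists (BMultinom lt) => //.
by rewrite mem_filter /= e eqxx mem_enum.
Qed.

Section Maximal.
Variable M : R -> Prop.
Hypotheses (hM : is_homog_ideal M) (properM : forall N, ~ forms_in M N).
Hypothesis maxM : forall N, is_homog_ideal N -> (forall j, ~ forms_in N j) ->
  (forall a, M a -> N a) -> forall a, N a -> M a.

Let idM : is_ideal M. Proof. by case: hM. Qed.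

Lemma max_adjoin a e : a \is e.-homog -> ~ M a -> exists N, forms_in (adjoin M a) N.
Proof.
move=> ha nMa; case: (pselect (exists N, forms_in (adjoin M a) N)) => // h.
case: nMa; apply: (maxM (adjoin_homog hM ha)); last exact: adjoin_mem.
  by move=> j hj; apply: h; exists j.
exact: adjoin_sub.
Qed.

(** If neither factor were in M, then M + (a) and M + (b) would contain all forms of degrees N and
    N'; products of these lie in M + (ab) = M, so M would contain all forms of degree N + N'. *)
Lemma max_prime a b d e : a \is d.-homog -> b \is e.-homog ->
  M (a * b) -> M a \/ M b.
Proof.
move=> ha hb Mab; case: (pselect (M a)) => [|/(max_adjoin ha)[N hN]]; first by left.
case: (pselect (M b)) => [|/(max_adjoin hb)[N' hN']]; first by right.
case: (properM (N := N + N')); apply: forms_in_mul => // p q /hN[i [c [Mi ->]]].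
move=> /hN'[j [c' [Mj ->]]].
case: (idM) => _ hD hMu; rewrite mulrDl; apply: (hD); first exact: ideal_mulr.
rewrite mulrDr; apply: (hD); first exact: hMu.
by rewrite mulrACA; apply: hMu.
Qed.

Lemma max_notin1 : ~ M 1.
Proof.
move=> M1; case: (properM (N := 0)) => p _.
by rewrite -[p]mulr1; case: idM => _ _; apply.
Qed.

Lemma max_exp a d e : a \is d.-homog -> M (a ^+ e) -> M a.
Proof.
move=> ha; elim: e => [/max_notin1//|e IH].
by rewrite exprS => /(max_prime ha (dhomogMn e ha))[|/IH].
Qed.

End Maximal.
End HomogIdeals.

(** * The projective Nullstellensatz *)

Section Nullstellensatz.
Variables (n : nat) (k : closedFieldType).
Local Notation R := {mpoly k[n.+1]}.
Implicit Types (Q M : R -> Prop).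

Section Maximal.
Variable M : R -> Prop.
Hypotheses (hM : is_homog_ideal M) (properM : forall N, ~ forms_in M N).
Hypothesis maxM : forall N, is_homog_ideal N -> (forall j, ~ forms_in N j) ->
  (forall a, M a -> N a) -> forall a, N a -> M a.

Let idM : is_ideal M. Proof. by case: hM. Qed.

Lemma max_var : exists i : 'I_n.+1, ~ M 'X_i.
Proof.
case: (pselect (exists i : 'I_n.+1, ~ M 'X_i)) => // h.
case: (properM (N := 1)) => p /homog_split[q [_ ->]].
apply: ideal_sum => // i _; apply: ideal_mulr => //.
by case: (pselect (M 'X_i)) => // h'; case: h; exists i.
Qed.

(** Since M + (X_i0) contains all forms of degree N, and hence N + 1, multiplication by X_i0 maps
    (R/M)_N onto (R/M)_(N+1). Thus X_i acts on (R/M)_N as X_i0 times a matrix. For an eigenvector w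
    of eigenvalue lam, (X_i - lam X_i0) w is in M and w is not, so primality puts the first factor
    in M. *)
Lemma max_proportional (i0 i : 'I_n.+1) : ~ M 'X_i0 ->
  exists lam : k, M ('X_i - lam *: 'X_i0).
Proof.
move=> nM; have [N hN] := max_adjoin hM maxM (dhomogU _ i0) nM.
pose U := form_space idM N; set W := (U^C)%VS; set h := \dim W.
(* (R/M)_N is nonzero because M contains no full degree; hence the characteristic polynomial is not
   constant and has a root. *)
have h0 : (0 < h)%N.
  rewrite lt0n; apply/negP; rewrite dimv_eq0 => /eqP W0.
  apply: (properM (N := N)) => p hp; have : (DHomog hp) \in fullv by rewrite memvf.
  by rewrite -(addv_complf U) -/W W0 addv0 => /form_spaceP.
pose b (j : 'I_h) : dhomog n.+1 k N := (vbasis W)`_j.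
have spanW w : w \in W -> exists c : 'rV_h, w = \sum_j c 0 j *: b j.
  move=> hw; exists (\row_j coord (vbasis W) j w).
  by rewrite {1}(coord_vbasis hw); apply: eq_bigr => j _; rewrite mxE.
have sumE (c : 'rV_h) : val (\sum_j c 0 j *: b j) = \sum_j c 0 j *: (b j : R).
  by rewrite (raddf_sum (@mpoly_of_dhomog n.+1 k N)).
(* Row j of [C] expresses X_i b_j, modulo M, as X_i0 times a combination of the basis [b] of the
   complement. *)
have /fin_all_exists[C hC] (j : 'I_h) : exists c : 'rV_h,
    M ('X_i * (b j : R) - (\sum_l c 0 l *: (b l : R)) * 'X_i0).
  have hXb : 'X_i * (b j : R) \is (N + 1).-homog.
    by rewrite addnC dhomogM ?dhomogU ?(valP (b j)).
  have [//|c hc Mc] := adjoin_decomp hM (dhomogU _ i0) hXb.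
    exact: (forms_inS (adjoin_ideal _ idM) hN (leq_addr 1 N)).
  have : (DHomog hc) \in fullv by rewrite memvf.
  rewrite -(addv_complf U) => /memv_addP[u uU [w /spanW[x ew] ec]].
  exists x; rewrite -sumE -ew.
  have -> : val w = c - val u by rewrite -[c]/(val (DHomog hc)) ec /= addrC addKr.
  rewrite mulrBl opprB addrCA; case: (idM) => _ hD _; apply: (hD) => //.
  by apply: ideal_mulr => //; apply/(form_spaceP idM).
have [lam] : exists lam, root (char_poly (\matrix_j C j)) lam.
  by apply/closed_rootP; rewrite size_char_poly eqSS -lt0n.
rewrite -eigenvalue_root_char => /eigenvalueP[u eu u0]; exists lam.
have [|||//|] := max_prime (M := M) hM properM maxM (a := 'X_i - lam *: 'X_i0)
    (b := \sum_j u 0 j *: (b j : R)) (d := 1) (e := N).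
- by rewrite rpredB ?rpredZ ?dhomogU.
- by apply: rpred_sum => j _; rewrite rpredZ // (valP (b j)).
- have -> : ('X_i - lam *: 'X_i0) * (\sum_j u 0 j *: (b j : R)) =
     \sum_j u 0 j *: ('X_i * (b j : R) - (\sum_l C j 0 l *: (b l : R)) * 'X_i0).
    rewrite mulrBl mulr_sumr.
    under [in RHS]eq_bigr do rewrite scalerBr [X in _ - X]scalerAl.
    rewrite sumrB -mulr_suml; congr (_ - _).
      by apply: eq_bigr => j _; rewrite scalerAr.
    rewrite -scalerAl mulrC scalerAl; congr (_ * _).
    under [in RHS]eq_bigr do rewrite scaler_sumr.
    rewrite exchange_big scaler_sumr; apply: eq_bigr => l _ /=.
    under eq_bigr do rewrite scalerA.
    rewrite -scaler_suml scalerA; congr (_ *: _).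
    have /rowP/(_ l) := eu; rewrite !mxE => <-.
    by apply: eq_bigr => j _; rewrite !mxE.
  by apply: ideal_sum => // j _; apply: ideal_scale.
- rewrite -sumE => /(form_spaceP idM) rU; case/negP: u0.
  have : \sum_j u 0 j *: b j \in (U :&: W)%VS.
    rewrite memv_cap rU; apply: rpred_sum => j _; apply: rpredZ.
    by apply: vbasis_mem; apply: mem_nth; rewrite size_tuple.
  rewrite capv_compl memv0 => /eqP hs.
  apply/eqP/rowP => j; rewrite mxE.
  by have /freeP/(_ (fun j => u 0 j) hs j) := basis_free (vbasisP W).
Qed.

(** Modulo M every variable is a multiple lam_i of X_i0, so the vector of the lam_i is the zero: a
    form of M not vanishing there would put a power of X_i0 in M. *)
Lemma max_zero : exists2 v : 'rV[k]_n.+1, v != 0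
  & forall d p, p \is d.-homog -> M p -> p.@[v 0] = 0.
Proof.
have [i0 nM] := max_var.
have /fin_all_exists[lam hlam] := fun i => max_proportional i nM.
exists (\row_i lam i).
  apply/eqP => /rowP/(_ i0); rewrite !mxE => h; apply: nM.
  by have := hlam i0; rewrite h scale0r subr0.
move=> d p hp Mp; apply/eqP/negPn/negP => pv0; apply: nM.
(* Modulo M, a form of degree e is its value at the point times X_i0^e. *)
have key e q : q \is e.-homog -> M (q - q.@[(\row_i lam i) 0] *: 'X_i0 ^+ e).
  elim: e q => [|e IH] q.
    move=> /homog0_const ->; rewrite mevalC expr0 -mul_mpolyC mulr1 subrr.
    by case: idM.
  move=> /homog_split[r [hr ->]]; rewrite raddf_sum scaler_suml -sumrB.
  apply: ideal_sum => // i _.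
  set w := (\row_i0 lam i0) 0.
  have -> : 'X_i * r i - ('X_i * r i).@[w] *: 'X_i0 ^+ e.+1 =
     'X_i * (r i - (r i).@[w] *: 'X_i0 ^+ e) +
     ('X_i - lam i *: 'X_i0) * ((r i).@[w] *: 'X_i0 ^+ e).
    rewrite mulrBr mulrBl addrA subrK mevalM mevalXU (_ : w i = lam i) ?mxE //.
    by rewrite exprS -scalerAl -scalerAr scalerA.
    by rewrite /w mxE.
  case: (idM) => _ hD hMu; apply: (hD); first by apply: hMu; apply: IH.
  exact: ideal_mulr.
have Mx : M (p.@[(\row_i lam i) 0] *: 'X_i0 ^+ d).
  rewrite -(subKr p (p.@[_] *: _)); apply: ideal_sub => //; exact: key.
apply: (max_exp hM properM maxM (e := d) (dhomogU _ i0)).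
by rewrite -['X_i0 ^+ d](scalerK pv0); apply: ideal_scale.
Qed.

End Maximal.

Lemma projective_nullstellensatz Q : is_homog_ideal Q ->
    (forall v : 'rV[k]_n.+1, v != 0 -> exists2 p, Q p & p.@[v 0] != 0) ->
  exists N, forms_in Q N.
Proof.
move=> hQ nz; case: (pselect (exists N, forms_in Q N)) => // nQ.
pose C (M : R -> Prop) := is_homog_ideal M /\ forall N, ~ forms_in M N.
have CQ : C Q by split=> // N h; apply: nQ; exists N.
have Cchain F : (exists X, F X) -> (forall X, F X -> C X) ->
    (forall X Y, F X -> F Y ->
       (forall a, X a -> Y a) \/ (forall a, Y a -> X a)) ->
    C (fun a => exists2 X, F X & X a).
  move=> exF FC tot; split; first split.
  - by apply: chain_union_ideal => // X /FC[[]].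
  - by move=> p d [X FX Xp]; exists X => //; case: (FC _ FX) => [[_ h] _]; apply: h.
  - move=> N /(chain_forms_in exF _ tot)[|X FX]; first by move=> X /FC[[]].
    by case: (FC _ FX) => _; apply.
have [M [[hM pM] QM maxM]] := zorn_above CQ Cchain.
have maxM' N : is_homog_ideal N -> (forall j, ~ forms_in N j) ->
  (forall a, M a -> N a) -> forall a, N a -> M a by move=> *; apply: (maxM N).
have [v v0 hv] := max_zero hM pM maxM'.
have [p Qp /pihomog_sum_neq[d]] := nz v v0.
rewrite (hv d) ?eqxx //; first exact: pihomogP.
by apply: QM; case: hQ => _; apply.
Qed.

End Nullstellensatz.

(** * The dimension count for the Bourbaki ideal *)

(** The map [g] is linear only on [S], because the maps below take a default value off the syzygies;
    composing with the projection onto [S] gives a globally linear map to which rank-nullity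
    applies. *)
Lemma rank_nullity_pred (F : fieldType) (V W : vectType F) (g : V -> W)
    (S K : {vspace V}) (T : {vspace W}) :
    (forall a u v, u \in S -> v \in S -> g (a *: u + v) = a *: g u + g v) ->
    (K <= S)%VS -> (forall u, u \in S -> (g u = 0 <-> u \in K)) ->
    (forall w, w \in T <-> exists2 u, u \in S & g u = w) ->
  (\dim K + \dim T = \dim S)%N.
Proof.
move=> gL KS gK gT.
pose h u := g (projv S u).
have hL : linear h.
  by move=> a u v; rewrite /h linearP gL ?memv_proj.
pose H := linfun (HB.pack_for {linear V -> W} h (GRing.isLinear.Build F V W _ h hL)).
have hE u : u \in S -> H u = g u by move=> uS; rewrite lfunE /= /h projv_id.
rewrite -(limg_ker_dim H S); congr (_ + _)%N.
  congr (\dim _); apply/vspaceP => u; rewrite memv_cap memv_ker; apply/idP/andP.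
    by move=> uK; have uS := subvP KS _ uK; rewrite uS hE //; have /gK[_ ->] := uS.
  by move=> [uS]; rewrite hE // => /eqP; have /gK[h1 _] := uS; apply: h1.
congr (\dim _); apply/vspaceP => w; apply/idP/memv_imgP.
  by move=> /gT[u uS <-]; exists u => //; rewrite hE.
by move=> [u uS ->]; apply/gT; exists u => //; rewrite hE.
Qed.

Lemma binDC m : ('C(m + 2, m) * 2 = m.+2 * m.+1)%N.
Proof.
by rewrite -bin_sub ?leq_addr // addKn addn2 mulnC -(mul_bin_diag m.+2 1) bin1.
Qed.

(** The binomials are quadratic polynomials in the degrees n, n - e, m = n + e - d and n + d; their
    terms in n cancel and leave the relation between the two Hilbert values. *)
Lemma binomial_count (d e m n h t : nat) : (e <= n)%N -> (m + d = n + e)%N ->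
    ('C(m + 2, m) + 'C(n - e + 2, n - e) + 'C(n + d + 2, n + d) =
     3 * 'C(n + 2, n) + h + t)%N ->
  (h + t + e * d = e ^ 2 + d ^ 2)%N.
Proof.
move=> le_en em; have := binDC m; have := binDC (n - e).
have := binDC (n + d); have := binDC n.
move: ('C(m + 2, m))%N ('C(n - e + 2, n - e))%N ('C(n + d + 2, n + d))%N.
move: ('C(n + 2, n))%N => A B C D hA hC hD hB eq.
move: le_en em hA hB hC hD eq => /subnKC; set q := (n - e)%N => <-.
rewrite !expnS !expn0 => em hA hB hC hD eq.
(* With n = e + q the degree m is q + 2e - d; it is eliminated over the integers, where the
   subtraction is not truncated. *)
have em' : m%:Z = (q%:Z + 2 * e%:Z - d%:Z)%R by lia.
have hB' : (B%:Z * 2 = (m%:Z + 2) * (m%:Z + 1))%R by lia.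
rewrite em' in hB'.
lia.
Qed.

Section Jacobian.
Variable k : fieldType.
Local Notation R := {mpoly k[3]}.
Implicit Types (f : R) (I : R -> Prop).

Definition jac f (p : R) := exists a : 'I_3 -> R, p = \sum_i a i * f^`M(i).

Lemma jac_ideal f : is_ideal (jac f).
Proof.
split; first by exists (fun=> 0); rewrite big1 // => i _; rewrite mul0r.
  move=> p q [a ->] [b ->]; exists (fun i => a i + b i).
  by rewrite -big_split; apply: eq_bigr => i _; rewrite mulrDl.
move=> p q [a ->]; exists (fun i => p * a i); rewrite mulr_sumr.
by apply: eq_bigr => i _; rewrite mulrA.
Qed.

Lemma jac_deriv f i : jac f f^`M(i).
Proof.
exists (fun j => (j == i)%:R); rewrite (bigD1 i) //= eqxx mul1r big1 ?addr0 //.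
by move=> j /negPf ->; rewrite mul0r.
Qed.

Lemma jac_homog_coef f d n p : f \is d.+1.-homog -> p \is (n + d).-homog ->
    jac f p -> exists a : 'I_3 -> R,
  (forall i, a i \is n.-homog) /\ p = \sum_i a i * f^`M(i).
Proof.
move=> hf hp [a ep]; exists (fun i => pihomog mdeg n (a i)); split.
  by move=> i; apply: pihomogP.
rewrite -(pihomog_dE hp) {1}ep raddf_sum; apply: eq_bigr => i _ /=.
by rewrite pihomogM // mderiv_homog.
Qed.

Lemma jac_homog f d : f \is d.+1.-homog -> is_homog_ideal (jac f).
Proof.
move=> hf; split; first exact: jac_ideal.
move=> p n [a ->]; rewrite raddf_sum; apply: ideal_sum; first exact: jac_ideal.
move=> i _; case: (leqP d n) => [le_dn|lt_nd] /=.
  rewrite -(subnK le_dn) pihomogM ?mderiv_homog //.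
  by case: (jac_ideal f) => _ _; apply; apply: jac_deriv.
by rewrite (pihomogM_lt _ (mderiv_homog i hf) lt_nd); case: (jac_ideal f).
Qed.

Section Degree.
Variables (f : R) (d e : nat) (eps : syz f) (I : R -> Prop).
Variable phi : {linear syz f -> R^o}.
Hypotheses (hf : f \is d.+1.-homog) (hI : is_homog_ideal I).
Hypotheses (heps : syz_homog e eps) (eps0 : eps != 0).
Hypothesis phiI : forall p : R, I p <-> exists s : syz f, phi s = p.
Hypothesis phi0 : forall s : syz f, phi s = 0 <-> exists a : R, s = a *: eps.
Hypothesis phi_deg : forall (n : nat) (s : syz f), syz_homog n s ->
  zhomog (n%:Z + e%:Z - d%:Z) (phi s : R).

Let idI : is_ideal I. Proof. by case: hI. Qed.

Local Notation V n := {ffun 'I_3 -> dhomog 3 k n}.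

Definition ffun_row n (u : V n) : 'rV[R]_3 := \row_i (u i : R).

Lemma syz_comp_proof n (s : syz f) :
  (\row_i pihomog mdeg n (syz_val s 0 i)) \in syz_pred f.
Proof.
have /eqP/(congr1 (pihomog mdeg (n + d))) := valP s.
rewrite raddf0 raddf_sum /= => hs; rewrite /in_mem /= /syz_pred -[X in _ == X]hs.
by apply/eqP/eq_bigr => i _; rewrite mxE /= pihomogM // mderiv_homog.
Qed.

Definition syz_comp n (s : syz f) := Syz (syz_comp_proof n s).

Lemma syz_comp_homog n s : syz_homog n (syz_comp n s).
Proof. by move=> i; rewrite mxE; apply: pihomogP. Qed.

Lemma syz_sum_comp (s : syz f) (N : nat) : (forall i : 'I_3, (msize (syz_val s 0%R i) <= N)%N) ->
  s = \sum_(n < N) syz_comp n s.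
Proof.
move=> hN; apply: val_inj; rewrite raddf_sum; apply/rowP => i /=.
rewrite summxE {1}[syz_val s 0 i](@pihomog_partitionE _ _ mdeg N) //.
by apply: eq_bigr => j _; rewrite mxE.
Qed.

Lemma phi_homog n m (s : syz f) : (m + d = n + e)%N -> syz_homog n s ->
  (phi s : R) \is m.-homog.
Proof.
by move=> h /phi_deg; have -> : n%:Z + e%:Z - d%:Z = m%:Z by lia.
Qed.

(** [phi] shifts degrees by e - d, so distinct components of [s] have images of distinct degrees; a
    component whose shifted degree would be negative is sent to 0 by the convention in [zhomog]. *)
Lemma phi_comp n m (s : syz f) : (m + d = n + e)%N ->
  (phi (syz_comp n s) : R) = pihomog mdeg m (phi s : R).
Proof.
move=> h; pose N := (maxn n.+1 (\max_i msize (syz_val s 0%R i))).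
have {2}-> : s = \sum_(j < N) syz_comp j s.
  apply: syz_sum_comp => i; rewrite /N leq_max; apply/orP; right.
  exact: (leq_bigmax i).
have nN : (n < N)%N by rewrite /N leq_max leqnn.
rewrite raddf_sum /= raddf_sum (bigD1 (Ordinal nN)) //= big1 ?addr0.
  by rewrite pihomog_dE //; apply: phi_homog (syz_comp_homog _ _).
move=> j ne; have := phi_deg (syz_comp_homog j s).
have nej : (val j != n) by apply: contraNneq ne => hj; apply/eqP/val_inj.
rewrite /zhomog; case E: (_ - _) => [m'|m']; last by move/eqP->; rewrite raddf0.
move=> hp; apply: pihomog_ne0 hp.
apply: contraNneq nej => hm; apply/eqP; move: E; rewrite hm /=; lia.
Qed.

Lemma indhomogK n (p : R) : p \is n.-homog -> val (indhomog n p) = p.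
Proof. by move=> hp; rewrite /indhomog insubdK. Qed.

Lemma indhomogP n a (p q : R) : p \is n.-homog -> q \is n.-homog ->
  indhomog n (a *: p + q) = a *: indhomog n p + indhomog n q.
Proof.
move=> hp hq; apply: val_inj; rewrite indhomogK ?rpredD ?rpredZ //=.
by rewrite !indhomogK.
Qed.

Lemma syz_space_exists n : exists S : {vspace V n},
  forall u, u \in S <-> ffun_row u \in syz_pred f.
Proof.
apply: vspace_of_pred => [|a u v hu hv].
  suff -> : ffun_row (0 : V n) = 0 by rewrite rpred0.
  by apply/rowP => i; rewrite !mxE ffunE.
suff -> : ffun_row (a *: u + v) = a%:MP *: ffun_row u + ffun_row v.
  by rewrite rpredD // rpredZ.
by apply/rowP => i; rewrite !mxE !ffunE /= mul_mpolyC.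
Qed.

Lemma dim_syz_jac n (S : {vspace V n}) :
    (forall u, u \in S <-> ffun_row u \in syz_pred f) ->
  (\dim S + \dim (form_space (jac_ideal f) (n + d)) = 3 * 'C(n + 2, n))%N.
Proof.
move=> hS; have hom (u : V n) : \sum_i (u i : R) * f^`M(i) \is (n + d).-homog.
  by apply: rpred_sum => i _; rewrite dhomogM ?mderiv_homog // (valP (u i)).
transitivity (\dim (fullv : {vspace V n})).
  pose g (u : V n) : dhomog 3 k (n + d) := indhomog (n + d) (\sum_i (u i : R) * f^`M(i)).
  apply: (rank_nullity_pred (g := g)) => [a u v _ _||u _|w].
  - rewrite -indhomogP //; congr indhomog; rewrite scaler_sumr -big_split.
    by apply: eq_bigr => i _; rewrite !ffunE /= mulrDl scalerAl.
  - exact: subvf.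
  - rewrite hS; have -> : (ffun_row u \in syz_pred f) = (\sum_i (u i : R) * f^`M(i) == 0).
      rewrite {1}/in_mem /= /syz_pred; congr (_ == _).
      by apply: eq_bigr => i _; rewrite mxE.
    split; first by move/(congr1 val); rewrite indhomogK // => /eqP.
    by move/eqP => h; apply: val_inj; rewrite indhomogK.
  - rewrite (form_spaceP (jac_ideal f)); split.
      move=> /(jac_homog_coef hf (valP w))[a [ha ew]].
      exists [ffun i => DHomog (ha i)]; first exact: memvf.
      apply: val_inj; rewrite indhomogK // [RHS]ew.
      by apply: eq_bigr => i _; rewrite ffunE.
    by move=> [u _ <-]; rewrite indhomogK //; exists (fun i => u i : R).
by rewrite dimvf /dim /= card_ord.
Qed.

(** Two rank counts: multiplication by [eps] embeds R_(n-e) in Syz_n with image [K], and [phi] maps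
    Syz_n onto I_m with kernel [K]. *)
Lemma dim_syz_quot n m (S : {vspace V n}) : (e <= n)%N -> (m + d = n + e)%N ->
    (forall u, u \in S <-> ffun_row u \in syz_pred f) ->
  ('C(n - e + 2, n - e) + \dim (form_space idI m) = \dim S)%N.
Proof.
move=> le_en em hS.
have [K hK] : exists K : {vspace V n}, forall u, u \in K <->
    exists2 a, a \is (n - e).-homog & forall i, (u i : R) = a * syz_val eps 0 i.
  apply: vspace_of_pred => [|a u v [p hp pu] [q hq qv]].
    by exists 0; rewrite ?rpred0 // => i; rewrite ffunE mul0r.
  exists (a *: p + q); first by rewrite rpredD ?rpredZ.
  by move=> i; rewrite !ffunE /= pu qv mulrDl scalerAl.
have heps_n (a : R) i : a \is (n - e).-homog -> a * syz_val eps 0 i \is n.-homog.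
  by move=> ha; rewrite -(subnK le_en) dhomogM.
have [i0 epsi] : exists i, syz_val eps 0 i != 0.
  case: (pickP (fun i => syz_val eps 0 i != 0)) => [i hi|h0]; first by exists i.
  case/eqP: eps0; apply/val_inj/rowP => i; rewrite mxE.
  by have /= := h0 i; case: eqP.
have <- : (\dim K = 'C(n - e + 2, n - e))%N.
  rewrite -(@dim_forms 2 k (n - e)).
  transitivity (\dim (0 : {vspace dhomog 3 k (n - e)}) + \dim K)%N.
    by rewrite dimv0.
  pose g (a : dhomog 3 k (n - e)) : V n := [ffun i => indhomog n ((a : R) * syz_val eps 0 i)].
  apply: (rank_nullity_pred (g := g)) => [a u v _ _||u _|w].
  - apply/ffunP => i; rewrite !ffunE -indhomogP ?heps_n ?(valP u) ?(valP v) //.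
    by rewrite /= mulrDl scalerAl.
  - exact: sub0v.
  - rewrite memv0; split; last by move/eqP->; apply/ffunP => i; rewrite !ffunE /=
      mul0r; apply: val_inj; rewrite indhomogK ?rpred0.
    move/ffunP/(_ i0); rewrite !ffunE => /(congr1 val).
    rewrite indhomogK ?heps_n ?(valP u) // => /eqP.
    by rewrite mulf_eq0 (negPf epsi) orbF => /eqP h; apply/eqP/val_inj.
  - rewrite hK; split=> [[a ha hw]|[u _ <-]].
      exists (DHomog ha); first exact: memvf.
      apply/ffunP => i; rewrite ffunE; apply: val_inj.
      by rewrite indhomogK ?heps_n //= hw.
    exists (u : R); first exact: (valP u).
    by move=> i; rewrite ffunE indhomogK ?heps_n ?(valP u).
(* Off [S] the value is the default 0, so [g] below is linear on [S] only. *)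
pose tosyz (u : V n) : syz f := insubd (0 : syz f) (ffun_row u).
have tosyzK u : u \in S -> syz_val (tosyz u) = ffun_row u.
  by move/hS => h; rewrite /tosyz /= (insubdK _ h).
have tosyz_homog u : u \in S -> syz_homog n (tosyz u).
  by move=> uS i; rewrite tosyzK // mxE; apply: valP.
pose g (u : V n) : dhomog 3 k m := indhomog m (phi (tosyz u)).
have gK u : u \in S -> val (g u) = phi (tosyz u).
  by move=> uS; rewrite indhomogK //; apply: (phi_homog em); apply: tosyz_homog.
have KS : (K <= S)%VS.
  apply/subvP => u /hK[a _ hu]; apply/hS.
  have -> : ffun_row u = a *: syz_val eps by apply/rowP => i; rewrite !mxE hu.
  by rewrite rpredZ // (valP eps).
apply: (rank_nullity_pred (g := g)) => // [a u v uS vS|u uS|w].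
- apply: val_inj; rewrite gK ?rpredD ?rpredZ //= !gK //.
  rewrite -mul_mpolyC.
  have -> : tosyz (a *: u + v) = a%:MP *: tosyz u + tosyz v.
    apply: val_inj; rewrite /= !tosyzK ?rpredD ?rpredZ //.
    by apply/rowP => i; rewrite !mxE !ffunE /= mul_mpolyC.
  by rewrite linearP.
- have -> : (g u = 0) <-> (phi (tosyz u) = 0).
    by split=> [/(congr1 val)|h]; rewrite ?gK //; apply: val_inj; rewrite gK.
  rewrite phi0 hK; split=> [[a ea]|[a _ hu]].
    exists (pihomog mdeg (n - e) a); first exact: pihomogP.
    move=> i; have /(congr1 (fun s => syz_val s 0 i)) := ea.
    rewrite tosyzK //= !mxE => hi.
    by rewrite -(pihomogM _ _ (heps i)) subnK // -hi pihomog_dE // (valP (u i)).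
  exists a; apply: val_inj; rewrite /= tosyzK //.
  by apply/rowP => i; rewrite !mxE hu.
- rewrite (form_spaceP idI); split=> [/phiI[s es]|[u uS <-]]; last first.
    by rewrite gK //; apply/phiI; exists (tosyz u).
  pose u : V n := [ffun i => indhomog n (syz_val (syz_comp n s) 0 i)].
  have uE : ffun_row u = syz_val (syz_comp n s).
    apply/rowP => i; rewrite mxE ffunE indhomogK //; exact: syz_comp_homog.
  have uS : u \in S by apply/hS; rewrite uE; apply: valP.
  exists u => //; apply: val_inj; rewrite gK //.
  have -> : tosyz u = syz_comp n s by apply: val_inj; rewrite /= tosyzK.
  by rewrite (phi_comp s em) es pihomog_dE // (valP w).
Qed.

Lemma hilbert_bourbaki n m h t : (e <= n)%N -> (m + d = n + e)%N ->
    hilbert_value I m h -> hilbert_value (jac f) (n + d) t ->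
  (h + t + e * d = e ^ 2 + d ^ 2)%N.
Proof.
move=> le_en em /(hilbert_valueP idI) hh /(hilbert_valueP (jac_ideal f)) ht.
have [S hS] := syz_space_exists n.
have h1 := dim_syz_jac hS; have h2 := dim_syz_quot le_en em hS.
by apply: (@binomial_count d e m n) => //; rewrite -hh -ht -h1 -h2; lia.
Qed.

End Degree.
End Jacobian.

(** * Syzygies of degree less than d *)

(** A, B, C are binary forms of degree d, dehomogenized; vanishing of the coefficient of index d is
    vanishing at infinity. Once G = A + al C is nonzero it has finitely many zeros, and each of them
    excludes at most one value of [be]. *)
Lemma coprime_combinations (k : closedFieldType) (d : nat) (A B C : {poly k}) :
    (0 < d)%N -> (size A <= d.+1)%N -> (size B <= d.+1)%N -> (size C <= d.+1)%N ->
    (forall t, ~ [/\ A.[t] = 0, B.[t] = 0 & C.[t] = 0]) ->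
    ~ [/\ A`_d = 0, B`_d = 0 & C`_d = 0] ->
  exists al be, coprimep (A + al *: C) (B + be *: C) /\
    ((A + al *: C)`_d != 0 \/ (B + be *: C)`_d != 0).
Proof.
move=> d0 sA sB sC nz nzd.
(* If A = 0, then C is nonzero: otherwise B would have no root, hence be constant, and all three
   would vanish at infinity as d > 0. *)
have [al hal] : exists al, A + al *: C != 0.
  have [A0|A0] := eqVneq A 0; last by exists 0; rewrite scale0r addr0.
  exists 1; rewrite A0 add0r scale1r; apply/eqP => C0.
  have : size B == 1%N.
    apply/negPn/negP => /closed_rootP[t /rootP Bt]; apply: (nz t).
    by rewrite A0 C0 horner0.
  case/size_poly1P=> c _ eB; apply: nzd; rewrite A0 C0 eB !coef0 coefC.
  by rewrite (gtn_eqF d0).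
exists al; set G := A + al *: C in hal *.
have [rs eG] := closed_field_poly_normal G.
have lG : lead_coef G != 0 by rewrite lead_coef_eq0.
(* As a polynomial in [be], [H] is the product of the values of B + be C at the zeros of G, with one
   more factor when infinity is a zero. *)
pose H := (\prod_(r <- rs) ((B.[r])%:P + C.[r] *: 'X)) *
          (if G`_d == 0 then (B`_d)%:P + C`_d *: 'X else 1).
have lin0 (b c : k) : b%:P + c *: 'X = 0 -> b = 0 /\ c = 0.
  move=> h; have h0 := congr1 (fun p : {poly k} => p`_0) h.
  have h1 := congr1 (fun p : {poly k} => p`_1) h.
  move: h0 h1; rewrite !(coefD, coefC, coefZ, coefX) /=.
  by rewrite mulr0 addr0 mulr1 add0r.
have H0 : H != 0.
  rewrite mulf_neq0 //.
    rewrite prodf_seq_neq0; apply/allP => r hr /=; apply/eqP => /lin0[Br Cr].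
    apply: (nz r); split=> //.
    have : root G r by rewrite eG rootZ // root_prod_XsubC.
    by move/rootP; rewrite /G hornerD hornerZ Cr mulr0 addr0.
  have [Gd|_] := eqVneq G`_d 0; last exact: oner_neq0.
  apply/eqP => /lin0[Bd Cd]; apply: nzd; split=> //.
  by move: Gd; rewrite /G coefD coefZ Cd mulr0 addr0.
have [be hbe] := closed_nonrootP _ H0.
exists be; move: hbe; rewrite /root /H hornerM mulf_eq0 negb_or horner_prod.
rewrite prodf_seq_neq0 => /andP[/allP h1 h2]; split.
  apply/Pdiv.ClosedField.coprimepP => r; rewrite eG rootZ // root_prod_XsubC.
  move=> /h1 /=; rewrite !hornerE; rewrite mulrC; exact.
have [Gd|] := eqVneq G`_d 0; last by left.
right; move: h2; rewrite Gd eqxx !hornerE coefD coefZ mulrC; exact.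
Qed.

Lemma ord3_big (T : Type) (idx : T) (op : Monoid.com_law idx) (F : 'I_3 -> T)
    (i j l : 'I_3) : i != j -> j != l -> i != l ->
  \big[op/idx]_a F a = op (op (F i) (F j)) (F l).
Proof.
move=> ij jl il; rewrite (bigD1 i) //= (bigD1 j) 1?eq_sym //= (bigD1 l) /=; last first.
  by rewrite eq_sym il eq_sym.
rewrite big1 ?Monoid.mulm1 ?Monoid.mulmA // => a /andP[/andP[ai aj] al].
by move: i j l a ij jl il ai aj al; do 4!case=> [[|[|[|//]]] ?].
Qed.

Lemma ord3_others (i : 'I_3) : exists j l : 'I_3,
  [/\ i != j, j != l, i != l & forall a, [\/ a = i, a = j | a = l]].
Proof.
have c a : [\/ a = ord0, a = (lift ord0 ord0 : 'I_3) | a = ord_max].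
  case: a => [[|[|[|//]]] h]; [constructor 1|constructor 2|constructor 3];
  exact/val_inj.
case: (c i) => ->.
- by exists (lift ord0 ord0), ord_max.
- by exists ord0, ord_max; split=> // a; case: (c a) => ->;
    [constructor 2|constructor 1|constructor 3].
- by exists ord0, (lift ord0 ord0); split=> // a; case: (c a) => ->;
    [constructor 2|constructor 3|constructor 1].
Qed.

(** * Restriction of ternary forms to a coordinate line *)

Section LineRestriction.
Variable k : fieldType.
Local Notation R := {mpoly k[3]}.
Variables i j l : 'I_3.
Hypotheses (ij : i != j) (jl : j != l) (il : i != l).

Definition line_pt (a : 'I_3) : {poly k} :=
  if a == i then 0 else if a == j then 1 else 'X.

(* Restriction to the line X_i = 0, dehomogenized by X_j = 1. *)
Definition line_res (p : R) : {poly k} := mmap (@polyC k) line_pt p.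

HB.instance Definition _ :=
  GRing.RMorphism.copy line_res (mmap (@polyC k) line_pt).

(** Homogenization to degree n in the variables X_j and X_l, a section of the restriction to the
    line on polynomials of degree at most n. *)
Definition line_lift (n : nat) (q : {poly k}) : R :=
  \sum_(s < n.+1) q`_s *: ('X_l ^+ s * 'X_j ^+ (n - s)).

Lemma line_resX a : line_res 'X_a = line_pt a.
Proof. by rewrite /line_res mmapX mmap1U. Qed.

Lemma line_resZ c p : line_res (c *: p) = c *: line_res p.
Proof. by rewrite /line_res mmapZ mul_polyC. Qed.

Lemma line_pt_i : line_pt i = 0. Proof. by rewrite /line_pt eqxx. Qed.
Lemma line_pt_j : line_pt j = 1.
Proof. by rewrite /line_pt eq_sym (negPf ij) eqxx. Qed.
Lemma line_pt_l : line_pt l = 'X.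
Proof. by rewrite /line_pt eq_sym (negPf il) eq_sym (negPf jl). Qed.

Lemma line_lift_homog n q : line_lift n q \is n.-homog.
Proof.
apply: rpred_sum => s _; rewrite rpredZ //.
have := dhomogM (dhomogMn s (dhomogU k l)) (dhomogMn (n - s) (dhomogU k j)).
by rewrite !mul1n subnKC // -ltnS.
Qed.

Lemma line_liftK n (q : {poly k}) : (size q <= n.+1)%N -> line_res (line_lift n q) = q.
Proof.
move=> sq; rewrite /line_lift raddf_sum -[RHS]coefK (poly_def (size q)).
rewrite (big_ord_widen n.+1 (fun s => q`_s *: 'X^s)) // [RHS]big_mkcond /=.
apply: eq_bigr => s _; rewrite line_resZ rmorphM !rmorphXn /= !line_resX.
rewrite line_pt_j line_pt_l expr1n mulr1; case: leqP => // h.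
by rewrite nth_default // scale0r.
Qed.

Lemma line_lift_linear n a p q :
  line_lift n (a *: p + q) = a *: line_lift n p + line_lift n q.
Proof.
rewrite /line_lift scaler_sumr -big_split; apply: eq_bigr => s _ /=.
by rewrite coefD coefZ scalerDl scalerA.
Qed.

Lemma line_res_horner p t : (line_res p).[t] =
  p.@[fun a => if a == i then 0 else if a == j then 1 else t].
Proof.
rewrite /line_res /mmap horner_sum /meval /mmap; apply: eq_bigr => m _.
rewrite hornerM hornerC /mmap1 horner_prod; congr (_ * _).
by apply: eq_bigr => a _; rewrite horner_exp /line_pt; case: ifP => _;
  [|case: ifP => _]; rewrite !hornerE.
Qed.

Lemma line_split n p : p \is n.-homog ->
  exists p', p = 'X_i * p' + line_lift n (line_res p).
Proof.
move: p; apply: homog_ind => [|p q [p' ep] [q' eq]|c m em].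
- exists 0; rewrite raddf0 mulr0 add0r /line_lift big1 // => s _.
  by rewrite coef0 scale0r.
- exists (p' + q'); rewrite {1}ep {1}eq raddfD /= mulrDr addrACA; congr (_ + _).
  by rewrite -[line_res p in RHS]scale1r line_lift_linear scale1r.
have [mi|mi] := eqVneq (m i) 0%N; last first.
  exists (c *: 'X_[m - U_(i)]).
  rewrite line_resZ /line_res mmapX /mmap1 (bigD1 i) //= line_pt_i.
  rewrite expr0n (negPf mi) mul0r scaler0 -scalerAr -mpolyX_divX //.
  rewrite /line_lift big1 ?addr0 // => s _; by rewrite coef0 scale0r.
exists 0; rewrite mulr0 add0r line_resZ /line_res mmapX /mmap1.
have -> : \prod_a line_pt a ^+ m a = 'X^(m l).
  rewrite (ord3_big _ _ ij jl il) /= line_pt_j line_pt_l mi expr0 mul1r.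
  by rewrite expr1n mul1r.
have edeg : (m j + m l = n)%N by rewrite -em mdegE (ord3_big _ _ ij jl il) /= mi.
have lt : (m l < n.+1)%N by rewrite ltnS -edeg leq_addl.
rewrite /line_lift (bigD1 (Ordinal lt)) //= big1 ?addr0; last first.
  move=> s hs; rewrite coefZ coefXn.
  have -> : (s == m l :> nat) = false by apply: contraNF hs => /eqP e; apply/eqP/val_inj.
  by rewrite mulr0 scale0r.
rewrite coefZ coefXn eqxx mulr1; congr (_ *: _).
have -> : (n - m l)%N = m j by rewrite -edeg addnK.
by rewrite mpolyXE_id (ord3_big _ _ ij jl il) /= mi expr0 mul1r mulrC.
Qed.

Lemma line_res_size n p : p \is n.-homog -> (size (line_res p) <= n.+1)%N.
Proof.
move: p; apply: homog_ind => [|p q hp hq|c m em].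
- by rewrite raddf0 size_poly0.
- by rewrite raddfD /= (leq_trans (size_polyD _ _)) // geq_max hp hq.
rewrite line_resZ (leq_trans (size_scale_leq _ _)) // /line_res mmapX /mmap1.
rewrite -em mdegE; apply: (big_ind2 (fun (p : {poly k}) N => (size p <= N.+1)%N)).
- by rewrite size_poly1.
- move=> p N q N' hp hq; rewrite (leq_trans (size_polyMleq _ _)) //; lia.
move=> a _; rewrite /line_pt; case: ifP => _.
  by rewrite expr0n; case: eqP => [->|_]; rewrite ?size_poly1 ?size_poly0.
by case: ifP => _; rewrite ?expr1n ?size_poly1 ?size_polyXn.
Qed.

(** The part of a form free of X_i is determined by its restriction to the line. The last clause
    covers n = 0, where [n.-1] is 0 and the degree condition alone would allow a nonzero
    constant. *)
Lemma line_res0 n p : p \is n.-homog -> line_res p = 0 ->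
  exists p', [/\ p = 'X_i * p', p' \is n.-1.-homog & n = 0%N -> p' = 0].
Proof.
move=> hp hr; have [q] := line_split hp.
rewrite hr /line_lift big1 ?addr0; last by move=> s _; rewrite coef0 scale0r.
case: n hp => [|n] hp ep.
  exists 0; rewrite mulr0 rpred0; split=> //.
  by rewrite -(pihomog_dE hp) ep mulrC (pihomogM_lt _ (dhomogU k i)).
exists (pihomog mdeg n q); split=> //; last exact: pihomogP.
by rewrite -{1}(pihomog_dE hp) {1}ep mulrC -[n.+1]addn1 (pihomogM _ _ (dhomogU k i)) mulrC.
Qed.

(** The top coefficient is the value at the point of the line with X_j = 0, the one lost in
    dehomogenizing. *)
Lemma line_res_top n p : p \is n.-homog ->
  (line_res p)`_n = p.@[fun a => (a == l)%:R].
Proof.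
move: p; apply: homog_ind => [|p q hp hq|c m em].
- by rewrite raddf0 coef0 raddf0.
- by rewrite !raddfD /= coefD hp hq.
rewrite line_resZ coefZ mevalZ mevalX; congr (_ * _).
rewrite /line_res mmapX /mmap1 !(ord3_big _ _ ij jl il) /=.
rewrite (negPf il) (negPf jl) eqxx expr1n !mulr1 line_pt_i line_pt_j line_pt_l.
have edeg : (m i + m j + m l = n)%N by rewrite -em mdegE (ord3_big _ _ ij jl il).
rewrite expr1n mulr1 !expr0n.
have [mi|mi] := eqVneq (m i) 0%N; last by rewrite !mul0r coef0.
rewrite !mul1r coefXn -edeg mi add0n; congr (_%:R).
by have [->|mj] := eqVneq (m j) 0%N; rewrite ?eqxx //; apply/eqP; lia.
Qed.

End LineRestriction.

Lemma pihomogM1 n (k : fieldType) d (p q : {mpoly k[n]}) :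
  q \is 1.-homog -> pihomog mdeg d.+1 (q * p) = q * pihomog mdeg d p.
Proof. by move=> hq; rewrite mulrC -addn1 (pihomogM _ _ hq) mulrC. Qed.

Lemma homogXM n (k : fieldType) d i (p : {mpoly k[n]}) :
  p \is d.-homog -> 'X_i * p \is d.+1.-homog.
Proof. by move=> hp; rewrite -add1n dhomogM ?dhomogU. Qed.

(** * Two forms that are a regular sequence together with a coordinate *)

Section RegularSequence.
Variable k : fieldType.
Local Notation R := {mpoly k[3]}.
Variables i j l : 'I_3.
Hypotheses (ij : i != j) (jl : j != l) (il : i != l).
Variables (d : nat) (g1 g2 : R).
Hypotheses (d0 : (0 < d)%N) (hg1 : g1 \is d.-homog) (hg2 : g2 \is d.-homog).
Local Notation res := (@line_res k i j).
Hypotheses (cop : coprimep (res g1) (res g2)).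
Hypothesis top : (res g1)`_d != 0 \/ (res g2)`_d != 0.

Let size_top (p : R) (hp : p \is d.-homog) : (res p)`_d != 0 -> size (res p) = d.+1.
Proof.
move=> h; apply/eqP; rewrite eqn_leq (line_res_size ij jl il hp) /=.
by rewrite ltnNge; apply: contra h => h; rewrite nth_default.
Qed.

(** On the line the restrictions of g1 and g2 are coprime, so the restricted relation is a multiple
    of the Koszul one. Lifting the multiplier leaves remainders that vanish on the line, hence are
    divisible by X_i. *)
Lemma line_syzygy n a b : a \is n.-homog -> b \is n.-homog ->
    res a * res g1 + res b * res g2 = 0 ->
  exists c a' b', [/\ a = c * g2 + 'X_i * a', b = - (c * g1) + 'X_i * b',
    a' \is n.-1.-homog, b' \is n.-1.-homog & n = 0%N -> a' = 0 /\ b' = 0].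
Proof.
move=> ha hb eab.
have g20 : res g2 != 0.
  apply/eqP => r20; have [h|h] := top; last by move: h; rewrite r20 coef0 eqxx.
  move: cop; rewrite r20 coprimep0 -size_poly_eq1 (size_top hg1 h) eqSS.
  by rewrite (gtn_eqF d0).
have [gam ea] : exists gam, res a = gam * res g2.
  apply/dvdpP; rewrite -(Gauss_dvdpl _ (_ : coprimep (res g2) (res g1))).
    by move/eqP: eab; rewrite addr_eq0 => /eqP ->; rewrite dvdpNr dvdp_mull.
  by rewrite coprimep_sym.
have eb : res b = - (gam * res g1).
  apply: (mulIf g20); apply/eqP; rewrite mulNr -subr_eq0 opprK addrC.
  by rewrite -[X in _ == X]eab ea mulrAC.
(* By [top] one of g1, g2 restricts to degree exactly d, which bounds the degree of [gam] by n - d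
   and lets it lift to a form of that degree. *)
have [c [ec hc1 hc2]] : exists c, [/\ res c = gam, c * g1 \is n.-homog & c * g2 \is n.-homog].
  have [->|gam0] := eqVneq gam 0.
    by exists 0; rewrite raddf0 !mul0r !rpred0.
  have sg : (size gam + d <= n.+1)%N.
    case: top => h.
      have g10 : res g1 != 0 by apply: contraNneq h => ->; rewrite coef0.
      have := line_res_size ij jl il hb.
      by rewrite eb size_polyN size_mul // (size_top hg1 h) addnS.
    have := line_res_size ij jl il ha.
    by rewrite ea size_mul // (size_top hg2 h) addnS.
  have sg0 : (0 < size gam)%N by rewrite size_poly_gt0.
  have led : (d <= n)%N by lia.
  exists (line_lift j l (n - d) gam).
  have hl := line_lift_homog j l (n - d) gam.
  rewrite line_liftK //; last by lia.
  by split=> //; rewrite -{2}(subnK led) dhomogM.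
have [a' [ea' ha' ha0]] := line_res0 ij jl il (rpredB ha hc2)
  ltac:(by rewrite rmorphB rmorphM /= ec ea subrr).
have [b' [eb' hb' hb0]] := line_res0 ij jl il (rpredD hb hc1)
  ltac:(by rewrite rmorphD rmorphM /= ec eb addNr).
exists c, a', b'; split=> //; last by move=> n0; split; [apply: ha0|apply: hb0].
  by rewrite -ea' addrC subrK.
by rewrite -eb' addrC addrK.
Qed.

(** Induction on the degree: after removing a Koszul multiple, (a, b) is X_i times a relation of
    lower degree. *)
Lemma koszul_homog n a b : a \is n.-homog -> b \is n.-homog ->
    a * g1 + b * g2 = 0 -> exists c, a = c * g2 /\ b = - (c * g1).
Proof.
elim: n a b => [|n IH] a b ha hb eab;
  have [|c [a' [b' [ea eb ha' hb' h0]]]] := line_syzygy ha hb;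
  try by rewrite -!rmorphM -rmorphD eab rmorph0.
  by have [//|za zb] := h0; exists c; rewrite ea eb za zb !mulr0 !addr0.
have [|c' [ea' eb']] := IH a' b' ha' hb'.
  have /eqP : 'X_i * (a' * g1 + b' * g2) = 0 :> R.
    by rewrite -[RHS]eab ea eb; ring.
  rewrite mulf_eq0 => /orP[/eqP/(congr1 (mcoeff U_(i)))|/eqP//].
  by rewrite mcoeffXU eqxx mcoeff0 => /eqP; rewrite oner_eq0.
exists (c + 'X_i * c'); rewrite ea eb ea' eb'; split; ring.
Qed.

Lemma koszul a b : a * g1 + b * g2 = 0 -> exists c, a = c * g2 /\ b = - (c * g1).
Proof.
move=> eab.
have /choice[c hc] n : exists c, pihomog mdeg n a = c * g2 /\
    pihomog mdeg n b = - (c * g1).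
  apply: (koszul_homog (n := n)); rewrite ?pihomogP //.
  by rewrite -(pihomogM _ _ hg1) -(pihomogM _ _ hg2) -pihomogD eab pihomog0.
pose N := maxn (msize a) (msize b).
exists (\sum_(n < N) c n); rewrite !mulr_suml -sumrN; split.
  rewrite [LHS](@pihomog_partitionE _ _ mdeg N) ?leq_maxl //.
  by apply: eq_bigr => n _; case: (hc n).
rewrite [LHS](@pihomog_partitionE _ _ mdeg N) ?leq_maxr //.
by apply: eq_bigr => n _; case: (hc n).
Qed.

(** On the line the right-hand side becomes a relation between g1 and g2; its Koszul part cancels in
    a g1 + b g2 and the rest is divisible by X_i. *)
Lemma var_nonzerodivisor n h a b : h \is n.-homog -> 'X_i * h = a * g1 + b * g2 ->
  exists a' b', h = a' * g1 + b' * g2.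
Proof.
move=> hh eh; have hX := homogXM i hh.
have Xi0 : 'X_i != 0 :> R.
  apply/eqP => /(congr1 (mcoeff U_(i))); rewrite mcoeffXU eqxx mcoeff0.
  by move/eqP; rewrite oner_eq0.
case: (leqP d n.+1) => [led|ltd]; last first.
  exists 0, 0; rewrite !mul0r addr0; apply: (mulfI Xi0); rewrite mulr0.
  rewrite -(pihomog_dE hX) eh pihomogD.
  by rewrite (pihomogM_lt _ hg1 ltd) (pihomogM_lt _ hg2 ltd) addr0.
set m := (n.+1 - d)%N.
have [|c [a' [b' [ea eb _ _ _]]]] :=
    line_syzygy (pihomogP mdeg m a) (pihomogP mdeg m b).
  rewrite -!rmorphM -rmorphD -(pihomogM _ _ hg1) -(pihomogM _ _ hg2).
  rewrite -pihomogD -eh subnK // pihomog_dE //.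
  by rewrite rmorphM /= line_resX line_pt_i mul0r.
exists a', b'; apply: (mulfI Xi0).
rewrite -[LHS](pihomog_dE hX) eh pihomogD -(subnK led).
rewrite (pihomogM _ _ hg1) (pihomogM _ _ hg2) -/m ea eb; ring.
Qed.

Lemma var_exp_nonzerodivisor N n h : h \is n.-homog ->
    (exists a b, 'X_i ^+ N * h = a * g1 + b * g2) ->
  exists a' b', h = a' * g1 + b' * g2.
Proof.
elim: N n h => [|N IH] n h hh; first by rewrite mul1r.
rewrite exprSr -mulrA => /IH H.
have [|a [b eh]] := H n.+1; first exact: homogXM.
exact: (var_nonzerodivisor hh eh).
Qed.

End RegularSequence.

(* The condition satisfied by v when the scheme of zeros of J_f is contained
   in the reduced point [v]. *)
Definition jac_at_most (k : fieldType) (f : {mpoly k[3]}) (v : 'rV[k]_3) (N : nat) :=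
  forall n h, (N <= n)%N -> h \is n.-homog -> h.@[v 0] = 0 -> jac f h.

(** * The ideal of a point and generic combinations of the partials *)

Section PointForms.
Variables (k : fieldType) (v : 'rV[k]_3).
Local Notation R := {mpoly k[3]}.

(** When v_i is nonzero, the forms [vlin i a] with a distinct from i generate the ideal of [v], and
    [vlin i i] is 0. *)
Definition vlin (i a : 'I_3) : R := 'X_a - (v 0 a / v 0 i) *: 'X_i.

Lemma vlin_homog i a : vlin i a \is 1.-homog.
Proof. by rewrite rpredB ?rpredZ ?dhomogU. Qed.

Lemma vlin_eval i a (w : 'I_3 -> k) : (vlin i a).@[w] = w a - v 0 a / v 0 i * w i.
Proof. by rewrite mevalB mevalZ !mevalXU. Qed.

Lemma vlin_v i a : v 0 i != 0 -> (vlin i a).@[v 0] = 0.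
Proof. by move=> vi; rewrite vlin_eval mulfVK // subrr. Qed.

Lemma point_coord : v != 0 -> exists i, v 0 i != 0.
Proof.
move=> v0; case: (pickP (fun i => v 0 i != 0)) => [i hi|h]; first by exists i.
case/eqP: v0; apply/rowP => i; rewrite mxE; have /= := h i.
by case: eqP.
Qed.

End PointForms.

Section GenericPartials.
Variable k : closedFieldType.
Local Notation R := {mpoly k[3]}.
Variables (f : R) (d : nat) (v : 'rV[k]_3) (N : nat).
Hypotheses (d0 : (0 < d)%N) (hf : f \is d.+1.-homog) (v0 : v != 0).
Hypothesis hv : jac_at_most f v N.
Local Notation f0 := (f^`M(ord0)).
Local Notation f1 := (f^`M(lift ord0 ord0 : 'I_3)).
Local Notation f2 := (f^`M(ord_max)).

Lemma jac_eval p (w : 'I_3 -> k) : jac f p -> (forall a, (f^`M(a)).@[w] = 0) ->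
  p.@[w] = 0.
Proof.
move=> [a ->] h; rewrite raddf_sum big1 // => b _ /=.
by rewrite mevalM h mulr0.
Qed.

(** A power of [vlin v i a] lies in J, and its value at a point of X_i = 0 is the same power of w_a.
    The exponent N + 1 keeps it positive, so that the power vanishes at v even for N = 0. *)
Lemma no_zero_on_line i (w : 'I_3 -> k) a : v 0 i != 0 -> w i = 0 -> w a != 0 ->
  ~ (forall b, (f^`M(b)).@[w] = 0).
Proof.
move=> vi wi wa hw; have := @hv N.+1 (vlin v i a ^+ N.+1) (leqnSn _).
have -> : vlin v i a ^+ N.+1 \is N.+1.-homog.
  by rewrite -{2}[N.+1]mul1n dhomogMn ?vlin_homog.
rewrite rmorphXn /= vlin_v // expr0n => /(_ isT erefl) /jac_eval/(_ hw).
rewrite rmorphXn /= vlin_eval wi mulr0 subr0 => /eqP.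
by rewrite expf_eq0 (negPf wa) andbF.
Qed.

Lemma ord3P (a : 'I_3) : [\/ a = ord0, a = (lift ord0 ord0 : 'I_3) | a = ord_max].
Proof.
case: a => [[|[|[|//]]] h]; [constructor 1|constructor 2|constructor 3];
exact/val_inj.
Qed.

Lemma sum3 (V : nmodType) (F : 'I_3 -> V) :
  \sum_a F a = F ord0 + F (lift ord0 ord0) + F ord_max.
Proof. by rewrite (@ord3_big _ _ _ F ord0 (lift ord0 ord0) ord_max). Qed.

(** The line X_i = 0 misses [v], so the partials have no common zero on it, and two combinations can
    be chosen whose restrictions have none either. *)
Lemma generic_partials i : v 0 i != 0 -> exists al be : k,
  let g1 := f0 + al *: f2 in let g2 := f1 + be *: f2 in
  (forall a b, a * g1 + b * g2 = 0 -> exists c, a = c * g2 /\ b = - (c * g1)) /\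
  (forall M n h, h \is n.-homog -> (exists a b, 'X_i ^+ M * h = a * g1 + b * g2) ->
     exists a b, h = a * g1 + b * g2).
Proof.
move=> vi; have [j [l [ij jl il cover]]] := ord3_others i.
have sz (p : R) (hp : p \is d.-homog) := line_res_size ij jl il hp.
have hd a : f^`M(a) \is d.-homog by apply: mderiv_homog.
have [||al [be [cop top]]] := coprime_combinations d0 (sz _ (hd ord0))
   (sz _ (hd (lift ord0 ord0))) (sz _ (hd ord_max)).
- move=> t [h0 h1 h2].
  have := @no_zero_on_line i (fun a => if a == i then 0 else if a == j then 1 else t) j vi.
  rewrite /= eqxx [j == i]eq_sym (negPf ij) eqxx oner_neq0 => /(_ erefl isT).
  apply=> a.
  by rewrite -line_res_horner; case: (ord3P a) => ->.
- rewrite !(line_res_top ij jl il) // => -[h0 h1 h2].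
  have := @no_zero_on_line i (fun a => (a == l)%:R) l vi.
  rewrite /= (negPf il) eqxx oner_neq0 => /(_ erefl isT); apply=> a.
  by case: (ord3P a) => ->.
exists al, be => g1 g2.
have hg1 : g1 \is d.-homog by rewrite rpredD ?rpredZ.
have hg2 : g2 \is d.-homog by rewrite rpredD ?rpredZ.
have e1 : line_res i j g1 = line_res i j f0 + al *: line_res i j f2.
  by rewrite raddfD /= line_resZ.
have e2 : line_res i j g2 = line_res i j f1 + be *: line_res i j f2.
  by rewrite raddfD /= line_resZ.
rewrite -e1 -e2 in cop top; split.
  by move=> a b; apply: (koszul ij jl il d0 hg1 hg2 cop top).
move=> M n h; apply: (var_exp_nonzerodivisor ij jl il d0 hg1 hg2 cop top).
Qed.

Lemma small_syzygy e (s : syz f) : (1 < d)%N -> (e < d)%N -> syz_homog e s -> s = 0.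
Proof.
move=> d1 led hs; have [i vi] := point_coord v0.
have [al [be]] := generic_partials vi.
set g1 := _ + _; set g2 := f1 + _ => /= -[kz nz].
have hd a : f^`M(a) \is d.-homog by apply: mderiv_homog.
have hg1 : g1 \is d.-homog by rewrite rpredD ?rpredZ.
have hg2 : g2 \is d.-homog by rewrite rpredD ?rpredZ.
pose a := syz_val s 0 ord0; pose b := syz_val s 0 (lift ord0 ord0).
(* The coefficient of the third partial once the first two are replaced by g1 and g2. *)
pose c := syz_val s 0 ord_max - al *: a - be *: b.
have eabc : a * g1 + b * g2 + c * f2 = 0.
  have /eqP := valP s; rewrite sum3 -/a -/b => e0.
  rewrite -[RHS]e0 /g1 /g2 /c -!mul_mpolyC /=; ring.
have small m (p q r : R) : (m < d)%N -> p \is m.-homog -> q \is d.-homog ->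
    p = r * q -> p = 0.
  by move=> lt hp hq ep; rewrite -(pihomog_dE hp) ep (pihomogM_lt _ hq lt).
have [c0|c0] := eqVneq c 0.
  move: eabc; rewrite c0 mul0r addr0 => /kz[r [ea eb]].
  have za : a = 0 by apply: (small e a g2 r led (hs _) hg2 ea).
  have zb : b = 0.
    by apply: (small e b g1 (- r) led (hs _) hg1); rewrite mulNr.
  apply/val_inj/rowP => m; rewrite mxE; case: (ord3P m) => -> //.
  by have := c0; rewrite /c za zb !scaler0 !subr0.
have [j [l [ij jl il cover]]] := ord3_others i.
have hc : c \is e.-homog by rewrite !rpredB ?rpredZ ?hs.
(* X_i^N times a generator of the ideal of [v] lies in J = (g1, g2, f_z). Multiplied by c, the f_z
   term goes into (g1, g2) by the syzygy; then X_i^N is cancelled, X_i being a nonzerodivisor modulo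
   (g1, g2). *)
have mem m : exists p q, c * vlin v i m = p * g1 + q * g2.
  have hcl : c * vlin v i m \is (e + 1).-homog by rewrite dhomogM ?vlin_homog.
  apply: (nz N (e + 1)%N) => //.
  have [||u eu] := @hv (N + 1)%N ('X_i ^+ N * vlin v i m) (leq_addr _ _).
  - by rewrite -{2}[N]mul1n dhomogM ?vlin_homog // dhomogMn ?dhomogU.
  - by rewrite rmorphM /= vlin_v // mulr0.
  exists (c * u ord0 - (u ord_max - al *: u ord0 - be *: u (lift ord0 ord0)) * a).
  exists (c * u (lift ord0 ord0) - (u ord_max - al *: u ord0 - be *: u (lift ord0 ord0)) * b).
  have ec : c * f2 = - (a * g1 + b * g2).
    by apply/eqP; rewrite -addr_eq0 addrC eabc.
  rewrite mulrCA eu sum3.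
  have -> : u ord0 * f0 + u (lift ord0 ord0) * f1 + u ord_max * f2 =
     u ord0 * g1 + u (lift ord0 ord0) * g2 +
     (u ord_max - al *: u ord0 - be *: u (lift ord0 ord0)) * f2.
    rewrite /g1 /g2 -!mul_mpolyC; ring.
  rewrite mulrDr [c * (_ * f2)]mulrCA ec; ring.
have vl0 m : m != i -> vlin v i m != 0.
  move=> mi; apply/eqP => /(congr1 (meval (fun x => (x == m)%:R))).
  rewrite vlin_eval eqxx eq_sym (negPf mi) mulr0 subr0 meval0 => /eqP.
  by rewrite oner_eq0.
have [p1 [q1 e1]] := mem j; have [p2 [q2 e2]] := mem l.
have hcv m : c * vlin v i m \is (e + 1).-homog by rewrite dhomogM ?vlin_homog.
case: (ltnP (e + 1) d) => [lt|ge].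
  have : c * vlin v i j = 0.
    by rewrite -(pihomog_dE (hcv j)) e1 pihomogD
      (pihomogM_lt _ hg1 lt) (pihomogM_lt _ hg2 lt) addr0.
  by move/eqP; rewrite mulf_eq0 (negPf c0) (negPf (vl0 _ _)) // eq_sym.
(* Only e + 1 = d is left, where the products of c with linear forms are constant combinations of g1
   and g2. *)
have ed : (e + 1 = 0 + d)%N by lia.
have hom0 m p q : c * vlin v i m = p * g1 + q * g2 ->
    exists x y : k, c * vlin v i m = x%:MP * g1 + y%:MP * g2.
  move=> em; exists (pihomog mdeg 0 p)@_0%MM, (pihomog mdeg 0 q)@_0%MM.
  rewrite -!(homog0_const (pihomogP mdeg 0 _)).
  rewrite -(pihomogM _ _ hg1) -(pihomogM _ _ hg2) -pihomogD -em.
  by rewrite -ed pihomog_dE.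
have [x1 [y1 {}e1]] := hom0 _ _ _ e1; have [x2 [y2 {}e2]] := hom0 _ _ _ e2.
(* Eliminating c gives a relation between g1 and g2 with linear coefficients; these vanish because 1
   < d, and then all four constants do. *)
have /kz[r [er1 er2]] : (x1%:MP * vlin v i l - x2%:MP * vlin v i j) * g1 +
     (y1%:MP * vlin v i l - y2%:MP * vlin v i j) * g2 = 0.
  have : c * vlin v i j * vlin v i l - c * vlin v i l * vlin v i j = 0 by ring.
  by rewrite e1 e2 => <-; ring.
have hl (x y : k) : x%:MP * vlin v i l - y%:MP * vlin v i j \is 1.-homog.
  by rewrite !mul_mpolyC rpredB ?rpredZ ?vlin_homog.
have z1 := small 1%N _ g2 r d1 (hl _ _) hg2 er1.
have z2 : y1%:MP * vlin v i l - y2%:MP * vlin v i j = 0.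
  by apply: (small 1%N _ g1 (- r) d1 (hl _ _) hg1); rewrite mulNr.
have coefl (x y : k) : x%:MP * vlin v i l - y%:MP * vlin v i j = 0 -> x = 0.
  move=> /(congr1 (meval (fun x => (x == l)%:R))).
  rewrite meval0 mevalB !mevalM !mevalC !vlin_eval eqxx (negPf il) (negPf jl).
  by rewrite !mulr0 !subr0 mulr0 mulr1 subr0.
have : c * vlin v i j = 0 by rewrite e1 (coefl _ _ z1) (coefl _ _ z2) !mpolyC0 !mul0r addr0.
by move/eqP; rewrite mulf_eq0 (negPf c0) (negPf (vl0 _ _)) // eq_sym.
Qed.

End GenericPartials.

(** * Quadratic expansion at a singular point *)

Lemma binary_quadratic_factor (k : closedFieldType) (a b c : k) :
  exists s t : k * k,
    [/\ a = s.1 * t.1, b = s.1 * t.2 + s.2 * t.1 & c = s.2 * t.2].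
Proof.
have [->|a0] := eqVneq a 0.
  by exists (0, 1), (b, c); split=> /=; ring.
have [r] : exists r, root (a *: 'X^2 + b *: 'X + c%:P) r.
  apply/closed_rootP.
  rewrite -addrA size_polyDl ?size_scale ?size_polyXn //.
  rewrite (leq_ltn_trans (size_polyD _ _)) // gtn_max.
  rewrite (leq_ltn_trans (size_scale_leq _ _)) ?size_polyX //.
  by rewrite (leq_ltn_trans (size_polyC_leq1 _)).
move/rootP; rewrite !hornerE => e.
exists (1, - r), (a, b + a * r); split=> /=; first by ring.
  by ring.
apply/eqP; rewrite -subr_eq0; apply/eqP; rewrite -[RHS]e /=; ring.
Qed.

Section DoublePoints.
Variable k : fieldType.
Local Notation R := {mpoly k[3]}.
Implicit Types (p : R) (v : 'rV[k]_3).

(** Substitution of (v_a / v_i) X_i + [vlin v i a] for each X_a. *)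
Lemma vlin_decomp v i n p : v 0 i != 0 -> p \is n.-homog ->
  exists c (A : 'I_3 -> R), p = c *: 'X_i ^+ n + \sum_a vlin v i a * A a.
Proof.
move=> vi; elim: n p => [|n IH] p.
  move=> /homog0_const ->; exists p@_0%MM, (fun=> 0).
  rewrite big1 ?addr0; last by move=> a _; rewrite mulr0.
  by rewrite expr0 -mul_mpolyC mulr1.
move=> /homog_split[q [hq ->]].
have /fin_all_exists[c hc] a := IH _ (hq a).
have {hc} /fin_all_exists[A eA] := hc.
exists (\sum_a c a * (v 0 a / v 0 i)).
exists (fun b => c b *: 'X_i ^+ n + \sum_a 'X_a * A a b).
have eX a : 'X_a = (v 0 a / v 0 i) *: 'X_i + vlin v i a :> R.
  by rewrite addrC subrK.
rewrite [LHS](eq_bigr (fun a => (c a * (v 0 a / v 0 i)) *: 'X_i ^+ n.+1 +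
   (vlin v i a * (c a *: 'X_i ^+ n) + 'X_a * \sum_b vlin v i b * A a b))).
  rewrite big_split /= -scaler_suml big_split /=; congr (_ + _).
  under [in RHS]eq_bigr do rewrite mulrDr.
  rewrite [in RHS]big_split /=; congr (_ + _).
  under eq_bigr do rewrite mulr_sumr.
  rewrite exchange_big; apply: eq_bigr => b _ /=.
  by rewrite mulr_sumr; apply: eq_bigr => a _; rewrite mulrCA.
move=> a _; rewrite {1}eA {1}mulrDr addrA; congr (_ + _).
rewrite {1}eX mulrDl; congr (_ + _).
by rewrite exprS -scalerAl -scalerAr scalerA [_ * c a]mulrC.
Qed.

Lemma vlin_ii v i : v 0 i != 0 -> vlin v i i = 0.
Proof. by move=> vi; rewrite /vlin divff // scale1r subrr. Qed.

Lemma point_ideal v i n p : v 0 i != 0 -> p \is n.+1.-homog -> p.@[v 0] = 0 ->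
  exists2 A : 'I_3 -> R, (forall a, A a \is n.-homog) &
    p = \sum_a vlin v i a * A a.
Proof.
move=> vi hp pv; have [c [A eA]] := vlin_decomp vi hp.
have c0 : c = 0.
  move/eqP: pv; rewrite eA mevalD raddf_sum big1 => [|a _] /=; last first.
    by rewrite mevalM vlin_v // mul0r.
  by rewrite addr0 mevalZ rmorphXn /= mevalXU mulf_eq0 expf_eq0 (negPf vi) andbF orbF => /eqP.
exists (fun a => pihomog mdeg n (A a)); first by move=> a; apply: pihomogP.
rewrite -{1}(pihomog_dE hp) eA c0 scale0r add0r raddf_sum.
apply: eq_bigr => a _ /=.
exact: pihomogM1 (vlin_homog v i a).
Qed.

Lemma mderiv_vlin v i a b : b != i -> (vlin v i a)^`M(b) = (a == b)%:R.
Proof.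
move=> bi; rewrite mderivB mderivZ !mderivX !mnm1E.
rewrite [i == b]eq_sym (negPf bi) scale0r scaler0 subr0.
case: eqP => [->|_]; last by rewrite scale0r.
rewrite scale1r; have -> : (U_(b) - U_(b))%MM = 0%MM :> 'X_{1..3}.
  by apply/mnmP => c; rewrite mnmBE subnn mnm0E.
by rewrite mpolyX0.
Qed.

(** Write p as a combination of the [vlin v i a]; at v the coefficient of index b is the partial of
    p along b, as the b-partial of [vlin v i a] is 1 or 0. It vanishes at v, so it can be expanded
    once more. *)
Lemma double_point_expansion v i j l n p :
    i != j -> j != l -> i != l -> v 0 i != 0 -> p \is n.+2.-homog ->
    p.@[v 0] = 0 -> (forall a, (p^`M(a)).@[v 0] = 0) ->
  exists a b c : R, [/\ a \is n.-homog, b \is n.-homog, c \is n.-homog &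
    p = a * vlin v i j ^+ 2 + b * (vlin v i j * vlin v i l) + c * vlin v i l ^+ 2].
Proof.
move=> ij jl il vi hp pv dpv; have [A hA eA] := point_ideal vi hp pv.
have Av b : b != i -> (A b).@[v 0] = 0.
  move=> bi; rewrite -[RHS](dpv b) {}eA (raddf_sum (mderiv b)) /=.
  rewrite (bigD1 b) //= mevalD [X in _ + X](_ : _ = 0) ?addr0; last first.
    rewrite (raddf_sum (meval (v 0))) big1 //= => c cb.
    rewrite mderivM mderiv_vlin // (negPf cb) mul0r add0r.
    by rewrite mevalM vlin_v // mul0r.
  by rewrite mderivM mderiv_vlin // eqxx mul1r mevalD mevalM vlin_v // mul0r addr0.
have [ji li] : j != i /\ l != i by rewrite ![_ == i]eq_sym.
have [B hB eB] := point_ideal vi (hA j) (Av j ji).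
have [C hC eC] := point_ideal vi (hA l) (Av l li).
move: eA eB eC; rewrite !(ord3_big _ _ ij jl il) /= vlin_ii // !mul0r !add0r.
move=> -> -> ->; exists (B j), (B l + C j), (C l); split; rewrite ?rpredD //; ring.
Qed.

End DoublePoints.

Section SmoothConic.
Variable k : closedFieldType.
Local Notation R := {mpoly k[3]}.

(** At a singular point the coefficients of the quadratic expansion are constants, so the conic
    splits into two lines. *)
Lemma irreducible_conic_smooth (f : R) (v : 'rV[k]_3) :
    irreducible_elt f -> f \is 2.-homog -> v != 0 -> f.@[v 0] = 0 ->
  ~ (forall a, (f^`M(a)).@[v 0] = 0).
Proof.
move=> [_ _ firr] hf v0 fv dfv; have [i vi] := point_coord v0.
have [j [l [ij jl il _]]] := ord3_others i.
have [a [b [c [ha hb hc ef]]]] := double_point_expansion ij jl il vi hf fv dfv.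
have [s [t [ea eb ec]]] := binary_quadratic_factor a@_0%MM b@_0%MM c@_0%MM.
pose L (s : k * k) : R := s.1%:MP * vlin v i j + s.2%:MP * vlin v i l.
have Lv s' : L s' \isn't a GRing.unit.
  apply/negP => /divrr/(congr1 (meval (v 0))).
  rewrite mevalM meval1 {1}/L mevalD !mevalM !vlin_v // !mulr0 addr0 mul0r.
  by move/eqP; rewrite eq_sym oner_eq0.
have /firr : f = L s * L t.
  rewrite ef (homog0_const ha) (homog0_const hb) (homog0_const hc) ea eb ec.
  by rewrite mpolyCD !mpolyCM /L; ring.
by case; apply/negP.
Qed.

End SmoothConic.

(** * Consequences of the absence of syzygies of degree below d *)

Section Syzygies.
Variable k : fieldType.
Local Notation R := {mpoly k[3]}.
Variables (f : R) (d : nat).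
Hypotheses (d0 : (0 < d)%N) (hf : f \is d.+1.-homog).
Hypothesis low : forall e (s : syz f), (e < d)%N -> syz_homog e s -> s = 0.

Lemma syz_val_sum (I : Type) (r : seq I) (P : pred I) (F : I -> syz f) i :
  syz_val (\sum_(j <- r | P j) F j) 0 i = \sum_(j <- r | P j) syz_val (F j) 0 i.
Proof. by rewrite -[syz_val _]/(val _) raddf_sum summxE. Qed.

Lemma syz_low (s : syz f) n i : (n < d)%N -> pihomog mdeg n (syz_val s 0 i) = 0.
Proof.
move=> lt; have := low lt (syz_comp_homog hf n s).
by move/(congr1 (fun s => syz_val s 0 i)); rewrite /= !mxE.
Qed.

Lemma pihomogM_low (p q : R) m : (m < d + d)%N ->
    (forall n, (n < d)%N -> pihomog mdeg n p = 0) ->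
    (forall n, (n < d)%N -> pihomog mdeg n q = 0) ->
  pihomog mdeg m (p * q) = 0.
Proof.
move=> lt hp hq; rewrite {1}[p](@pihomog_partitionE _ _ mdeg (msize p)) //.
rewrite mulr_suml raddf_sum big1 // => i _ /=.
have hpi := pihomogP mdeg i p.
case: (ltnP i d) => [/hp->|led]; first by rewrite mul0r raddf0.
rewrite mulrC; case: (ltnP m i) => [lti|lei]; first by rewrite (pihomogM_lt _ hpi).
by rewrite -(subnK lei) (pihomogM _ _ hpi) hq ?mul0r //; lia.
Qed.

(** Row a is the cross product of the gradient with the a-th unit vector; that it is a syzygy, and
    the relation between the three rows, are identities of the cross product. *)
Definition koszul_coord (a i : 'I_3) : R :=
  if a == ord0 then
    (if i == ord0 then 0
     else if i == ord_max then - f^`M(lift ord0 ord0 : 'I_3) else f^`M(ord_max))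
  else if a == ord_max then
    (if i == ord0 then f^`M(lift ord0 ord0 : 'I_3)
     else if i == ord_max then 0 else - f^`M(ord0))
  else (if i == ord0 then - f^`M(ord_max) else if i == ord_max then f^`M(ord0) else 0).

Lemma koszul_proof a : (\row_i koszul_coord a i) \in syz_pred f.
Proof.
rewrite /in_mem /= /syz_pred; apply/eqP; rewrite sum3 !mxE.
by case: (ord3P a) => ->; rewrite /koszul_coord /=; ring.
Qed.

Definition koszul_syz a : syz f := Syz (koszul_proof a).

Lemma koszul_syz_homog a : syz_homog d (koszul_syz a).
Proof.
move=> i; rewrite mxE; have hd b : f^`M(b) \is d.-homog by apply: mderiv_homog.
by case: (ord3P a) => ->; case: (ord3P i) => ->; rewrite /koszul_coord /= ?rpredN ?rpred0.
Qed.

Lemma koszul_syz_relation : \sum_a f^`M(a) *: koszul_syz a = 0.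
Proof.
apply/val_inj; rewrite raddf_sum sum3; apply/rowP => i; rewrite !mxE /=.
by case: (ord3P i) => ->; rewrite /koszul_coord /=; ring.
Qed.

Lemma koszul_syz_neq0 : (exists a, f^`M(a) != 0) -> exists a, koszul_syz a != 0.
Proof.
move=> [a0 fa0].
have [a [i eai]] : exists a i, koszul_coord a i = f^`M(a0).
  case: (ord3P a0) => ->.
  - by exists (lift ord0 ord0), ord_max.
  - by exists ord_max, ord0.
  - by exists ord0, (lift ord0 ord0).
exists a; apply: contraNneq fa0 => /(congr1 (fun s => syz_val s 0 i)).
by rewrite /= !mxE eai => ->.
Qed.

(** By uniqueness of coordinates in a basis, the relation between the Koszul syzygies makes each
    column of their coordinate matrix a syzygy. So coordinates and basis vectors both start in
    degree d at least, and the Koszul syzygies in degree 2d; being homogeneous of degree d > 0 they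
    would vanish. The basis need not be homogeneous, hence the comparison of lowest degrees. *)
Lemma low_not_free : (exists a, f^`M(a) != 0) -> ~ is_free_module (syz f).
Proof.
move=> grad [n [b hb]].
have /fin_all_exists[C hC] a : exists c : 'rV[R]_n, koszul_syz a = \sum_j c 0 j *: b j.
  by have [c [hc _]] := hb (koszul_syz a); exists c.
have rel j : \sum_a C a 0 j * f^`M(a) = 0.
  have [c0 [_ uc]] := hb 0.
  have z0 : 0 = \sum_j (0 : 'rV[R]_n) 0 j *: b j.
    by rewrite big1 // => j' _; rewrite mxE scale0r.
  have : \row_j (\sum_a C a 0 j * f^`M(a)) = 0 :> 'rV[R]_n.
    rewrite -(uc _ z0); apply/esym/uc.
    rewrite -{1}koszul_syz_relation.
    under eq_bigr do rewrite hC scaler_sumr.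
    rewrite exchange_big; apply: eq_bigr => j' _ /=; rewrite mxE scaler_suml.
    by apply: eq_bigr => a _; rewrite scalerA mulrC.
  by move/rowP/(_ j); rewrite !mxE.
have Csyz j : (\row_a C a 0 j) \in syz_pred f.
  by rewrite /in_mem /= /syz_pred -[X in _ == X](rel j); apply/eqP/eq_bigr => a _; rewrite mxE.
have K0 a : koszul_syz a = 0.
  apply/val_inj/rowP => i; rewrite [RHS]mxE.
  rewrite -(pihomog_dE (koszul_syz_homog a i)) hC syz_val_sum raddf_sum big1 // => j _.
  rewrite !mxE; apply: pihomogM_low; first by rewrite -{1}[d]addn0 ltn_add2l.
    by move=> m lt; have := syz_low (Syz (Csyz j)) a lt; rewrite /= mxE.
  by move=> m lt; apply: syz_low.
by have [a /eqP[]] := koszul_syz_neq0 grad; apply: K0.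
Qed.

(** A combination of syzygies with coefficients X_i starts in degree d + 1 at least. *)
Lemma low_min_generator (eps : syz f) : eps != 0 -> syz_homog d eps -> syz_min_generator eps.
Proof.
move=> eps0 heps [t et]; case/eqP: eps0; apply/val_inj/rowP => i; rewrite [RHS]mxE.
rewrite -(pihomog_dE (heps i)) et syz_val_sum raddf_sum big1 // => a _ /=.
rewrite mxE -[in LHS](prednK d0) pihomogM1 ?dhomogU // syz_low ?mulr0 //.
by rewrite prednK.
Qed.

End Syzygies.

Section LowSyzygies.
Variable k : closedFieldType.
Local Notation R := {mpoly k[3]}.
Variables (f : R) (d : nat).
Hypotheses (char0 : [pchar k] =i pred0) (d0 : (0 < d)%N).
Hypotheses (hf : f \is d.+1.-homog) (firr : irreducible_elt f).

Lemma char0_neq0 n : n.+1%:R != 0 :> k.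
Proof. by have /(pcharf0P k)-> := char0. Qed.

Lemma euler_zero (v : 'I_3 -> k) : (forall a, (f^`M(a)).@[v] = 0) -> f.@[v] = 0.
Proof.
move=> h; have /(congr1 (meval v)) := euler hf.
rewrite mevalZ raddf_sum big1 => [/esym/eqP|a _]; last by rewrite /= mevalM h mulr0.
by rewrite mulf_eq0 (negPf (char0_neq0 d)) => /eqP.
Qed.

Lemma gradient_neq0 : exists a, f^`M(a) != 0.
Proof.
case: (pickP (fun a => f^`M(a) != 0)) => [a h|h]; first by exists a.
have f0 : f = 0.
  have := euler hf; rewrite big1 => [/esym/eqP|a _].
    by rewrite scaler_eq0 (negPf (char0_neq0 d)) => /eqP.
  by have /negbFE/eqP -> := h a; rewrite mulr0.
by case: firr; rewrite f0 eqxx.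
Qed.

(** The syzygy is a constant vector w killed by the Hessian. The partials of a conic are linear, so
    by symmetry of the Hessian they vanish at w, which is then a singular point. *)
Lemma conic_syzygy0 (s : syz f) : d = 1%N -> syz_homog 0 s -> s = 0.
Proof.
move=> d1 hs; have hf2 : f \is 2.-homog by move: hf; rewrite d1.
apply/eqP/negPn/negP => s0; pose w : 'rV[k]_3 := \row_i (syz_val s 0 i)@_0%MM.
have sE i : syz_val s 0 i = (w 0 i)%:MP by rewrite mxE -homog0_const.
have w0 : w != 0.
  apply: contraNneq s0 => w0; apply/eqP/val_inj/rowP => i.
  by rewrite sE w0 !mxE.
have df0 a : (f^`M(a)).@[w 0] = 0.
  have ha : f^`M(a) \is 1.-homog by apply: mderiv_homog.
  have /(congr1 (meval (w 0))) := euler ha; rewrite scale1r => <-.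
  have /eqP/(congr1 (mderiv a)) := valP s.
  rewrite mderiv0 (raddf_sum (mderiv a)) => /(congr1 (meval (w 0))).
  rewrite meval0 !raddf_sum /= => e; rewrite -[RHS]e; apply: eq_bigr => b _.
  by rewrite sE mderiv_mulC !mevalM mevalXU mevalC mderiv_comm.
exact: (irreducible_conic_smooth firr hf2 w0 (euler_zero df0) df0).
Qed.

Lemma low_syzygies (v : 'rV[k]_3) N : v != 0 -> jac_at_most f v N ->
  forall e (s : syz f), (e < d)%N -> syz_homog e s -> s = 0.
Proof.
move=> v0 hv e s lt hs; case: (ltnP 1 d) => [d1|le1].
  exact: (small_syzygy d0 hf v0 hv d1 lt hs).
have d1 : d = 1%N by apply/eqP; rewrite eqn_leq le1.
by apply: conic_syzygy0 => //; move: hs; have -> : e = 0%N by lia.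
Qed.

End LowSyzygies.

(** * Heights *)

(* The intermediate prime avoids all s * g2 ^ n with s outside P; by regularity
   such an element is a multiple of g1 only if s is. *)
Lemma regular_pair_height (A : idomainType) (g1 g2 : A) (P : A -> Prop) :
    g1 != 0 ->
    (forall a b, a * g1 + b * g2 = 0 -> exists c, a = c * g2 /\ b = - (c * g1)) ->
    is_prime_ideal P -> P g1 -> P g2 ->
  height_ge 2 P.
Proof.
move=> g10 kz [hP P1 PM] Pg1 Pg2.
pose S x := exists s n, ~ P s /\ x = s * g2 ^+ n.
pose I x := exists a, x = a * g1.
have idI : is_ideal I.
  split; first by exists 0; rewrite mul0r.
    by move=> x y [a ->] [b ->]; exists (a + b); rewrite mulrDl.
  by move=> x y [a ->]; exists (x * a); rewrite mulrA.
have [Q [[hQ Q1 QM] IQ SQ]] : exists Q, [/\ is_prime_ideal Q, forall a, I a -> Q a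
    & forall a, S a -> ~ Q a].
  apply: prime_avoiding => //; first by exists 1, 0%N; rewrite mulr1.
    move=> x y [s [n [Ps ->]]] [t [m [Pt ->]]]; exists (s * t), (n + m)%N.
    by split; [move=> /PM[] | rewrite exprD mulrACA].
  move=> x [s [n [Ps ->]]] [a ea].
  suff [b eb] : exists b, s = b * g1.
    by apply: Ps; rewrite eb; case: hP => _ _; apply.
  elim: n a ea => [|n IH] a ea; first by exists a; rewrite -ea mulr1.
  have [|c [_ ec]] := kz (- a) (s * g2 ^+ n).
    by rewrite mulNr -ea exprSr mulrA addNr.
  by apply: (IH (- c)); rewrite mulNr.
exists Q; split=> //.
- move=> a Qa; case: (pselect (P a)) => // Pa.
  by case: (SQ a) => //; exists a, 0%N; rewrite mulr1.
- by exists g2 => //; apply: SQ; exists 1, 1%N; rewrite mul1r.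
exists (fun x => x = 0); split=> //.
- split; first split=> //.
  + by move=> a b -> ->; rewrite addr0.
  + by move=> a b ->; rewrite mulr0.
  + by apply/eqP; rewrite oner_eq0.
  + by move=> a b /eqP; rewrite mulf_eq0 => /orP[/eqP->|/eqP->]; [left|right].
- by move=> a ->; case: hQ.
by exists g1; [apply: IQ; exists 1; rewrite mul1r | apply/eqP].
Qed.

(** * Chains of primes and algebraic independence *)

Section Transcendence.
Variables (A : idomainType) (B : comNzRingType) (phi : {rmorphism A -> B}).

Definition poly_ext (b : B) : {rmorphism {poly A} -> B} :=
  horner_morph (fun x => mulrC b (phi x)).

Lemma poly_ext_poly b n (E : nat -> A) :
  poly_ext b (\poly_(i < n) E i) = \sum_(i < n) phi (E i) * b ^+ i.
Proof.
rewrite poly_def rmorph_sum; apply: eq_bigr => i _.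
by rewrite -mul_polyC rmorphM rmorphXn /= horner_morphC horner_morphX.
Qed.

(** If A embeds in B / Q' and b lies in Q' but not in Q, then A[T] embeds in B / Q by sending T to
    b: modulo Q' a relation reduces to its constant term, which is 0, and b can be cancelled modulo
    the prime Q. *)
Lemma transcendental_step (Q Q' : B -> Prop) b :
    is_prime_ideal Q -> is_ideal Q' -> (forall a, Q a -> Q' a) -> Q' b -> ~ Q b ->
    (forall x, Q' (phi x) -> x = 0) ->
  forall p, Q (poly_ext b p) -> p = 0.
Proof.
move=> [hQ Q1 QM] hQ' QQ' Qb' Qb inj; elim/poly_ind => // p c IH.
rewrite rmorphD rmorphM /= horner_morphX horner_morphC => h.
have c0 : c = 0.
  apply: inj; rewrite -(addKr (poly_ext b p * b) (phi c)) addrC.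
  apply: (ideal_sub hQ' (QQ' _ h)); case: hQ' => _ _; exact.
move: h; rewrite c0 rmorph0 addr0 => /QM[/IH ->|//].
by rewrite mul0r addr0.
Qed.

End Transcendence.

Lemma sum_pair (V : nmodType) (I J : finType) (F : I * J -> V) :
  \sum_p F p = \sum_j \sum_i F (i, j).
Proof.
by rewrite exchange_big pair_bigA; apply: eq_bigr => -[].
Qed.

Section Counting.
Variables (k : fieldType).
Local Notation R := {mpoly k[3]}.

Lemma card_bmnm_le D : (#|{: 'X_{1..3 < D}}| <= D ^ 3)%N.
Proof.
case: D => [|D].
  by rewrite leqn0; apply/eqP/eq_card0 => m; have := bmdeg m.
rewrite -[X in (_ <= X ^ 3)%N](card_ord D.+1) -[in X in (_ <= _ ^ X)%N](card_ord 3).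
rewrite -card_ffun.
pose F (m : 'X_{1..3 < D.+1}) : {ffun 'I_3 -> 'I_D.+1} := [ffun i => inord (bmnm m i)].
apply: (@leq_card _ _ F) => m m' /ffunP h; apply/val_inj/mnmP => i.
have lt (m0 : 'X_{1..3 < D.+1}) : (bmnm m0 i < D.+1)%N.
  by apply: leq_ltn_trans (bmdeg m0); rewrite mdegE (bigD1 i) //= leq_addr.
by have := congr1 val (h i); rewrite !ffunE /= !inordK ?lt.
Qed.

Lemma linear_dependency (I : finType) (w : I -> R) D :
    (forall s, (msize (w s) <= D)%N) -> (D ^ 3 < #|I|)%N ->
  exists c : I -> k, (exists s, c s != 0) /\ \sum_s c s *: w s = 0.
Proof.
move=> hw ltI.
pose M : 'M[k]_(#|I|, #|{: 'X_{1..3 < D}}|) :=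
  \matrix_(a, b) (w (enum_val a))@_(bmnm (enum_val b)).
have : ~~ row_free M.
  apply/negP => /eqP rM; have := rank_leq_col M.
  by rewrite rM leqNgt (leq_ltn_trans (card_bmnm_le D)).
rewrite -kermx_eq0 => /rowV0Pn[u /sub_kermxP uM u0].
exists (fun s => u 0 (enum_rank s)); split.
  case: (pickP (fun a => u 0 a != 0)) => [a ha|h].
    by exists (enum_val a); rewrite enum_valK.
  by case/eqP: u0; apply/rowP => a; rewrite mxE; have /negbFE/eqP := h a.
apply/mpolyP => m; rewrite mcoeff0 raddf_sum.
case: (ltnP (mdeg m) D) => [lt|ge]; last first.
  rewrite big1 // => s _; rewrite /= mcoeffZ memN_msupp_eq0 ?mulr0 //.
  by apply: msize_mdeg_ge; apply: leq_trans (hw s) ge.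
have /rowP/(_ (enum_rank (BMultinom lt))) := uM; rewrite !mxE => e.
rewrite -[RHS]e (reindex _ (onW_bij _ (enum_val_bij I))) /=.
by apply: eq_bigr => a _; rewrite mcoeffZ enum_valK mxE enum_rankK.
Qed.

Lemma msizeM_bound (p q : R) a b : (msize p <= a.+1)%N -> (msize q <= b.+1)%N ->
  (msize (p * q) <= (a + b).+1)%N.
Proof.
move=> hp hq; have [->|p0] := eqVneq p 0; first by rewrite mul0r msize0.
have [->|q0] := eqVneq q 0; first by rewrite mulr0 msize0.
by rewrite msizeM //; move: hp hq; move: (mmeasure _ p) (mmeasure _ q) => x y; lia.
Qed.

Lemma msizeX_bound (p : R) a n : (msize p <= a.+1)%N -> (msize (p ^+ n) <= (n * a).+1)%N.
Proof.
move=> hp; elim: n => [|n IH]; first by rewrite msize1.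
by rewrite exprS mulSn; apply: msizeM_bound.
Qed.

(** The N^4 monomials in the y's with exponents below N have degree at most 4ND, in a space of
    dimension at most (4ND + 1)^3; for large N they are linearly dependent. *)
Lemma no_four_independent (y0 y1 y2 y3 : R) :
  ~ (forall p, poly_ext (poly_ext (poly_ext (poly_ext (@mpolyC 3 k) y0) y1) y2) y3 p = 0
     -> p = 0).
Proof.
move=> inj.
pose D := (msize y0 + msize y1 + msize y2 + msize y3)%N.
(* Chosen so that (4ND + 1)^3 is at most N^3 (4D + 1)^3, which is less than N^4. *)
pose N := ((4 * D + 1) ^ 3).+1.
pose I : finType := ('I_N * 'I_N * 'I_N * 'I_N)%type.
pose w (s : I) : R := y0 ^+ s.1.1.1 * y1 ^+ s.1.1.2 * y2 ^+ s.1.2 * y3 ^+ s.2.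
have [s||c [[s cs]]] := @linear_dependency I w (4 * (N * D)).+1.
- have lt (a : 'I_N) (y : R) : (msize y <= D)%N -> (msize (y ^+ a) <= (N * D).+1)%N.
    move=> hy; apply: leq_trans (msizeX_bound a (leqW hy)) _.
    by rewrite ltnS leq_mul2r ltnW ?orbT.
  have -> : (4 * (N * D) = N * D + N * D + N * D + N * D)%N by lia.
  by do !apply: msizeM_bound; apply: lt; rewrite /D; lia.
- rewrite !card_prod !card_ord.
  have h : ((4 * (N * D)).+1 <= N * (4 * D + 1))%N by rewrite /N; nia.
  apply: (@leq_ltn_trans ((N * (4 * D + 1)) ^ 3)); first by rewrite leq_exp2r.
  have -> : (N * N * N * N = N ^ 3 * N)%N by rewrite !expnS expn0 muln1 !mulnA.
  by rewrite expnMn ltn_pmul2l ?expn_gt0 // /N.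
pose E : {poly {poly {poly {poly k}}}} :=
  \poly_(m < N) \poly_(l < N) \poly_(j < N) \poly_(i < N)
    c (inord i, inord j, inord l, inord m).
move=> ec; have E0 : E = 0.
  apply: inj; rewrite poly_ext_poly -[RHS]ec.
  rewrite sum_pair.
  apply: eq_bigr => m _; rewrite poly_ext_poly mulr_suml.
  rewrite sum_pair.
  apply: eq_bigr => l _; rewrite poly_ext_poly !mulr_suml.
  rewrite sum_pair.
  apply: eq_bigr => j _; rewrite poly_ext_poly !mulr_suml.
  by apply: eq_bigr => i _; rewrite !inord_val /w /= -mul_mpolyC !mulrA.
have := congr1 (fun p : {poly {poly {poly {poly k}}}} => p`_s.2`_s.1.2`_s.1.1.2`_s.1.1.1) E0.
rewrite /= !(coef_poly, ltn_ord, coef0) /= !inord_val.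
by case: s cs => [[[a b] e] g] /= /eqP.
Qed.

End Counting.

Section SmallHeight.
Variable k : fieldType.
Local Notation R := {mpoly k[3]}.

(** P is chosen to contain I but no nonzero polynomial in X_i, so k[X_i] embeds in R / P. Each step
    down a chain of primes adds an independent element; three steps would give four in R. *)
Lemma prime_of_small_height (I : R -> Prop) (i : 'I_3) : is_homog_ideal I ->
    (forall n, ~ I ('X_i ^+ n)) ->
  exists P, [/\ is_prime_ideal P, forall a, I a -> P a & ~ height_ge 3 P].
Proof.
move=> [hI hH] nI.
pose psi := poly_ext (@mpolyC 3 k) 'X_i.
pose S x := exists2 F, F != 0 & x = psi F.
have [P [hP IP SP]] : exists P, [/\ is_prime_ideal P, forall a, I a -> P a
    & forall a, S a -> ~ P a].
  apply: prime_avoiding => //.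
  - by exists 1; rewrite ?oner_neq0 ?rmorph1.
  - by move=> _ _ [F F0 ->] [G G0 ->]; exists (F * G); rewrite ?mulf_neq0 ?rmorphM.
  (* I is homogeneous, so it would contain the leading component of F(X_i), a nonzero multiple of
     X_i^m. *)
  move=> _ [F F0 ->] IF; set m := (size F).-1.
  have Fm : F`_m != 0 by rewrite -lead_coefE lead_coef_eq0.
  apply: (nI m); have := hH _ m IF.
  have szF : (m < size F)%N by rewrite /m prednK // size_poly_gt0.
  rewrite -[F]coefK poly_ext_poly raddf_sum (bigD1 (Ordinal szF)) //= big1 ?addr0.
    rewrite mul_mpolyC pihomog_dE; last first.
      by rewrite rpredZ // -{2}[m]mul1n dhomogMn ?dhomogU.
    by move/(ideal_scale (F`_m)^-1 hI); rewrite scalerK.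
  move=> j ne; apply: (@pihomog_ne0 _ _ _ j).
    by apply: contraNneq ne => h; apply/eqP/val_inj.
  by rewrite mul_mpolyC rpredZ // -{2}[j : nat]mul1n dhomogMn ?dhomogU.
exists P; split=> // -[Q2 [hQ2 Q2P [a2 Pa2 Q2a2] [Q1 [hQ1 Q1Q2 [a1 Q2a1 Q1a1]]]]].
move=> [Q0 [hQ0 Q0Q1 [a0 Q1a0 Q0a0] _]].
have inj0 F : P (psi F) -> F = 0.
  by move=> h; apply/eqP/negPn/negP => F0; apply: (SP (psi F)) h; exists F.
have [idP _ _] := hP; have [idQ2 _ _] := hQ2; have [idQ1 _ _] := hQ1.
have inj1 := transcendental_step hQ2 idP Q2P Pa2 Q2a2 inj0.
have inj2 := transcendental_step hQ1 idQ2 Q1Q2 Q2a1 Q1a1 inj1.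
have inj3 := transcendental_step hQ0 idQ1 Q0Q1 Q1a0 Q0a0 inj2.
apply: (@no_four_independent k 'X_i a2 a1 a0) => p hp; apply: inj3.
by rewrite hp; case: hQ0 => [[]].
Qed.

End SmallHeight.

(** * The local ring at a point *)

Section LocalRing.
Variables (k : fieldType) (v : 'rV[k]_3).
Local Notation R := {mpoly k[3]}.
Local Notation K := {fraction R}.
Local Notation O := (local_ring v).
Local Notation mx := (local_max v).
Local Notation mn := (ideal_pow O mx).
Implicit Types (x y z : K) (a b : R).

Lemma eval_neq0 b : b.@[v 0] != 0 -> tofrac b != 0.
Proof. by apply: contraNneq => /eqP; rewrite tofrac_eq0 => /eqP ->; rewrite meval0. Qed.

Lemma local_fractionD (N : R -> Prop) x y :
    (forall a b, N a -> N b -> N (a + b)) -> (forall a b, N b -> N (a * b)) ->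
  local_fraction v N x -> local_fraction v N y -> local_fraction v N (x + y).
Proof.
move=> ND NM [d [a [b [ha hb bv Na ->]]]] [e [a' [b' [ha' hb' bv' Na' ->]]]].
exists (d + e)%N, (a * b' + b * a'), (b * b'); split.
- by rewrite rpredD ?dhomogM.
- exact: dhomogM.
- by rewrite mevalM mulf_neq0.
- by apply: ND; [rewrite mulrC|]; apply: NM.
by rewrite addf_div ?eval_neq0 // [b * a']mulrC tofracD !tofracM.
Qed.

Lemma local_fractionM (N : R -> Prop) x y : (forall a b, N b -> N (a * b)) ->
  O x -> local_fraction v N y -> local_fraction v N (x * y).
Proof.
move=> NM [d [a [b [ha hb bv _ ->]]]] [e [a' [b' [ha' hb' bv' Na' ->]]]].
exists (d + e)%N, (a * a'), (b * b'); split; rewrite ?dhomogM //.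
- by rewrite mevalM mulf_neq0.
- exact: NM.
by rewrite mulf_div !tofracM.
Qed.

Lemma OD x y : O x -> O y -> O (x + y). Proof. exact: local_fractionD. Qed.
Lemma OM x y : O x -> O y -> O (x * y). Proof. exact: local_fractionM. Qed.

Lemma O_form d a b : a \is d.-homog -> b \is d.-homog -> b.@[v 0] != 0 ->
  O (tofrac a / tofrac b).
Proof. by move=> *; exists d, a, b. Qed.

Lemma OC (c : k) : O (tofrac c%:MP).
Proof.
exists 0%N, c%:MP, 1; rewrite tofrac1 divr1 dhomogC dhomog1 meval1 oner_neq0.
by split.
Qed.

Lemma O0 : O 0. Proof. by rewrite -tofrac0 -mpolyC0; apply: OC. Qed.
Lemma O1 : O 1. Proof. by rewrite -tofrac1 -mpolyC1; apply: OC. Qed.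
Lemma ON x : O x -> O (- x).
Proof. by move=> h; rewrite -mulN1r -tofrac1 -tofracN -mpolyC1 -mpolyCN; apply: OM (OC _) h. Qed.
Lemma OB x y : O x -> O y -> O (x - y).
Proof. by move=> hx hy; apply: OD hx (ON hy). Qed.

Lemma maxD x y : mx x -> mx y -> mx (x + y).
Proof.
apply: local_fractionD => [a b ea eb|a b eb]; rewrite ?mevalD ?mevalM ?ea ?eb ?addr0 //.
by rewrite mulr0.
Qed.

Lemma maxM x y : O x -> mx y -> mx (x * y).
Proof. by apply: local_fractionM => a b eb; rewrite mevalM eb mulr0. Qed.

Lemma maxO x : mx x -> O x.
Proof. by move=> [d [a [b [*]]]]; exists d, a, b; split. Qed.

Lemma max_form d a b : a \is d.-homog -> b \is d.-homog -> b.@[v 0] != 0 ->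
  a.@[v 0] = 0 -> mx (tofrac a / tofrac b).
Proof. by move=> *; exists d, a, b. Qed.

Lemma maxC (c : k) : mx (tofrac c%:MP) -> c = 0.
Proof.
move=> [d [a [b [ha hb bv av e]]]]; have b0 := eval_neq0 bv.
have /eqP : tofrac (c%:MP * b) = tofrac a by rewrite tofracM e divfK.
rewrite tofrac_eq => /eqP/(congr1 (meval (v 0))).
by rewrite mevalM mevalC av => /eqP; rewrite mulf_eq0 (negPf bv) orbF => /eqP.
Qed.

Lemma O_residue x : O x -> exists c : k, mx (x - tofrac c%:MP).
Proof.
move=> [d [a [b [ha hb bv _ ->]]]]; exists (a.@[v 0] / b.@[v 0]).
exists d, (a - (a.@[v 0] / b.@[v 0]) *: b), b; split=> //.
- by rewrite rpredB ?rpredZ.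
- by rewrite mevalB mevalZ divfK // subrr.
by rewrite tofracB -mul_mpolyC tofracM mulrBl mulfK // eval_neq0.
Qed.

Lemma O_inv x : O x -> ~ mx x -> x != 0 /\ O x^-1.
Proof.
move=> [d [a [b [ha hb bv _ ->]]]] nm.
have av : a.@[v 0] != 0 by apply/eqP => av; apply: nm; apply: (max_form ha hb).
split; first by rewrite mulf_neq0 ?invr_eq0 ?eval_neq0.
by rewrite invf_div; apply: (O_form hb ha).
Qed.

Lemma mn_ind n (P : K -> Prop) : P 0 -> (forall x y, P x -> P y -> P (x + y)) ->
    (forall s (t : 'I_n -> K), O s -> (forall j, mx (t j)) -> P (s * \prod_j t j)) ->
  forall x, mn n x -> P x.
Proof.
move=> P0 PD PM x [r [s [t [hs ht ->]]]].
by apply: big_ind => // i _; apply: PM.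
Qed.

Lemma mn_prod n s (t : 'I_n -> K) : O s -> (forall j, mx (t j)) -> mn n (s * \prod_j t j).
Proof.
by move=> hs ht; exists 1%N, (fun=> s), (fun=> t); rewrite big_ord1.
Qed.

Lemma mn0 n : mn n 0.
Proof.
by exists 0%N, (fun=> 0), (fun _ _ => 0); rewrite big_ord0; split=> // -[].
Qed.

Lemma mnD n x y : mn n x -> mn n y -> mn n (x + y).
Proof.
move=> [r [s [t [hs ht ->]]]] [r' [s' [t' [hs' ht' ->]]]].
exists (r + r')%N,
  (fun c : 'I_(r + r') => match fintype.split c with inl e => s e | inr e => s' e end).
exists (fun c : 'I_(r + r') => match fintype.split c with inl e => t e | inr e => t' e end); split.
- by move=> c; case: fintype.split.
- by move=> c j; case: fintype.split.
rewrite big_split_ord; congr (_ + _); apply: eq_bigr => c _.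
  by rewrite (unsplitK (inl _ c)).
by rewrite (unsplitK (inr _ c)).
Qed.

Lemma mnO n x y : O x -> mn n y -> mn n (x * y).
Proof.
move=> hx; move: y; apply: mn_ind => [|y1 y2 h1 h2|s t hs ht]; first by rewrite mulr0; apply: mn0.
  by rewrite mulrDr; apply: mnD.
by rewrite mulrA; apply: mn_prod => //; apply: OM.
Qed.

Lemma mnN n x : mn n x -> mn n (- x).
Proof. by move=> h; rewrite -mulN1r; apply: mnO (ON O1) h. Qed.

Lemma mnB n x y : mn n x -> mn n y -> mn n (x - y).
Proof. by move=> hx hy; apply: mnD hx (mnN hy). Qed.

Lemma mn_0P x : mn 0 x <-> O x.
Proof.
split; last first.
  move=> hx; have := @mn_prod 0 x (fun=> 0) hx.
  by rewrite big_ord0 mulr1; apply=> -[].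
move: x; apply: mn_ind; [exact: O0 | exact: OD | ].
by move=> s t hs _; rewrite big_ord0 mulr1.
Qed.

Lemma mn_1P x : mn 1 x <-> mx x.
Proof.
split; last first.
  move=> hx; have := @mn_prod 1 1 (fun=> x) O1.
  by rewrite big_ord1 mul1r; apply.
move: x; apply: mn_ind; last by move=> s t hs ht; rewrite big_ord1; apply: maxM.
  by exists 0%N, 0, 1; rewrite rpred0 dhomog1 meval1 oner_neq0 meval0 tofrac0 mul0r.
exact: maxD.
Qed.

Lemma mnM n m x y : mn n x -> mn m y -> mn (n + m) (x * y).
Proof.
move=> + hy; move: x; apply: mn_ind => [|x1 x2 h1 h2|s t hs ht].
- by rewrite mul0r; apply: mn0.
- by rewrite mulrDl; apply: mnD.
move: y hy; apply: mn_ind => [|y1 y2 h1 h2|s' t' hs' ht'].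
- by rewrite mulr0; apply: mn0.
- by rewrite mulrDr; apply: mnD.
rewrite mulrACA.
pose T c := match fintype.split c with inl j => t j | inr j => t' j end.
have -> : (\prod_j t j) * (\prod_j t' j) = \prod_(c < n + m) T c.
  rewrite big_split_ord /T; congr (_ * _); apply: eq_bigr => c _.
    by rewrite (unsplitK (inl _ c)).
  by rewrite (unsplitK (inr _ c)).
by apply: mn_prod; [apply: OM | move=> c; rewrite /T; case: fintype.split].
Qed.

Lemma mnSM n x y : mx x -> mn n y -> mn n.+1 (x * y).
Proof. by move=> /mn_1P hx; apply: (@mnM 1 n). Qed.

Lemma mnSW n x : mn n.+1 x -> mn n x.
Proof.
move: x; apply: mn_ind; [exact: mn0 | exact: mnD | move=> s t hs ht].
rewrite big_ord_recl mulrA; apply: mn_prod => //.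
by apply: OM => //; apply: maxO.
Qed.

Lemma mnW n m x : (m <= n)%N -> mn n x -> mn m x.
Proof. by move/subnK <-; elim: (n - m)%N => // r IH /mnSW. Qed.

Lemma mn_generators (L1 L2 : K) :
    (forall x, mx x -> exists y z, [/\ O y, O z & x = L1 * y + L2 * z]) ->
  forall n x, mn n.+1 x -> exists y z, [/\ mn n y, mn n z & x = L1 * y + L2 * z].
Proof.
move=> gen n; apply: mn_ind.
- by exists 0, 0; rewrite !mulr0 addr0; split=> //; apply: mn0.
- move=> _ _ [y [z [hy hz ->]]] [y' [z' [hy' hz' ->]]].
  by exists (y + y'), (z + z'); split; [apply: mnD | apply: mnD | rewrite !mulrDr addrACA].
move=> s t hs ht; have [y [z [hy hz et]]] := gen _ (ht ord0).
rewrite big_ord_recl; set T := \prod_(_ < n) _.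
have hT : mn n (s * T) by apply: mn_prod.
exists (y * (s * T)), (z * (s * T)); split; [exact: mnO | exact: mnO |].
by rewrite et mulrCA mulrDl -!mulrA.
Qed.

(* Restriction to the line v + tau w of the affine cone, with parameter tau. *)
Definition dir_pt (w : 'I_3 -> k) (c : 'I_3) : {poly k} := (v 0 c)%:P + w c *: 'X.
Definition dir_res (w : 'I_3 -> k) (a : R) : {poly k} := mmap (@polyC k) (dir_pt w) a.

HB.instance Definition _ w := GRing.RMorphism.copy (dir_res w) (mmap (@polyC k) (dir_pt w)).

Lemma dir_resX w c : dir_res w 'X_c = dir_pt w c.
Proof. by rewrite /dir_res mmapX mmap1U. Qed.

Lemma dir_resC w (c : k) : dir_res w c%:MP = c%:P.
Proof. by rewrite /dir_res mmapC. Qed.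

Lemma dir_res0 w a : (dir_res w a).[0] = a.@[v 0].
Proof.
rewrite /dir_res /mmap horner_sum /meval /mmap; apply: eq_bigr => m _.
rewrite hornerM hornerC /mmap1 horner_prod; congr (_ * _).
by apply: eq_bigr => c _; rewrite horner_exp /dir_pt !hornerE.
Qed.

Lemma dir_res_dvd w a : a.@[v 0] = 0 -> 'X %| dir_res w a.
Proof.
by move=> av; rewrite -[X in X %| _]subr0 -polyC0 dvdp_XsubCl /root dir_res0 av.
Qed.

(** The means of showing that a fraction is not in m^n: each factor from m vanishes at v, so on
    every line through v it contributes one zero at parameter 0. *)
Lemma mn_order n x : mn n x -> exists a b, [/\ b.@[v 0] != 0, x = tofrac a / tofrac b
  & forall w, 'X^n %| dir_res w a].
Proof.
move: x; apply: mn_ind.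
- by exists 0, 1; rewrite meval1 oner_neq0 tofrac0 mul0r; split=> // w; rewrite raddf0 dvdp0.
- move=> _ _ [a [b [bv -> ha]]] [a' [b' [bv' -> ha']]].
  exists (a * b' + a' * b), (b * b'); split.
  + by rewrite mevalM mulf_neq0.
  + by rewrite addf_div ?eval_neq0 // tofracD !tofracM.
  + by move=> w; rewrite rmorphD !rmorphM /= dvdp_add // dvdp_mulr.
move=> s t [d [a0 [b0 [_ _ bv _ ->]]]]; elim: n t => [|n IH] t ht.
  by exists a0, b0; rewrite big_ord0 mulr1; split=> // w; rewrite expr0 dvd1p.
have [|a [b [bv' e ha]]] := IH (fun j => t (lift ord0 j)); first by move=> j.
have [e' [a1 [b1 [_ _ bv1 av1 et]]]] := ht ord0.
exists (a1 * a), (b1 * b); split; first by rewrite mevalM mulf_neq0.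
  by rewrite big_ord_recl mulrCA e et !tofracM invfM mulrACA.
by move=> w; rewrite rmorphM /= exprS dvdp_mul // dir_res_dvd.
Qed.

End LocalRing.

Lemma fraction_split (F : fieldType) (p q A B b x : F) : x != 0 ->
  (p * A + q * B) / b = p / x * (x * A / b) + q / x * (x * B / b).
Proof. by move=> x0; rewrite !mulrA !divfK // mulrDl. Qed.

Lemma cross_mul (F : fieldType) (x y b c : F) :
  x / c = y / b -> c != 0 -> b != 0 -> x * b = y * c.
Proof. by move=> e c0 b0; apply/eqP; rewrite -eqr_div // e. Qed.

Lemma mulrBB (A : comPzRingType) (a a' b b' : A) :
  a * b - a' * b' = (a - a') * b + a' * (b - b').
Proof. by ring. Qed.

Lemma subrDD (A : zmodType) (a b a' b' : A) :
  a + b - (a' + b') = (a - a') + (b - b').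
Proof. by rewrite opprD addrACA. Qed.

Lemma cramer2 (F : fieldType) (a b c e y z X Y : F) : a * e - c * b != 0 ->
  X * y + Y * z =
    (a * X + b * Y) * (e / (a * e - c * b) * y - c / (a * e - c * b) * z) +
    (c * X + e * Y) * (a / (a * e - c * b) * z - b / (a * e - c * b) * y).
Proof. by move=> D0; field. Qed.

Lemma mcoeff_pihomog n (A : nzRingType) (p : {mpoly A[n]}) m :
  (pihomog mdeg (mdeg m) p)@_m = p@_m.
Proof.
rewrite [in RHS](@pihomog_partitionE _ _ mdeg (maxn (msize p) (mdeg m).+1) p) ?leq_maxl //.
have lt : (mdeg m < maxn (msize p) (mdeg m).+1)%N by rewrite leq_maxr.
rewrite [RHS](raddf_sum (mcoeff m)) (bigD1 (Ordinal lt)) //= big1 ?addr0 // => s ne.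
apply: (dhomog_nemf_coeff (pihomogP mdeg s p)).
by apply: contraNneq ne => h; apply/eqP/val_inj.
Qed.

(** The values at the points (1, t) determine the dehomogenized polynomial; in a fixed degree, its
    exponents determine the monomials. *)
Lemma binary_form_eq0 (k : closedFieldType) r (q : {mpoly k[2]}) :
  q \is r.-homog -> (forall w : 'I_2 -> k, q.@[w] = 0) -> q = 0.
Proof.
move=> hq h; pose Q : {poly k} := \sum_(m <- msupp q) q@_m *: 'X^(m ord_max).
have Q0 : Q = 0.
  apply/eqP/negPn/negP => /closed_nonrootP[t]; rewrite /root.
  rewrite -(h (fun c => if c == ord0 then 1 else t)) mevalE /Q horner_sum.
  case/eqP; apply: eq_bigr => m _; rewrite hornerZ hornerXn.
  rewrite big_ord_recl big_ord1 /= expr1n mul1r; congr (_ * _ ^+ m _).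
  exact/val_inj.
apply/mpolyP => m0; rewrite mcoeff0.
case: (boolP (m0 \in msupp q)) => [m0q|]; last exact: memN_msupp_eq0.
have /(congr1 (fun p : {poly k} => p`_(m0 ord_max))) := Q0.
rewrite coef0 /Q coef_sum (bigD1_seq m0) //= coefZ coefXn eqxx mulr1.
rewrite big_seq_cond big1 ?addr0 // => m /andP[mq ne]; rewrite coefZ coefXn.
case: eqP => [e|_]; last by rewrite mulr0.
case/eqP: ne; apply/mnmP => c.
have := dhomog_mf hq mq; have := dhomog_mf hq m0q.
rewrite /= !mdegE !big_ord_recl !big_ord0 /= !addn0 => e0 e1.
have e' : m (lift ord0 ord0) = m0 (lift ord0 ord0).
  by have -> : lift ord0 ord0 = ord_max :> 'I_2 by apply/val_inj.
have [->|->] : c = ord0 \/ c = lift ord0 ord0.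
  by case: c => [[|[|//]] hc]; [left|right]; apply/val_inj.
  by move: e0 e1; rewrite e'; lia.
exact: e'.
Qed.

(** * Regular parameters at a point *)

Section LocalCoordinates.
Variables (k : closedFieldType) (v : 'rV[k]_3) (i j l : 'I_3).
Hypotheses (ij : i != j) (jl : j != l) (il : i != l) (vi : v 0 i != 0).
Local Notation R := {mpoly k[3]}.
Local Notation K := {fraction R}.
Local Notation O := (local_ring v).
Local Notation mx := (local_max v).
Local Notation mn := (ideal_pow O mx).

Lemma Xi_eval : ('X_i : R).@[v 0] != 0. Proof. by rewrite mevalXU. Qed.

Lemma Xi_neq0 : tofrac ('X_i : R) != 0.
Proof. exact: (eval_neq0 Xi_eval). Qed.

Lemma Xin_eval n : ('X_i ^+ n : R).@[v 0] != 0.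
Proof. by rewrite rmorphXn /= expf_neq0 // mevalXU. Qed.

Lemma Xin_homog n : ('X_i ^+ n : R) \is n.-homog.
Proof. by rewrite -{2}[n]mul1n dhomogMn ?dhomogU. Qed.

Definition lcoord (a : 'I_3) : K := tofrac (vlin v i a) / tofrac 'X_i.

Lemma lcoord_max a : mx (lcoord a).
Proof. by apply: (max_form (vlin_homog v i a) (dhomogU _ i) Xi_eval); apply: vlin_v. Qed.

Lemma max_generators x : mx x ->
  exists y z, [/\ O y, O z & x = lcoord j * y + lcoord l * z].
Proof.
move=> [[|D] [a [b [ha hb bv av ->]]]].
  have -> : a = 0.
    by move: av; rewrite (homog0_const ha) mevalC => ->; rewrite mpolyC0.
  by exists 0, 0; rewrite tofrac0 mul0r !mulr0 addr0; split=> //; apply: O0.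
have [A hA eA] := point_ideal vi ha av.
(* The factor X_i restores the degree D + 1 of the denominator and is compensated in the coordinates
   [lcoord]. *)
exists (tofrac ('X_i * A j) / tofrac b), (tofrac ('X_i * A l) / tofrac b).
split; try by apply: (O_form _ hb bv); apply: homogXM.
rewrite eA (ord3_big _ _ ij jl il) /= vlin_ii // mul0r add0r /lcoord.
by rewrite tofracD !tofracM; apply: fraction_split Xi_neq0.
Qed.

Definition kconst : {rmorphism k -> K} := @tofrac R \o @mpolyC 3 k.

Definition ev (h : 'I_2 -> K) (p : {mpoly k[2]}) : K := mmap kconst h p.

HB.instance Definition _ h := GRing.RMorphism.copy (ev h) (mmap kconst h).

Lemma evX h c : ev h 'X_c = h c.
Proof. by rewrite /ev mmapX mmap1U. Qed.

Lemma evC h (c : k) : ev h c%:MP = tofrac c%:MP.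
Proof. by rewrite /ev mmapC. Qed.

Lemma evZ h (c : k) p : ev h (c *: p) = tofrac c%:MP * ev h p.
Proof. by rewrite -mul_mpolyC rmorphM /= evC. Qed.

Lemma ev_homog_mn h n p : (forall c, mx (h c)) -> p \is n.-homog -> mn n (ev h p).
Proof.
move=> hh; elim: n p => [|n IH] p.
  by move=> /homog0_const ->; rewrite evC; apply/mn_0P; apply: OC.
move=> /homog_split[q [hq ->]]; rewrite rmorph_sum.
apply: big_ind; [exact: mn0 | exact: mnD |] => c _.
by rewrite rmorphM /= evX; apply: mnSM => //; apply: IH.
Qed.

Lemma ev_order h n p : (forall c, mx (h c)) ->
  (forall m, (mdeg m < n)%N -> p@_m = 0) -> mn n (ev h p).
Proof.
move=> hh hp; rewrite [p](@pihomog_partitionE _ _ mdeg (msize p)) // rmorph_sum.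
apply: big_ind; [exact: mn0 | exact: mnD |] => r _ /=.
case: (ltnP r n) => [lt|le]; last by apply: (mnW le); apply: ev_homog_mn => //; apply: pihomogP.
suff -> : pihomog mdeg r p = 0 by rewrite rmorph0; apply: mn0.
by rewrite pihomogE big1 // => m /eqP em; rewrite hp ?scale0r ?em.
Qed.

Lemma ev_O h p : (forall c, O (h c)) -> O (ev h p).
Proof.
move=> hh; elim/mpolyind: p => [|c m p _ _ IH]; first by rewrite rmorph0; apply: O0.
rewrite rmorphD /= evZ; apply: OD => //; apply: OM; first exact: OC.
rewrite /ev mmapX /mmap1; apply: big_ind; [exact: O1 | exact: OM | move=> a _].
by elim: (m a) => [|e IHe]; [apply: O1 | rewrite exprS; apply: OM].
Qed.

Lemma ev_congr h h' n p : (forall c, O (h c)) -> (forall c, O (h' c)) ->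
  (forall c, mn n (h c - h' c)) -> mn n (ev h p - ev h' p).
Proof.
move=> hO hO' hh.
have hom r q : q \is r.-homog -> mn n (ev h q - ev h' q).
  elim: r q => [|r IH] q.
    by move=> /homog0_const ->; rewrite !evC subrr; apply: mn0.
  move=> /homog_split[s [hs ->]]; rewrite !rmorph_sum -sumrB.
  apply: big_ind; [exact: mn0 | exact: mnD |] => c _; rewrite !rmorphM /= !evX.
  rewrite mulrBB [_ * ev h _]mulrC.
  by apply: mnD; apply: mnO => //; [apply: ev_O | apply: hh | apply: IH].
rewrite [p](@pihomog_partitionE _ _ mdeg (msize p)) // !rmorph_sum -sumrB.
by apply: big_ind; [exact: mn0 | exact: mnD |] => r _ /=; apply: hom (pihomogP _ _ _).
Qed.

(** Replacing one argument in a product of r of them changes it by a factor in m^2 against r - 1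
    factors in m: the difference gains one order over the degree. *)
Lemma ev_congr_homog h h' r p : (forall c, mx (h c)) -> (forall c, mx (h' c)) ->
  (forall c, mn 2 (h c - h' c)) -> p \is r.-homog -> mn r.+1 (ev h p - ev h' p).
Proof.
move=> hm hm' hh; elim: r p => [|r IH] p.
  by move=> /homog0_const ->; rewrite !evC subrr; apply: mn0.
move=> /homog_split[s [hs ->]]; rewrite !rmorph_sum -sumrB.
apply: big_ind; [exact: mn0 | exact: mnD |] => c _; rewrite !rmorphM /= !evX.
rewrite mulrBB; apply: mnD.
  by apply: (@mnM _ _ 2 r); [apply: hh | apply: ev_homog_mn].
by apply: mnSM; [apply: hm' | apply: IH].
Qed.

Section LinearParameters.
Variables (al be : 'I_2 -> k).
Hypothesis det : al ord0 * be ord_max - al ord_max * be ord0 != 0.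

Definition plin (c : 'I_2) : R := al c *: vlin v i j + be c *: vlin v i l.
Definition plc (c : 'I_2) : K := tofrac (plin c) / tofrac 'X_i.

Lemma plcE c : plc c = tofrac (al c)%:MP * lcoord j + tofrac (be c)%:MP * lcoord l.
Proof.
by rewrite /plc /plin tofracD -!mul_mpolyC !tofracM /lcoord mulrDl !mulrA.
Qed.

Lemma plc_max c : mx (plc c).
Proof. by rewrite plcE; apply: maxD; apply: maxM; try exact: OC; apply: lcoord_max. Qed.

(** A linear form vanishing at v takes at v + tau w the value tau times its value at w. *)
Lemma plin_dir w c : dir_res v w (plin c) = (plin c).@[w] *: 'X.
Proof.
have vl a : dir_res v w (vlin v i a) = (vlin v i a).@[w] *: 'X.
  rewrite /vlin rmorphB -mul_mpolyC rmorphM /= dir_resC !dir_resX /dir_pt.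
  rewrite mulrDr -polyCM divfK // opprD addrACA subrr add0r.
  by rewrite mul_polyC scalerA -scalerBl mevalB mevalM mevalC !mevalXU.
rewrite /plin mevalD !mevalZ rmorphD -!mul_mpolyC !rmorphM /= !dir_resC !vl.
by rewrite !mul_polyC !scalerA -scalerDl.
Qed.

Definition psub (p : {mpoly k[2]}) : R := mmap (@mpolyC 3 k) plin p.

HB.instance Definition _ := GRing.RMorphism.copy psub (mmap (@mpolyC 3 k) plin).

Lemma psubX c : psub 'X_c = plin c. Proof. by rewrite /psub mmapX mmap1U. Qed.
Lemma psubC (c : k) : psub c%:MP = c%:MP. Proof. by rewrite /psub mmapC. Qed.

Lemma ev_plc r p : p \is r.-homog -> ev plc p = tofrac (psub p) / tofrac ('X_i ^+ r).
Proof.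
elim: r p => [|r IH] p.
  by move=> /homog0_const ->; rewrite evC psubC tofrac1 divr1.
move=> /homog_split[q [hq ->]]; rewrite (rmorph_sum (ev plc)) (rmorph_sum psub) /=.
rewrite rmorph_sum mulr_suml.
apply: eq_bigr => c _; rewrite !rmorphM /= evX psubX IH // exprS !tofracM /plc.
by rewrite mulf_div.
Qed.

Lemma psub_dir r p w : p \is r.-homog ->
  dir_res v w (psub p) = p.@[fun c => (plin c).@[w]] *: 'X^r.
Proof.
elim: r p => [|r IH] p.
  move=> /homog0_const ->; rewrite psubC dir_resC mevalC expr0.
  by rewrite -mul_polyC mulr1.
move=> /homog_split[q [hq ->]]; rewrite (rmorph_sum psub) /= (rmorph_sum (dir_res v w)).
rewrite (rmorph_sum (meval _)) scaler_suml /=.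
apply: eq_bigr => c _; rewrite !rmorphM /= psubX plin_dir IH // mevalXU.
by rewrite -scalerAl -scalerAr scalerA exprS.
Qed.

Lemma plin_onto (t : 'I_2 -> k) : exists w : 'I_3 -> k, forall c, (plin c).@[w] = t c.
Proof.
pose D := al ord0 * be ord_max - al ord_max * be ord0.
pose s1 := (t ord0 * be ord_max - t ord_max * be ord0) / D.
pose s2 := (al ord0 * t ord_max - al ord_max * t ord0) / D.
exists (fun a => if a == j then s1 else if a == l then s2 else 0) => c.
rewrite /plin mevalD !mevalZ !vlin_eval (negPf ij) (negPf il) !mulr0 !subr0.
rewrite !eqxx [l == j]eq_sym (negPf jl).
have [->|->] : c = ord0 \/ c = ord_max.
  by case: c => [[|[|//]] hc]; [left|right]; apply/val_inj.
  by rewrite /s1 /s2 /D; field.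
by rewrite /s1 /s2 /D; field.
Qed.

(* The leading form of p survives in the associated graded ring, where the
   classes of the parameters u are independent linear forms. *)
Lemma regular_parameters (u : 'I_2 -> K) n p :
    (forall c, mx (u c)) -> (forall c, mn 2 (u c - plc c)) ->
    mn n.+1 (ev u p) -> forall m, (mdeg m <= n)%N -> p@_m = 0.
Proof.
move=> um hu hp m.
suff low r : (r <= n)%N -> pihomog mdeg r p = 0.
  by move=> /low/(congr1 (mcoeff m)); rewrite mcoeff0 mcoeff_pihomog.
elim/ltn_ind: r => r IH rn; set q := pihomog mdeg r p.
have hq : q \is r.-homog by apply: pihomogP.
have rest : mn r.+1 (ev u (p - q)).
  apply: ev_order => // m'; rewrite ltnS leq_eqVlt mcoeffB => /orP[/eqP e|lt].
    by rewrite /q -e mcoeff_pihomog subrr.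
  rewrite -[p@_m']mcoeff_pihomog IH ?(leq_trans (ltnW lt)) // mcoeff0 sub0r.
  by rewrite (dhomog_nemf_coeff hq) ?oppr0 // neq_ltn lt.
have hqu : mn r.+1 (ev u q).
  have -> : ev u q = ev u p - ev u (p - q) by rewrite -rmorphB subKr.
  by apply: mnB => //; apply: mnW hp.
have : mn r.+1 (ev plc q).
  rewrite -(subKr (ev u q) (ev plc q)); apply: mnB => //.
  exact: ev_congr_homog um plc_max hu hq.
rewrite (ev_plc hq) => /mn_order[a [b [bv e ha]]].
apply: (binary_form_eq0 hq) => t; have [w hw] := plin_onto t.
have b0 := eval_neq0 bv; have x0 := eval_neq0 (Xin_eval r).
have : tofrac (psub q * b) == tofrac (a * 'X_i ^+ r).
  by rewrite tofracM [X in _ == X]tofracM (cross_mul e x0 b0).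
rewrite tofrac_eq => /eqP/(congr1 (dir_res v w)).
rewrite !rmorphM /= (psub_dir _ hq) (meval_eq _ hw) => e2.
have : 'X^(r.+1) %| q.@[t] *: 'X^r * dir_res v w b.
  by rewrite e2 dvdp_mulr.
rewrite -scalerAl scalerAr exprSr dvdp_mul2l; last first.
  by rewrite expf_neq0 ?polyX_eq0.
rewrite -[X in X %| _]subr0 -polyC0 dvdp_XsubCl /root hornerZ dir_res0.
by rewrite mulf_eq0 (negPf bv) orbF => /eqP.
Qed.

Lemma plc_generators x : mx x -> exists y z, [/\ O y, O z & x = plc ord0 * y + plc ord_max * z].
Proof.
move=> /max_generators[y [z [hy hz ->]]].
pose D := al ord0 * be ord_max - al ord_max * be ord0.
pose c t := tofrac (t%:MP : R).
have D0 : c D != 0 by rewrite tofrac_eq0 mpolyC_eq0.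
exists (c (be ord_max / D) * y - c (al ord_max / D) * z).
exists (c (al ord0 / D) * z - c (be ord0 / D) * y).
split; try by apply: OB; apply: OM => //; apply: OC.
rewrite !plcE -![tofrac _%:MP]/(c _).
have cD (s : k) : c (s / D) = c s / c D.
  by apply: (mulIf D0); rewrite divfK // /c -tofracM -mpolyCM divfK.
have eD : c D = c (al ord0) * c (be ord_max) - c (al ord_max) * c (be ord0).
  by rewrite /c /D mpolyCB !mpolyCM tofracB !tofracM.
by rewrite !cD; rewrite eD in D0 *; apply: cramer2.
Qed.

Lemma mn_form (u : 'I_2 -> K) n x :
    (forall c, mx (u c)) -> (forall c, mn 2 (u c - plc c)) -> mn n x ->
  exists2 B : {mpoly k[2]}, B \is n.-homog & mn n.+1 (x - ev u B).
Proof.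
move=> um hu; elim: n x => [|n IH] x.
  move=> /mn_0P/O_residue[c hc]; exists c%:MP; first exact: dhomogC.
  by rewrite evC; apply/mn_1P.
move=> /(mn_generators plc_generators)[y [z [hy hz ->]]].
have [B hB eB] := IH _ hy; have [C hC eC] := IH _ hz.
exists ('X_ord0 * B + 'X_ord_max * C); first by rewrite rpredD ?homogXM.
rewrite rmorphD !rmorphM /= !evX.
have key c y' B' : mn n y' -> mn n.+1 (y' - ev u B') -> mn n.+2 (plc c * y' - u c * ev u B').
  move=> hy' h; rewrite mulrBB -(opprB (u c)).
  apply: mnD; first by apply: (@mnM _ _ 2 n) => //; apply: mnN; apply: hu.
  by apply: mnSM.
by rewrite subrDD; apply: mnD; apply: key.
Qed.

Lemma O_poly (u : 'I_2 -> K) n x :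
    (forall c, mx (u c)) -> (forall c, mn 2 (u c - plc c)) -> O x ->
  exists B, mn n (x - ev u B).
Proof.
move=> um hu hx; elim: n => [|n [B hB]].
  by exists 0; rewrite rmorph0 subr0; apply/mn_0P.
have [C _ hC] := mn_form um hu hB; exists (B + C).
by rewrite rmorphD opprD addrA.
Qed.

End LinearParameters.
End LocalCoordinates.

(** * Nodes *)

(** Dependent choice with an invariant P and a link Q between consecutive terms, for constructions
    by successive approximation. *)
Lemma dependent_sequence (T : Type) (P : nat -> T -> Prop) (Q : nat -> T -> T -> Prop) t0 :
    P 0%N t0 -> (forall n t, P n t -> exists2 t', P n.+1 t' & Q n t t') ->
  exists s : nat -> T, forall n, P n (s n) /\ Q n (s n) (s n.+1).
Proof.
move=> P0 PS.
have /choice[g hg] (x : nat * T) : exists t', P x.1 x.2 -> P x.1.+1 t' /\ Q x.1 x.2 t'.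
  case: (pselect (P x.1 x.2)) => [/PS[t' h1 h2]|h]; first by exists t'.
  by exists t0.
pose fix s n := if n is m.+1 then g (m, s m) else t0.
have sP n : P n (s n) by elim: n => // n IH; case: (hg (n, s n) IH).
by exists s => n; split=> //; case: (hg (n, s n) (sP n)).
Qed.

(** * Truncation of power series and multiplication by a variable *)

Section PowerSeries.
Variables (n : nat) (k : fieldType).
Local Notation S := (@mpowser n k).
Implicit Types (a b : S) (m : 'X_{1..n}).

Lemma mcoeff_varM0 (q : {mpoly k[n]}) i m : m i = 0%N -> ('X_i * q)@_m = 0.
Proof.
move=> mi; rewrite mcoeffM big1 // => h /eqP e; rewrite mcoeffX.
case: eqP => [e1|_]; last by rewrite mul0r.
have := congr1 (fun m' : 'X_{1..n} => m' i) e.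
by rewrite mi mnmDE -e1 mnm1E eqxx.
Qed.

Lemma mcoeff_varM (q : {mpoly k[n]}) i m : m i != 0%N -> ('X_i * q)@_m = q@_(m - U_(i)).
Proof.
move=> mi; rewrite mulrC -[in LHS](@submK _ U_(i)%MM m) ?lep1mP // addmC.
exact: mcoeffMX.
Qed.

Lemma mps_var_mulE i b m :
  (mps_var i * b : S) m = if m i == 0%N then 0 else b (m - U_(i))%MM.
Proof.
rewrite -[LHS]/(mps_mul _ _ _) (mps_mulE (d := (mdeg m).+1)) //.
rewrite (@mcoeffM_eq _ _ _ 'X_i _ (mps_trunc (mdeg m).+1 b)) //; last first.
  by move=> j hj; rewrite mps_truncE // mcoeffX /mps_var eq_sym.
case: eqP => [/mcoeff_varM0->//|/eqP mi]; rewrite mcoeff_varM // mps_truncE //.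
by rewrite ltnS mdegB.
Qed.

Lemma mps_truncD d a b : mps_trunc d (a + b : S) = mps_trunc d a + mps_trunc d b.
Proof. by rewrite /mps_trunc -big_split; apply: eq_bigr => m _; rewrite /= -scalerDl. Qed.

Lemma mps_trunc_mul d a b m : (mdeg m < d)%N ->
  (mps_trunc d (a * b : S) - mps_trunc d a * mps_trunc d b)@_m = 0.
Proof.
move=> lt; rewrite mcoeffB mps_truncE // -[(a * b : S) m]/(mps_mul a b m).
by rewrite (mps_mulE _ _ lt) subrr.
Qed.

End PowerSeries.

(** * The local equation of the curve and its tangent cone *)

Section Neighbourhoods.
Variables (k : closedFieldType) (v : 'rV[k]_3) (i j l : 'I_3).
Hypotheses (ij : i != j) (jl : j != l) (il : i != l) (vi : v 0 i != 0).
Local Notation R := {mpoly k[3]}.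
Local Notation K := {fraction R}.
Local Notation O := (local_ring v).
Local Notation mx := (local_max v).
Local Notation mn := (ideal_pow O mx).
Variables (f : R) (n : nat).
Hypothesis hf : f \is n.+2.-homog.

(** The local equation at [v], f dehomogenized by X_i; it generates the ideal of the curve in the
    local ring. *)
Definition feq : K := tofrac f / tofrac ('X_i ^+ n.+2).
Local Notation nb := (local_nbhd f v).

Lemma local_curveP y : local_curve f v y <-> exists2 o, O o & y = feq * o.
Proof.
have x0 := eval_neq0 (Xin_eval vi n.+2).
split.
  move=> [D [a [b [ha hb bv [g eg] ->]]]].
  (* A multiple of f that is a form of degree below that of f is 0. *)
  case: (leqP n.+2 D) => [le|lt]; last first.
    have -> : a = 0 by rewrite -(pihomog_dE ha) eg mulrC (pihomogM_lt _ hf lt).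
    by exists 0; [apply: O0 | rewrite mulr0 tofrac0 mul0r].
  exists (tofrac ('X_i ^+ n.+2 * pihomog mdeg (D - n.+2) g) / tofrac b).
    apply: (O_form _ hb bv).
    have := dhomogM (Xin_homog k i n.+2) (pihomogP mdeg (D - n.+2) g).
    by rewrite subnKC.
  have -> : a = f * pihomog mdeg (D - n.+2) g.
    by rewrite mulrC -(pihomogM _ _ hf) subnK // mulrC -eg pihomog_dE.
  by rewrite /feq (tofracM f) (tofracM ('X_i ^+ n.+2)) !mulrA divfK.
move=> [_ [D [a [b [ha hb bv _ ->]]]] ->].
exists (n.+2 + D)%N, (f * a), ('X_i ^+ n.+2 * b); split.
- exact: dhomogM.
- by rewrite dhomogM ?Xin_homog.
- by rewrite mevalM mulf_neq0 ?Xin_eval.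
- by exists a.
by rewrite /feq mulf_div -!tofracM.
Qed.

Lemma nbP r x : nb r x <-> exists o y, [/\ O o, mn r y & x = feq * o + y].
Proof.
split; first by move=> [_ [z [/local_curveP[o ho ->] hz ->]]]; exists o, z.
by move=> [o [z [ho hz ->]]]; exists (feq * o), z; split=> //; apply/local_curveP; exists o.
Qed.

Lemma nb_mn r x : mn r x -> nb r x.
Proof. by move=> h; apply/nbP; exists 0, x; rewrite mulr0 add0r; split=> //; apply: O0. Qed.

Lemma nb_feq r o : O o -> nb r (feq * o).
Proof. by move=> h; apply/nbP; exists o, 0; rewrite addr0; split=> //; apply: mn0. Qed.

Lemma nbD r x y : nb r x -> nb r y -> nb r (x + y).
Proof.
move=> /nbP[o [z [ho hz ->]]] /nbP[o' [z' [ho' hz' ->]]]; apply/nbP.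
by exists (o + o'), (z + z'); rewrite mulrDr addrACA; split=> //; [apply: OD | apply: mnD].
Qed.

Lemma nbO r x y : O x -> nb r y -> nb r (x * y).
Proof.
move=> hx /nbP[o [z [ho hz ->]]]; apply/nbP; exists (x * o), (x * z).
by rewrite mulrDr mulrCA; split=> //; [apply: OM | apply: mnO].
Qed.

Lemma nbN r x : nb r x -> nb r (- x).
Proof. by move=> h; rewrite -mulN1r; apply: nbO h; apply: ON (O1 _). Qed.

Lemma nbB r x y : nb r x -> nb r y -> nb r (x - y).
Proof. by move=> hx hy; apply: nbD hx (nbN hy). Qed.

Lemma nb0 r : nb r 0. Proof. by apply/nb_mn/mn0. Qed.

Lemma nbW r s x : (s <= r)%N -> nb r x -> nb s x.
Proof. by move=> le /nbP[o [z [ho hz ->]]]; apply/nbP; exists o, z; split=> //; apply: mnW hz. Qed.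

Lemma nb_trans r x y z : nb r (x - y) -> nb r (y - z) -> nb r (x - z).
Proof. by move=> h1 h2; rewrite -(subrKA y); apply: nbD. Qed.

Lemma nb_sym r x y : nb r (x - y) -> nb r (y - x).
Proof. by move=> /nbN; rewrite opprB. Qed.

Variables (a b c : R).
Hypotheses (ha : a \is n.-homog) (hb : b \is n.-homog) (hc : c \is n.-homog).
Hypothesis ef : f = a * vlin v i j ^+ 2 + b * (vlin v i j * vlin v i l) + c * vlin v i l ^+ 2.
Local Notation X := (lcoord v i j).
Local Notation Y := (lcoord v i l).

Let val (p : R) : k := p.@[v 0] / v 0 i ^+ n.
Let kc (t : k) : K := tofrac t%:MP.

Lemma quotient_identity (F : fieldType) (A B C p q x y : F) : x != 0 -> y != 0 ->
  (A * p ^+ 2 + B * (p * q) + C * q ^+ 2) / (x * (x * y)) =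
  A / y * (p / x) ^+ 2 + B / y * (p / x * (q / x)) + C / y * (q / x) ^+ 2.
Proof. by move=> x0 y0; field; rewrite x0 y0. Qed.

Lemma residue_mx (p : R) : p \is n.-homog -> mx (tofrac p / tofrac ('X_i ^+ n) - kc (val p)).
Proof.
move=> hp; have x0 := eval_neq0 (Xin_eval vi n).
have -> : tofrac p / tofrac ('X_i ^+ n) - kc (val p) =
   tofrac (p - (val p) *: 'X_i ^+ n) / tofrac ('X_i ^+ n).
  by rewrite tofracB -mul_mpolyC tofracM mulrBl mulfK.
apply: (max_form _ (Xin_homog k i n) (Xin_eval vi n)).
  by rewrite rpredB ?rpredZ ?Xin_homog.
by rewrite mevalB mevalZ rmorphXn /= mevalXU divfK ?subrr // expf_neq0.
Qed.

Definition qform (x y z : k) (X Y : K) : K :=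
  tofrac x%:MP * X ^+ 2 + tofrac y%:MP * (X * Y) + tofrac z%:MP * Y ^+ 2.

Lemma quad_diff (A : comPzRingType) (p q r p' q' r' X Y : A) :
  p * X ^+ 2 + q * (X * Y) + r * Y ^+ 2 - (p' * X ^+ 2 + q' * (X * Y) + r' * Y ^+ 2) =
  (p - p') * (X * X) + (q - q') * (X * Y) + (r - r') * (Y * Y).
Proof. by ring. Qed.

(** Each coefficient a / X_i^n differs from its value at v by an element of m, and it multiplies an
    element of m^2. *)
Lemma feq_qform : mn 3 (feq - qform (val a) (val b) (val c) X Y).
Proof.
have -> : feq = tofrac a / tofrac ('X_i ^+ n) * X ^+ 2 +
   tofrac b / tofrac ('X_i ^+ n) * (X * Y) + tofrac c / tofrac ('X_i ^+ n) * Y ^+ 2.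
  have ex : tofrac ('X_i ^+ n.+2) = tofrac 'X_i * (tofrac 'X_i * tofrac ('X_i ^+ n)) :> K.
    by rewrite [in LHS]exprS tofracM [in LHS]exprS tofracM.
  have e : tofrac f = tofrac a * tofrac (vlin v i j) ^+ 2 +
    tofrac b * (tofrac (vlin v i j) * tofrac (vlin v i l)) +
    tofrac c * tofrac (vlin v i l) ^+ 2 .
    rewrite ef [in LHS]tofracD [X in X + _ = _]tofracD (tofracM a) (tofracM b) (tofracM c).
    by rewrite !tofracXn (tofracM (vlin v i j)).
  rewrite /feq ex e; exact: quotient_identity (Xi_neq0 vi) (eval_neq0 (Xin_eval vi n)).
rewrite /qform quad_diff.
have XX p q r : mx p -> mx q -> mx r -> mn 3 (p * (q * r)).
  by move=> hp hq hr; apply: mnSM => //; apply: mnSM => //; apply/mn_1P.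
by do !apply: mnD; apply: XX; try exact: lcoord_max; apply: residue_mx.
Qed.

Lemma feq_mn2 : mn 2 feq.
Proof.
rewrite -(subrK (qform (val a) (val b) (val c) X Y) feq).
apply: mnD; first exact: mnW (feq_qform).
have XX q r : mx q -> mx r -> mn 2 (q * r) by move=> hq hr; apply: mnSM => //; apply/mn_1P.
by do !apply: mnD; apply: mnO; try exact: OC; rewrite ?expr2; apply: XX; exact: lcoord_max.
Qed.

(** The local equation lies in m^2, so modulo m^r with r at most 2 the curve cannot be told from the
    plane; this carries membership in m and tangent vectors from the completion to the plane. *)
Lemma nb_small r x : (r <= 2)%N -> nb r x -> mn r x.
Proof.
move=> le /nbP[o [y [ho hy ->]]]; apply: mnD => //.
by rewrite mulrC; apply: mnO => //; apply: mnW feq_mn2.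
Qed.

End Neighbourhoods.

Lemma product_two_lines (A : comPzRingType) (s1 s2 t1 t2 X Y : A) :
  (s1 * t1) * X ^+ 2 + (s1 * t2 + s2 * t1) * (X * Y) + (s2 * t2) * Y ^+ 2 =
  (s1 * X + s2 * Y) * (t1 * X + t2 * Y).
Proof. by ring. Qed.

(** The corrections are crossed: p, the coefficient of L1, is added to y, the cofactor of x, and q
    to x. As x - L1 and y - L2 lie in m^2, the new error gains one order. *)
Lemma newton_step (A : comPzRingType) (F L1 L2 x y p q : A) :
  F - x * y = L1 * p + L2 * q ->
  F - (x + q) * (y + p) = - (x - L1) * p + - (y - L2) * q - q * p.
Proof.
move=> e; transitivity ((F - x * y) - x * p - y * q - q * p); first by ring.
by rewrite e; ring.
Qed.

Lemma ord2P (c : 'I_2) : c = ord0 \/ c = ord_max.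
Proof. by case: c => [[|[|//]] hc]; [left|right]; apply/val_inj. Qed.

(** * From distinct tangents to a node *)

Section NodalPoints.
Variables (k : closedFieldType) (v : 'rV[k]_3) (i j l : 'I_3).
Hypotheses (ij : i != j) (jl : j != l) (il : i != l) (vi : v 0 i != 0).
Local Notation R := {mpoly k[3]}.
Local Notation K := {fraction R}.
Local Notation O := (local_ring v).
Local Notation mx := (local_max v).
Local Notation mn := (ideal_pow O mx).
Variables (f : R) (n : nat).
Hypothesis hf : f \is n.+2.-homog.
Variables (a b c : R).
Hypotheses (ha : a \is n.-homog) (hb : b \is n.-homog) (hc : c \is n.-homog).
Hypothesis ef : f = a * vlin v i j ^+ 2 + b * (vlin v i j * vlin v i l) + c * vlin v i l ^+ 2.
Local Notation X := (lcoord v i j).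
Local Notation Y := (lcoord v i l).
Local Notation nb := (local_nbhd f v).
Local Notation F := (feq i f n).
Local Notation val p := (p.@[v 0] / v 0 i ^+ n).
Local Notation kc t := (tofrac (t%:MP : R)).

Let kcM s t : kc (s * t) = kc s * kc t. Proof. by rewrite mpolyCM tofracM. Qed.
Let kcD s t : kc (s + t) = kc s + kc t. Proof. by rewrite mpolyCD tofracD. Qed.

Let nB r x y : nb r x -> nb r y -> nb r (x - y). Proof. exact: (nbB vi hf). Qed.
Let nD r x y : nb r x -> nb r y -> nb r (x + y). Proof. exact: (nbD vi hf). Qed.
Let nO r x y : O x -> nb r y -> nb r (x * y). Proof. exact: (nbO vi hf). Qed.
Let nM r x : mn r x -> nb r x. Proof. exact: (nb_mn vi hf). Qed.
Let nF r o : O o -> nb r (F * o). Proof. exact: (nb_feq vi hf r). Qed.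
Let n0 r : nb r 0. Proof. exact: (nb0 vi hf r). Qed.
Let nT r x y z : nb r (x - y) -> nb r (y - z) -> nb r (x - z).
Proof. exact: (nb_trans vi hf). Qed.
Let nS r x y : nb r (x - y) -> nb r (y - x). Proof. exact: (nb_sym vi hf). Qed.
Let nP := nbP vi hf.

Section Completion.
Variables (al be : 'I_2 -> k).
Hypothesis det : al ord0 * be ord_max - al ord_max * be ord0 != 0.
Local Notation L := (plc v i j l al be).
Hypothesis hF : mn 3 (F - L ord0 * L ord_max).

Let L_max c' : mx (L c'). Proof. exact: plc_max. Qed.
Let L_gen := plc_generators ij jl il vi det.

(* Hensel: the factorization of the tangent cone into two lines lifts modulo
   every power of the maximal ideal, to the two formal branches of the curve. *)
Lemma branches_exist : exists h : nat -> 'I_2 -> K, forall r,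
  [/\ forall c', mx (h r c'), forall c', mn 2 (h r c' - L c'),
      mn r (F - h r ord0 * h r ord_max) & forall c', mn r (h r.+1 c' - h r c')].
Proof.
pose P r (z : K * K) := [/\ mn 2 (z.1 - L ord0), mn 2 (z.2 - L ord_max)
  & mn r.+3 (F - z.1 * z.2)].
pose Q r (z z' : K * K) := mn r.+2 (z'.1 - z.1) /\ mn r.+2 (z'.2 - z.2).
have P0 : P 0%N (L ord0, L ord_max) by split=> //=; rewrite subrr; apply: mn0.
have [r [x y] [h1 h2 /= h3]|s hs] := @dependent_sequence _ P Q _ P0.
  have [p [q [hp hq e]]] := mn_generators L_gen h3.
  exists (x + q, y + p); last by split; rewrite /= addrAC subrr add0r.
  split=> /=.
  - by rewrite addrAC; apply: mnD => //; apply: mnW hq.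
  - by rewrite addrAC; apply: mnD => //; apply: mnW hp.
  rewrite (newton_step e); apply: mnB.
    by apply: mnD; apply: (@mnM _ _ 2 r.+2) => //; apply: mnN.
  by apply: mnW (mnM hq hp); lia.
exists (fun r c' => if c' == ord0 then (s r).1 else (s r).2) => r.
have [[h1 h2 h3] [h4 h5]] := hs r.
have hL : forall c', mn 2 ((if c' == ord0 then (s r).1 else (s r).2) - L c').
  by move=> c'; case: (ord2P c') => ->.
split=> //.
- move=> c'; rewrite -(subrK (L c') (if _ then _ else _)); apply: maxD => //.
  by apply/mn_1P; apply: mnW (hL c').
- by apply: mnW h3; lia.
- by move=> c'; case: (ord2P c') => -> /=; [apply: mnW h4 | apply: mnW h5]; lia.
Qed.

Lemma nodal_of_factorization : nodal_point f v.
Proof.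
have [h hh] := branches_exist.
have hm r c' : mx (h r c') by case: (hh r).
have hO r c' : O (h r c') by apply: maxO.
have hu r c' : mn 2 (h r c' - L c') by case: (hh r).
have hF' r : mn r (F - h r ord0 * h r ord_max) by case: (hh r).
have hS r c' : mn r (h r.+1 c' - h r c') by case: (hh r).
(* At level r the series is cut at degree r and evaluated at the r-th approximations of the two
   branches; the discarded terms lie in m^r. *)
pose phi (x : @mpowser 2 k) r := ev (h r) (mps_trunc r x).
have ev0 r p : (forall m, (mdeg m < r)%N -> p@_m = 0) -> mn r (ev (h r) p).
  by apply: ev_order.
have phiM x y r : mn r (phi (x * y) r - phi x r * phi y r).
  by rewrite /phi -rmorphM -rmorphB; apply: ev0 => m; apply: mps_trunc_mul.
have phiO x r : O (phi x r) by apply: ev_O.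
have phiV c' r : mn r (phi (mps_var c') r - h r c').
  rewrite /phi -(evX (h r)) -rmorphB; apply: ev0 => m lt.
  by rewrite mcoeffB mps_truncE // mcoeffX /mps_var eq_sym subrr.
have prod_nb r : nb r (h r ord0 * h r ord_max).
  have -> : h r ord0 * h r ord_max = F * 1 - (F - h r ord0 * h r ord_max).
    by rewrite mulr1 subKr.
  by apply: nB; [apply: nF => //; apply: O1 | apply: nM].
have diff_mn r p q : mn r (p - q) -> nb r q -> nb r p.
  by move=> h1 h2; rewrite -(subrK q p); apply: nD => //; apply: nM.
exists phi; split.
- move=> x; split=> // r; apply: nM.
  rewrite /phi -(subrKA (ev (h r.+1) (mps_trunc r x))) -rmorphB; apply: mnD.
    apply: ev_order => // m lt; rewrite mcoeffB !mps_truncE ?subrr //; exact: ltnW.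
  by apply: ev_congr.
- split.
  + by move=> x y r; rewrite /phi mps_truncD rmorphD subrr; apply: n0.
  + by move=> x y r; apply: nM.
  move=> t r; apply: nM; rewrite /phi -(evC (h r)) -rmorphB; apply: ev0 => m lt.
  rewrite mcoeffB mps_truncE // mcoeffC /mps_const.
  by case: eqP => _; rewrite ?mulr1 ?mulr0 subrr.
- move=> x [xO xS].
  (* Surjectivity: [A] approximates x at level r, and the next polynomial only adds a form of degree
     r, so each coefficient eventually stabilizes. *)
  pose P r (A : {mpoly k[2]}) := nb r (ev (h r) A - x r).
  pose Q r (A A' : {mpoly k[2]}) := forall m, (mdeg m < r)%N -> A'@_m = A@_m.
  have P0 : P 0%N 0.
    by apply: nM; apply/mn_0P; rewrite rmorph0 sub0r; apply: ON.
  have [r A hA|A hA] := @dependent_sequence _ P Q _ P0.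
    have : nb r (x r.+1 - ev (h r.+1) A).
      apply: (nT (xS r)); apply: (nT (nS hA)).
      by apply: nS; apply: nM; apply: ev_congr.
    move=> /nP[o [mu [ho hmu e]]].
    have [B hB eB] := mn_form ij jl il vi det (hm r.+1) (hu r.+1) hmu.
    exists (A + B); last first.
      move=> m lt; rewrite mcoeffD (dhomog_nemf_coeff hB) ?addr0 //.
      by rewrite neq_ltn lt.
    apply: nS; rewrite rmorphD /= opprD addrA e -addrA.
    by apply: nD; [apply: nF | apply: nM].
  (* The coefficient at m is final from level mdeg m + 1 on. *)
  exists (fun m => (A (mdeg m).+1)@_m) => r.
  have stable s m : (mdeg m < s)%N -> (A (mdeg m).+1)@_m = (A s)@_m.
    elim: s => // s IH; rewrite ltnS leq_eqVlt => /orP[/eqP<- //|lt].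
    by rewrite IH //; case: (hA s) => _ /(_ m lt).
  case: (hA r) => hr _; apply: (nT _ hr); apply: nM.
  rewrite -rmorphB; apply: ev0 => m lt.
  by rewrite mcoeffB mps_truncE // (stable r m lt) subrr.
- move=> x; split.
    move=> hx; pose v0 : 'X_{1..2} := U_(ord0)%MM; pose v1 : 'X_{1..2} := U_(ord_max)%MM.
    (* At level r the value of x is a multiple F o of the equation modulo m^r. With F replaced by
       the product of the branches and o by a polynomial G in them, x - u v G has value in m^r, so
       its coefficients of degree below r vanish. *)
    have x0 (m : 'X_{1..2}) : m ord0 = 0%N \/ m ord_max = 0%N -> x m = 0.
      move=> hm0; set r := (mdeg m).+1; have := hx r; rewrite subr0.
      move=> /nP[o [mu [ho hmu e]]].
      have [G hG] := O_poly ij jl il vi det r (hm r) (hu r) ho.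
      have : mn r (ev (h r) (mps_trunc r x - 'X_ord0 * ('X_ord_max * G))).
        rewrite rmorphB !rmorphM /= !evX -/(phi x r) e mulrA.
        have -> : F * o + mu - h r ord0 * h r ord_max * ev (h r) G =
           (F - h r ord0 * h r ord_max) * o +
           h r ord0 * h r ord_max * (o - ev (h r) G) + mu.
          by rewrite mulrBl mulrBr addrA subrK addrAC.
        apply: mnD => //; apply: mnD; first by rewrite mulrC; apply: mnO.
        by apply: mnO => //; apply: OM.
      move=> /(regular_parameters ij jl il vi det (hm r) (hu r))/(_ m (leqnn _)).
      rewrite mcoeffB mps_truncE // => /eqP; rewrite subr_eq0 => /eqP ->.
      case: hm0 => hm0; first by rewrite mcoeff_varM0.
      have [z|nz] := eqVneq (m ord0) 0%N; first by rewrite mcoeff_varM0.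
      by rewrite mcoeff_varM // mcoeff_varM0 // mnmBE hm0.
    (* Only monomials divisible by u v are left; the quotient by u v shifts the exponents. *)
    exists (fun m => x (m + v1 + v0)%MM); apply/funext => m.
    rewrite -mulrA mps_var_mulE; case: eqP => [z|/eqP nz]; first by apply: x0; left.
    rewrite mps_var_mulE; case: eqP => [z|/eqP nz'].
      by apply: x0; right; move: z; rewrite mnmBE mnm1E subn0.
    by rewrite !submK // ?lep1mP.
  move=> [y ->] r; rewrite subr0.
  apply: (diff_mn _ _ _ (phiM _ _ _)); rewrite mulrC; apply: nO => //.
  apply: (diff_mn _ _ _ (phiM _ _ _)).
  apply: (diff_mn _ _ (h r ord0 * h r ord_max)) => //.
  rewrite mulrBB; apply: mnD; first by rewrite mulrC; apply: mnO.
  by apply: mnO.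
Qed.

End Completion.

Let feqq := feq_qform vi ha hb hc ef.

(** The tangent cone is a product of two linear forms; its discriminant is the square of their
    determinant, so they can serve as parameters. *)
Lemma nodal_of_discriminant :
  b.@[v 0] ^+ 2 - 4 * a.@[v 0] * c.@[v 0] != 0 -> nodal_point f v.
Proof.
move=> disc.
have [s [t [ea eb ec]]] := binary_quadratic_factor (val a) (val b) (val c).
pose al (c' : 'I_2) := if c' == ord0 then s.1 else t.1.
pose be (c' : 'I_2) := if c' == ord0 then s.2 else t.2.
apply: (@nodal_of_factorization al be).
  apply: contraNneq disc => /= det0.
  have vn : v 0 i ^+ n != 0 by rewrite expf_neq0.
  have e p : p.@[v 0] = val p * v 0 i ^+ n by rewrite divfK.
  rewrite (e a) (e b) (e c) ea eb ec; apply/eqP.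
  transitivity ((s.1 * t.2 - t.1 * s.2) ^+ 2 * (v 0 i ^+ n) ^+ 2); first by ring.
  by rewrite det0 expr0n mul0r.
have -> : plc v i j l al be ord0 * plc v i j l al be ord_max = qform (val a) (val b) (val c) X Y.
  by rewrite !plcE // ea eb ec /qform kcD !kcM product_two_lines.
exact: feqq.
Qed.

End NodalPoints.

(** The two linear forms have an invertible coefficient matrix and their product is o times the
    quadratic form. The discriminant of the product is the squared determinant, and also o^2 times
    that of the form. *)
Lemma discriminant_neq0 (F : fieldType) (a b c o s1 s2 t1 t2 p q r z : F) :
    p * s1 + q * t1 = 1 -> p * s2 + q * t2 = 0 ->
    r * s1 + z * t1 = 0 -> r * s2 + z * t2 = 1 ->
    s1 * t1 = o * a -> s1 * t2 + s2 * t1 = o * b -> s2 * t2 = o * c ->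
  b ^+ 2 - 4 * a * c != 0.
Proof.
move=> e1 e2 e3 e4 ea eb ec; apply/eqP => d0.
have : (s1 * t2 - s2 * t1) ^+ 2 = 0.
  transitivity ((s1 * t2 + s2 * t1) ^+ 2 - 4 * (s1 * t1) * (s2 * t2)); first by ring.
  rewrite ea eb ec; transitivity (o ^+ 2 * (b ^+ 2 - 4 * a * c)); first by ring.
  by rewrite d0 mulr0.
move/eqP; rewrite sqrf_eq0 => /eqP dt.
have : (p * z - q * r) * (s1 * t2 - s2 * t1) = 1.
  transitivity ((p * s1 + q * t1) * (r * s2 + z * t2) -
    (p * s2 + q * t2) * (r * s1 + z * t1)); first by ring.
  by rewrite e1 e2 e4 mul0r subr0 mulr1.
by rewrite dt mulr0 => /eqP; rewrite eq_sym oner_eq0.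
Qed.

Lemma combination_diff (A : comPzRingType) (o x y z x' y' z' P Q S : A) :
  x * P + y * Q + z * S - o * (x' * P + y' * Q + z' * S) =
  (x - o * x') * P + (y - o * y') * Q + (z - o * z') * S.
Proof. by ring. Qed.

Lemma substitute_lines (A : comPzRingType) (Z X Y u w p q a1 b1 a2 b2 : A) :
  Z - (p * u + q * w) + (p * (u - (a1 * X + b1 * Y)) + q * (w - (a2 * X + b2 * Y))) =
  Z - ((p * a1 + q * a2) * X + (p * b1 + q * b2) * Y).
Proof. by ring. Qed.

Lemma subrDr_swap (A : zmodType) (x y z : A) : y = x - z - (x - (y + z)).
Proof. by rewrite opprB addrC addrA subrK addrK. Qed.

(** * From a node to distinct tangents *)

Section NodalConverse.
Variables (k : closedFieldType) (v : 'rV[k]_3) (i j l : 'I_3).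
Hypotheses (ij : i != j) (jl : j != l) (il : i != l) (vi : v 0 i != 0).
Local Notation R := {mpoly k[3]}.
Local Notation O := (local_ring v).
Local Notation mx := (local_max v).
Local Notation mn := (ideal_pow O mx).
Local Notation X := (lcoord v i j).
Local Notation Y := (lcoord v i l).
Local Notation kc t := (tofrac (t%:MP : R)).

Let kcM s t : kc (s * t) = kc s * kc t. Proof. by rewrite mpolyCM tofracM. Qed.
Let kcD s t : kc (s + t) = kc s + kc t. Proof. by rewrite mpolyCD tofracD. Qed.
Let kcB s t : kc (s - t) = kc s - kc t. Proof. by rewrite mpolyCB tofracB. Qed.
Let kcN s : kc (- s) = - kc s. Proof. by rewrite mpolyCN tofracN. Qed.
Let kc0 : kc 0 = 0. Proof. by rewrite mpolyC0 tofrac0. Qed.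
Let kc1 : kc 1 = 1. Proof. by rewrite mpolyC1 tofrac1. Qed.

Lemma coordinate_form_eq0 r (p : {mpoly k[2]}) : p \is r.-homog ->
  mn r.+1 (ev (fun c => if c == ord0 then X else Y) p) -> p = 0.
Proof.
move=> hp h; pose al (c : 'I_2) : k := (c == ord0)%:R.
pose be (c : 'I_2) : k := (c == ord_max)%:R.
have det : al ord0 * be ord_max - al ord_max * be ord0 != 0.
  by rewrite /al /be /= mulr1 mulr0 subr0 oner_neq0.
apply/mpolyP => m; rewrite mcoeff0; case: (leqP (mdeg m) r) => le.
  apply: (regular_parameters ij jl il vi det _ _ h) => // c.
    by case: (ord2P c) => -> /=; apply: lcoord_max.
  rewrite plcE // /al /be; suff -> : (if c == ord0 then X else Y) =
     kc (c == ord0)%:R * X + kc (c == ord_max)%:R * Y by rewrite subrr; apply: mn0.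
  by case: (ord2P c) => -> /=; rewrite kc0 kc1 mul0r mul1r ?addr0 ?add0r.
by apply: (dhomog_nemf_coeff hp); rewrite neq_ltn le orbT.
Qed.

Lemma linear_form_eq0 (x y : k) : mn 2 (kc x * X + kc y * Y) -> x = 0 /\ y = 0.
Proof.
move=> h; have e : x *: 'X_ord0 + y *: 'X_ord_max = 0 :> {mpoly k[2]}.
  apply: (@coordinate_form_eq0 1); first by rewrite rpredD ?rpredZ ?dhomogU.
  by rewrite rmorphD /= !evZ !evX.
have e0 := congr1 (meval (fun c => (c == ord0)%:R)) e.
have e1 := congr1 (meval (fun c => (c == ord_max)%:R)) e.
move: e0 e1; rewrite !mevalD !mevalZ !mevalXU !meval0 /=.
by rewrite !mulr0 !mulr1 addr0 add0r.
Qed.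

Lemma quadratic_form_eq0 (x y z : k) : mn 3 (qform x y z X Y) -> [/\ x = 0, y = 0 & z = 0].
Proof.
move=> h; have e : x *: 'X_ord0 ^+ 2 + y *: ('X_ord0 * 'X_ord_max) +
    z *: 'X_ord_max ^+ 2 = 0 :> {mpoly k[2]}.
  apply: (@coordinate_form_eq0 2).
    rewrite !rpredD ?rpredZ //; [|exact: (dhomogM (dhomogU _ _) (dhomogU _ _))|];
    exact: (dhomogM (dhomogU _ _) (dhomogU _ _)).
  by rewrite !rmorphD /= !evZ !rmorphXn /= rmorphM /= !evX.
(* The points (1, 0), (0, 1) and (1, 1) read off the three coefficients. *)
have e0 := congr1 (meval (fun c => (c == ord0)%:R)) e.
have e1 := congr1 (meval (fun c => (c == ord_max)%:R)) e.
have e2 := congr1 (meval (fun=> 1)) e.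
move: e0 e1 e2; rewrite !mevalD !mevalZ !rmorphXn /= !rmorphM /= !mevalXU !meval0 /=.
rewrite !expr1n !expr0n !mul0r !mulr0 !mulr1 !addr0 !add0r => -> ->.
by rewrite addr0 add0r => ->.
Qed.

Lemma tangent_coordinates x : mx x -> exists s t : k, mn 2 (x - (kc s * X + kc t * Y)).
Proof.
move=> /(max_generators ij jl il vi)[y [z [/O_residue[s hs] /O_residue[t ht] ->]]].
exists s, t; rewrite subrDD [kc s * _]mulrC [kc t * _]mulrC -!mulrBr.
by apply: mnD; apply: mnSM; try exact: lcoord_max; apply/mn_1P.
Qed.

Variables (f : R) (n : nat).
Hypothesis hf : f \is n.+2.-homog.
Variables (a b c : R).
Hypotheses (ha : a \is n.-homog) (hb : b \is n.-homog) (hc : c \is n.-homog).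
Hypothesis ef : f = a * vlin v i j ^+ 2 + b * (vlin v i j * vlin v i l) + c * vlin v i l ^+ 2.
Local Notation nb := (local_nbhd f v).
Local Notation F := (feq i f n).
Local Notation val p := (p.@[v 0] / v 0 i ^+ n).

Let nD r x y : nb r x -> nb r y -> nb r (x + y). Proof. exact: (nbD vi hf). Qed.
Let nO r x y : O x -> nb r y -> nb r (x * y). Proof. exact: (nbO vi hf). Qed.
Let nM r x : mn r x -> nb r x. Proof. exact: (nb_mn vi hf). Qed.
Let n0 r : nb r 0. Proof. exact: (nb0 vi hf r). Qed.
Let nT r x y z : nb r (x - y) -> nb r (y - z) -> nb r (x - z).
Proof. exact: (nb_trans vi hf). Qed.
Let nS r x y : nb r (x - y) -> nb r (y - x). Proof. exact: (nb_sym vi hf). Qed.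
Let nW r s x : (s <= r)%N -> nb r x -> nb s x. Proof. exact: (nbW vi hf). Qed.
Let nP := nbP vi hf.
Let nL r x : (r <= 2)%N -> nb r x -> mn r x. Proof. exact: (nb_small vi hf ha hb hc ef). Qed.

(** A monomial other than 1 is divisible by u or else by v; [z] receives those free of u. *)
Lemma mps_decomposition (x : @mpowser 2 k) : exists y z : @mpowser 2 k,
  x = mps_const (x 0%MM) + (mps_var ord0 * y + mps_var ord_max * z).
Proof.
exists (fun m : 'X_{1..2} => x (m + U_(ord0))%MM).
exists (fun m : 'X_{1..2} => if m ord0 == 0%N then x (m + U_(ord_max))%MM else 0).
apply/funext => m.
rewrite -[RHS]/(mps_const (x 0%MM) m + ((mps_var ord0 * _ : @mpowser 2 k) m +
  (mps_var ord_max * _ : @mpowser 2 k) m)) !mps_var_mulE /mps_const.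
have [->|m0] := eqVneq m 0%MM; first by rewrite !mnm0E !eqxx !addr0.
rewrite add0r; have [z0|nz0] := eqVneq (m ord0) 0%N; last first.
  rewrite submK ?lep1mP //; case: eqP => _; first by rewrite addr0.
  by rewrite mnmBE mnm1E subn0 (negPf nz0) addr0.
rewrite add0r mnmBE z0 sub0n eqxx; case: eqP => [z1|/eqP nz1].
  by case/eqP: m0; apply/mnmP => c'; rewrite mnm0E; case: (ord2P c') => ->.
by rewrite submK ?lep1mP.
Qed.

(** The images u, w of the two variables lie in m and span m / m^2, while u w is 0 on the curve.
    Modulo m^3 this makes the product of two independent linear forms a multiple of the tangent
    cone. *)
Lemma discriminant_of_nodal : nodal_point f v ->
  b.@[v 0] ^+ 2 - 4 * a.@[v 0] * c.@[v 0] != 0.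
Proof.
move=> [phi [phiC [phiD phiM phiK] phiS phi0]].
have phiO x r : O (phi x r) by case: (phiC x).
have stepO x r : nb r (phi x r.+1 - phi x r) by case: (phiC x).
have step_mx x r : mx (phi x r.+2 - phi x r.+1).
  by apply/mn_1P/nL => //; apply: (nW _ (stepO x r.+1)).
(* Whether the image of x is in m does not depend on the level, since successive terms differ by
   elements of m. *)
have mx_all x r : mx (phi x 1) -> mx (phi x r.+1).
  by move=> h; elim: r => // r IH; rewrite -(subrK (phi x r.+1) (phi x r.+2)); apply: maxD.
have nmx_all x r : ~ mx (phi x 1) -> ~ mx (phi x r.+1).
  move=> h; elim: r => // r IH h'; apply: IH.
  by rewrite -(subKr (phi x r.+2) (phi x r.+1)); apply: maxD => //; rewrite -mulN1r;
    apply: maxM => //; apply: ON; apply: O1.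
(* If x maps to a unit and x y to 0, then y maps to 0, so y lies in (u v). Applied to the two
   variables, neither of which is in (u v), this shows that both map into m. *)
have unit_case x y : completion_eq f v (phi (x * y)) (fun=> 0) -> ~ mx (phi x 1) ->
    exists z, y = mps_var ord0 * mps_var ord_max * z.
  move=> hxy nm; apply/phi0 => r; rewrite subr0; case: r => [|r].
    by apply: nM; apply/mn_0P.
  have [u0 uO] := O_inv (phiO x r.+1) (nmx_all x r nm).
  rewrite -(mulKf u0 (phi y r.+1)); apply: nO => //.
  rewrite -(subr0 (_ * _)); apply: (nT (nS (phiM x y r.+1))); exact: hxy.
have varxy : completion_eq f v (phi (mps_var ord0 * mps_var ord_max)) (fun=> 0).
  by apply/phi0; exists 1; rewrite mulr1.
have novar c' : ~ exists z : @mpowser 2 k, mps_var c' = mps_var ord0 * mps_var ord_max * z.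
  move=> [z /(congr1 (fun x : @mpowser 2 k => x U_(c')%MM))].
  rewrite -mulrA !mps_var_mulE /mps_var eqxx mnmBE !mnm1E.
  by case: (ord2P c') => -> /= /eqP; rewrite oner_eq0.
have Um : mx (phi (mps_var ord0) 1).
  by case: (pselect (mx (phi (mps_var ord0) 1))) => // /(unit_case _ _ varxy)/novar.
have Vm : mx (phi (mps_var ord_max) 1).
  case: (pselect (mx (phi (mps_var ord_max) 1))) => // nV.
  case: (@novar ord0); apply: (unit_case (mps_var ord_max)) => //.
  by rewrite mulrC.
(* Level 3 suffices: only the quadratic part of u w is compared. *)
pose u := phi (mps_var ord0) 3; pose w := phi (mps_var ord_max) 3.
have um : mx u by apply: mx_all.
have wm : mx w by apply: mx_all.
(* Surjectivity represents x by a series; its constant term vanishes since x, u and w are in m, and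
   its linear terms give the combination modulo m^2. *)
have span x : mx x -> exists p q : k, mn 2 (x - (kc p * u + kc q * w)).
  move=> hx; have [|y hy] := phiS (fun=> x).
    by split=> r; [apply: maxO | rewrite subrr].
  have [y1 [y2 ey]] := mps_decomposition y.
  have [p hp] := O_residue (phiO y1 3); have [q hq] := O_residue (phiO y2 3).
  exists p, q; set p0 := y 0%MM in ey.
  have e3 : nb 3 (x - (kc p0 + (u * phi y1 3 + w * phi y2 3))).
    apply: (nT (nS (hy 3))); rewrite ey; apply: (nT (phiD _ _ 3)).
    rewrite subrDD; apply: nD; first exact: phiK.
    apply: (nT (phiD _ _ 3)); rewrite subrDD; apply: nD; exact: phiM.
  have e2 : mn 2 (x - (kc p0 + (u * phi y1 3 + w * phi y2 3))).
    by apply: nL => //; apply: nW e3.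
  have p00 : p0 = 0.
    apply: (@maxC _ v); have -> : kc p0 = x - (u * phi y1 3 + w * phi y2 3) -
      (x - (kc p0 + (u * phi y1 3 + w * phi y2 3))).
      exact: subrDr_swap.
    apply: maxD; first (apply: maxD => //; rewrite -mulN1r).
      apply: maxM; first by apply: ON; apply: O1.
      by apply: maxD; rewrite mulrC; apply: maxM.
    by apply/mn_1P/mnN; apply: mnW e2.
  move: e2; rewrite p00 kc0 add0r => e2.
  rewrite -(subrKA (u * phi y1 3 + w * phi y2 3)); apply: mnD => //.
  rewrite subrDD ![kc _ * _]mulrC -!mulrBr.
  by apply: mnD; apply: mnSM => //; apply/mn_1P.
have [s1 [t1 eu]] := tangent_coordinates um.
have [s2 [t2 ew]] := tangent_coordinates wm.
have [p [q eX]] := span _ (lcoord_max vi j).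
have [r [z eY]] := span _ (lcoord_max vi l).
have comb x y x' : mn 2 (x' - (kc x * u + kc y * w)) ->
    mn 2 (x' - (kc (x * s1 + y * s2) * X + kc (x * t1 + y * t2) * Y)).
  move=> h; rewrite !kcD !kcM -(substitute_lines _ _ _ u w); apply: mnD => //.
  by apply: mnD; apply: mnO => //; apply: OC.
(* X and Y are written in u and w, and these back in X and Y; independence of X and Y modulo m^2
   makes the two coefficient matrices inverse to each other. *)
have [E1 E2] : 1 - (p * s1 + q * s2) = 0 /\ - (p * t1 + q * t2) = 0.
  apply: linear_form_eq0; move: (comb _ _ _ eX).
  by rewrite kcB kc1 kcN mulrBl mul1r mulNr -addrA -opprD.
have [E3 E4] : - (r * s1 + z * s2) = 0 /\ 1 - (r * t1 + z * t2) = 0.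
  apply: linear_form_eq0; move: (comb _ _ _ eY).
  by rewrite kcB kc1 kcN mulrBl mul1r mulNr addrCA -opprD.
have /nP[o [mu [ho hmu eo]]] : nb 3 (u * w).
  by rewrite -(subr0 (u * w)); apply: (nT (nS (phiM _ _ 3))); apply: varxy.
have [o0 ho0] := O_residue ho.
(* u w is the product of the two linear parts modulo m^3; by the equation of the curve it is also o
   F, whose quadratic part is o0 times the tangent cone. *)
have quad : mn 3 (qform (s1 * s2) (s1 * t2 + t1 * s2) (t1 * t2) X Y -
    kc o0 * qform (val a) (val b) (val c) X Y).
  rewrite -(subrKA (u * w)); apply: mnD.
    rewrite /qform kcD !kcM product_two_lines -opprB; apply: mnN.
    rewrite mulrBB; apply: mnD; first by rewrite mulrC; apply: mnSM.
    by apply: mnSM => //; apply: maxD; apply: maxM; try exact: OC; apply: lcoord_max.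
  rewrite eo addrAC; apply: mnD => //.
  rewrite [F * o]mulrC mulrBB; apply: mnD.
    by apply: mnSM => //; apply: (feq_mn2 vi ha hb hc ef).
  by apply: mnO; [apply: OC | apply: (feq_qform vi ha hb hc ef)].
have [Q1 Q2 Q3] : [/\ s1 * s2 - o0 * val a = 0, s1 * t2 + t1 * s2 - o0 * val b = 0
    & t1 * t2 - o0 * val c = 0].
  apply: quadratic_form_eq0; move: quad.
  by rewrite /qform combination_diff -!kcM -!kcB.
have vn : v 0 i ^+ n != 0 by rewrite expf_neq0.
have : val b ^+ 2 - 4 * val a * val c != 0.
  apply: (@discriminant_neq0 _ _ _ _ o0 s1 t1 s2 t2 p q r z).
  - by apply/esym/eqP; rewrite -subr_eq0; apply/eqP.
  - by apply/eqP; rewrite -oppr_eq0; apply/eqP.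
  - by apply/eqP; rewrite -oppr_eq0; apply/eqP.
  - by apply/esym/eqP; rewrite -subr_eq0; apply/eqP.
  - by apply/eqP; rewrite -subr_eq0; apply/eqP.
  - by apply/eqP; rewrite -subr_eq0; apply/eqP.
  - by apply/eqP; rewrite -subr_eq0; apply/eqP.
apply: contraNneq => d0; apply/eqP.
transitivity ((b.@[v 0] ^+ 2 - 4 * a.@[v 0] * c.@[v 0]) / (v 0 i ^+ n) ^+ 2).
  by field.
by rewrite d0 mul0r.
Qed.

End NodalConverse.

(** * The gradient ideal at a double point *)

Section DoublePointJacobian.
Variables (k : closedFieldType) (v : 'rV[k]_3) (i j l : 'I_3).
Hypotheses (ij : i != j) (jl : j != l) (il : i != l) (vi : v 0 i != 0).
Local Notation R := {mpoly k[3]}.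
Variables (f : R) (n : nat).
Hypothesis hf : f \is n.+2.-homog.
Variables (a b c : R).
Local Notation lj := (vlin v i j).
Local Notation ll := (vlin v i l).
Hypothesis ef : f = a * lj ^+ 2 + b * (lj * ll) + c * ll ^+ 2.

Let ji : j != i. Proof. by rewrite eq_sym. Qed.
Let li : l != i. Proof. by rewrite eq_sym. Qed.
Let lj_v : lj.@[v 0] = 0. Proof. exact: vlin_v. Qed.
Let ll_v : ll.@[v 0] = 0. Proof. exact: vlin_v. Qed.

(** The four [dbl] forms are the coefficients of the partials along j and l in terms of [lj] and
    [ll]; at v their matrix is the Hessian of the tangent cone. *)
Definition dbl_jj := 2 * a + a^`M(j) * lj + b^`M(j) * ll.
Definition dbl_jl := b + c^`M(j) * ll.
Definition dbl_lj := b + a^`M(l) * lj.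
Definition dbl_ll := 2 * c + b^`M(l) * lj + c^`M(l) * ll.

Lemma double_point_partial_j : f^`M(j) = dbl_jj * lj + dbl_jl * ll.
Proof.
rewrite ef !expr2 !mderivD !mderivM !mderiv_vlin // eqxx [l == j]eq_sym (negPf jl).
rewrite mulr1n mulr0n /dbl_jj /dbl_jl; ring.
Qed.

Lemma double_point_partial_l : f^`M(l) = dbl_lj * lj + dbl_ll * ll.
Proof.
rewrite ef !expr2 !mderivD !mderivM !mderiv_vlin // eqxx (negPf jl).
rewrite mulr1n mulr0n /dbl_lj /dbl_ll; ring.
Qed.

Lemma dbl_eval : [/\ dbl_jj.@[v 0] = 2 * a.@[v 0], dbl_jl.@[v 0] = b.@[v 0],
  dbl_lj.@[v 0] = b.@[v 0] & dbl_ll.@[v 0] = 2 * c.@[v 0]].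
Proof.
have e2 : (2 : R).@[v 0] = 2 by rewrite rmorph_nat.
by rewrite !mevalD !mevalM e2 lj_v ll_v !mulr0 !addr0.
Qed.

(** The colon ideal Q of J by the ideal of [v] contains J, which has no zero off [v], and by
    Cramer's rule the determinant of the [dbl] matrix, whose value at v is minus the discriminant.
    So Q has no projective zero and contains all forms of large degree; these times the ideal of [v]
    lie in J. *)
Lemma jac_at_most_of_discriminant : [pchar k] =i pred0 ->
    b.@[v 0] ^+ 2 - 4 * a.@[v 0] * c.@[v 0] != 0 ->
    (forall w, singular_point f w -> same_point v w) ->
  exists N, jac_at_most f v N.
Proof.
move=> char0 disc uniq_v.
pose Q p := jac f (p * lj) /\ jac f (p * ll).
have [J0 JD JM] := jac_ideal f; have hJ := jac_homog hf.
have hQ : is_homog_ideal Q.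
  split; first split.
  - by split; rewrite mul0r.
  - by move=> p q [p1 p2] [q1 q2]; split; rewrite mulrDl; apply: JD.
  - by move=> p q [q1 q2]; split; rewrite -mulrA; apply: JM.
  move=> p s [p1 p2]; case: hJ => _ hJ.
  by split; rewrite -(pihomogM _ _ (vlin_homog v i _)); apply: hJ.
have JQ p : jac f p -> Q p by move=> h; split; rewrite mulrC; apply: JM.
pose h := dbl_jj * dbl_ll - dbl_jl * dbl_lj.
have Qh : Q h.
  split.
    have -> : h * lj = dbl_ll * f^`M(j) - dbl_jl * f^`M(l).
      by rewrite double_point_partial_j double_point_partial_l /h; ring.
    by apply: (ideal_sub (jac_ideal f)); apply: JM; apply: jac_deriv.
  have -> : h * ll = dbl_jj * f^`M(l) - dbl_lj * f^`M(j).
    by rewrite double_point_partial_j double_point_partial_l /h; ring.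
  by apply: (ideal_sub (jac_ideal f)); apply: JM; apply: jac_deriv.
have hv : h.@[v 0] != 0.
  rewrite /h mevalB !mevalM; have [-> -> -> ->] := dbl_eval.
  apply: contraNneq disc => e; rewrite -oppr_eq0 -[X in _ == X]e; apply/eqP; ring.
have [s hs] := pihomog_sum_neq hv.
have Qs : Q (pihomog mdeg s h) by case: hQ => _; apply.
have [w w0|N hN] := projective_nullstellensatz hQ.
  case: (pselect (forall a', (f^`M(a')).@[w 0] = 0)) => [sing|].
    have [t et] : same_point v w.
      by apply: uniq_v; split=> //; apply: (euler_zero char0 hf sing).
    exists (pihomog mdeg s h) => //.
    have t0 : t != 0 by apply: contraNneq w0 => t0; rewrite et t0 scale0r.
    rewrite (meval_eq (v2 := fun a' => t * v 0 a')); last by move=> a'; rewrite et mxE.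
    by rewrite (meval_scale t (v 0) (pihomogP mdeg s h)) mulf_neq0 ?expf_neq0.
  move=> nsing.
  case: (pselect (exists2 p, Q p & p.@[w 0] != 0)) => // hn; exfalso; apply: nsing => a'.
  apply/eqP/negPn/negP => ne; apply: hn; exists f^`M(a') => //.
  by apply: JQ; apply: jac_deriv.
exists N.+1 => m p; case: m => // m; rewrite ltnS => le hp pv.
have [A hA ->] := point_ideal vi hp pv.
rewrite (ord3_big _ _ ij jl il) /= vlin_ii // mul0r add0r.
have inQ a' : Q (A a') by apply: (forms_inS _ hN le) => //; case: hQ.
by apply: JD; rewrite mulrC; [case: (inQ j) | case: (inQ l)].
Qed.

(** A kernel vector (s, t) of a degenerate Hessian gives a tangent direction whose derivative at v
    vanishes on all of J. It does not vanish on the generators of the ideal of [v], although their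
    multiples by X_i^N lie in J. *)
Lemma discriminant_of_jac_at_most N : [pchar k] =i pred0 ->
    f.@[v 0] = 0 -> (forall a', (f^`M(a')).@[v 0] = 0) ->
    jac_at_most f v N ->
  b.@[v 0] ^+ 2 - 4 * a.@[v 0] * c.@[v 0] != 0.
Proof.
move=> char0 fv dfv hN; apply/eqP => disc.
set av := a.@[v 0] in disc; set bv := b.@[v 0] in disc; set cv := c.@[v 0] in disc.
(* A nonzero kernel vector of the matrix with rows (2a, b) and (b, 2c), whose determinant is minus
   the discriminant. *)
have [s [t [st e1 e2]]] : exists s t : k, [/\ (s != 0) || (t != 0),
    s * (2 * av) + t * bv = 0 & s * bv + t * (2 * cv) = 0].
  have [b0|b0] := eqVneq bv 0; last first.
    exists bv, (- 2 * av); rewrite b0; split=> //; first by ring.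
    by rewrite -[RHS]disc; ring.
  have [a0|a0] := eqVneq av 0.
    by exists 1, 0; rewrite oner_neq0 a0 b0; split=> //; ring.
  have c0 : cv = 0.
    move/eqP: disc; rewrite b0 expr0n sub0r oppr_eq0 !mulf_eq0 (negPf a0) orbF.
    by rewrite (negPf (char0_neq0 char0 3)) => /eqP.
  by exists 0, 1; rewrite oner_neq0 orbT c0 b0; split=> //; ring.
pose g := s *: f^`M(j) + t *: f^`M(l).
(* Both coefficients of g on [lj] and [ll] vanish at v, so g vanishes there to order two; by
   symmetry of second partials so do the derivatives of all partials of f in the direction (s,
   t). *)
have dg a' : (g^`M(a')).@[v 0] = 0.
  have -> : g = (s *: dbl_jj + t *: dbl_lj) * lj + (s *: dbl_jl + t *: dbl_ll) * ll.
    by rewrite /g double_point_partial_j double_point_partial_l -!mul_mpolyC; ring.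
  have [E1 E2 E3 E4] := dbl_eval.
  rewrite mderivD !mderivM !mevalD !mevalM lj_v ll_v !mulr0 !add0r !mevalD !mevalZ.
  by rewrite E1 E2 E3 E4 e1 e2 !mul0r addr0.
have dirJ p : jac f p -> s * (p^`M(j)).@[v 0] + t * (p^`M(l)).@[v 0] = 0.
  move=> [A ->]; rewrite !(raddf_sum (mderiv _)) !(raddf_sum (meval (v 0))) /=.
  rewrite !mulr_sumr -big_split big1 // => a' _ /=.
  rewrite !mderivM !mevalD !mevalM dfv !mulr0 !add0r.
  rewrite [f^`M(a')^`M(j)]mderiv_comm [f^`M(a')^`M(l)]mderiv_comm.
  rewrite !mulrA ![_ * (A a').@[_]]mulrC -!mulrA -mulrDr.
  by have := dg a'; rewrite /g mderivD !mderivZ mevalD !mevalZ => ->; rewrite mulr0.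
have dir0 m : m != i -> s * (m == j)%:R + t * (m == l)%:R = 0.
  move=> mi; pose q := vlin v i m * 'X_i ^+ N.
  have hq : q \is N.+1.-homog.
    exact: (dhomogM (vlin_homog v i m) (Xin_homog k i N)).
  have qv : q.@[v 0] = 0 by rewrite mevalM vlin_v // mul0r.
  have := dirJ q (hN _ _ (leqnSn N) hq qv).
  rewrite !mderivM !mderiv_vlin // !mevalD !mevalM vlin_v // !mul0r !addr0.
  rewrite !rmorph_nat !mulrA -mulrDl => /eqP.
  by rewrite mulf_eq0 (negPf (Xin_eval vi N)) orbF => /eqP.
have s0 : s = 0 by have := dir0 j ji; rewrite eqxx (negPf jl) mulr1 mulr0 addr0.
have t0 : t = 0 by have := dir0 l li; rewrite eqxx eq_sym (negPf jl) mulr1 mulr0 add0r.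
by move: st; rewrite s0 t0 eqxx.
Qed.

End DoublePointJacobian.

(** * Hilbert functions of the gradient ideal and bounded Hilbert functions *)

Section HilbertValues.
Variable k : closedFieldType.
Local Notation R := {mpoly k[3]}.
Variable f : R.

Lemma hilbert_value_exists (I : R -> Prop) n : is_ideal I -> exists h, hilbert_value I n h.
Proof.
move=> hI; exists ('C(n + 2, n) - \dim (form_space hI n))%N.
by apply/hilbert_valueP; rewrite subnKC // -(@dim_forms 2 k n) dimvS ?subvf.
Qed.

Lemma hilbert_value_uniq (I : R -> Prop) n h h' : is_ideal I ->
  hilbert_value I n h -> hilbert_value I n h' -> h = h'.
Proof.
move=> hI /(hilbert_valueP hI) e /(hilbert_valueP hI) e'.
by apply/eqP; rewrite -(eqn_add2l (\dim (form_space hI n))) e e'.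
Qed.

Lemma forms_in_hilbert0 (I : R -> Prop) n : is_ideal I -> forms_in I n -> hilbert_value I n 0.
Proof.
move=> hI h; exists (fun=> 0); split; first by move=> i; rewrite rpred0.
move=> p hp; exists 0; split; first by rewrite big_ord0 subr0; apply: h.
by move=> x _; apply/rowP => -[].
Qed.

Lemma jac_hilbert1 (v : 'rV[k]_3) N n : v != 0 -> (forall a, (f^`M(a)).@[v 0] = 0) ->
  jac_at_most f v N -> (N <= n)%N -> hilbert_value (jac f) n 1.
Proof.
move=> v0 dfv hN le; have [i vi] := point_coord v0.
exists (fun=> 'X_i ^+ n); split; first by move=> _; apply: Xin_homog.
move=> p hp; exists (\row__ (p.@[v 0] / v 0 i ^+ n)); split.
  rewrite big_ord1 mxE; apply: (hN n) => //.
    by rewrite rpredB ?rpredZ ?Xin_homog.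
  by rewrite mevalB mevalZ rmorphXn /= mevalXU divfK ?subrr // expf_neq0.
move=> x; rewrite big_ord1 => /jac_eval/(_ dfv)/eqP.
rewrite mevalB mevalZ rmorphXn /= mevalXU subr_eq0 => /eqP ->.
by apply/rowP => z; rewrite mxE (ord1 z) mulfK // expf_neq0.
Qed.

(** In each degree J lies in the hyperplane of forms vanishing at v; codimension at most one forces
    equality. *)
Lemma jac_small_codim (v : 'rV[k]_3) N :
    v != 0 -> (forall a, (f^`M(a)).@[v 0] = 0) ->
    (forall n h, (N <= n)%N -> hilbert_value (jac f) n h -> (h <= 1)%N) ->
  jac_at_most f v N.
Proof.
move=> v0 dfv small n p le hp pv; have [i vi] := point_coord v0.
pose hJ := jac_ideal f; pose U := form_space hJ n.
have [E hE] : exists E : {vspace dhomog 3 k n}, forall u, u \in E <-> (u : R).@[v 0] = 0.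
  apply: vspace_of_pred; first by rewrite meval0.
  by move=> a u w eu ew; rewrite /= mevalD mevalZ eu ew mulr0 addr0.
have UE : (U <= E)%VS by apply/subvP => u /form_spaceP/jac_eval/(_ dfv)/hE.
have dE : (\dim E < 'C(n + 2, n))%N.
  rewrite -(@dim_forms 2 k n) ltnNge; apply/negP => h.
  have : (DHomog (Xin_homog k i n)) \in E.
    suff -> : E = fullv by rewrite memvf.
    by apply/eqP; rewrite eqEdim subvf h.
  move/hE/eqP; rewrite /= rmorphXn /= mevalXU expf_eq0 (negPf vi) andbF; exact.
have [h hh] := hilbert_value_exists n hJ.
have le1 := small _ _ le hh; move/(hilbert_valueP hJ): hh => dU.
have /eqP UEe : U == E.
  rewrite eqEdim UE -ltnS (leq_trans dE) //= -dU.
  by rewrite -/U -(addn1 (\dim U)) leq_add2l.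
by apply/(form_spaceP hJ (DHomog hp)); rewrite -/U UEe; apply/hE.
Qed.

End HilbertValues.

(** The product of the P - b for b up to B vanishes at all large integers, so it is zero and P is
    one of the constants b, which is then the degree m. *)
Lemma hilbert_poly_bounded (k : fieldType) (I : {mpoly k[3]} -> Prop) B N m :
    (forall n h, (N <= n)%N -> hilbert_value I n h -> (h <= B)%N) ->
    has_degree I m ->
  exists N', forall n, (N' <= n)%N -> hilbert_value I n m.
Proof.
move=> hB [P [M hM] em].
pose T : {poly rat} := \prod_(b < B.+1) (P - (b%:R)%:P).
have T0 : T = 0.
  apply/eqP/negPn/negP => Tn0.
  pose rs : seq rat := [seq (maxn N M + x)%:R | x <- iota 0 (size T)].
  have := @max_poly_roots _ T rs Tn0; rewrite size_map size_iota ltnn => H.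
  suff : false by []; apply: H.
    apply/allP => _ /mapP[x _ ->]; set n := (maxn N M + x)%N.
    have [|h hh eP] := hM n; first by rewrite /n; lia.
    have hb : (h < B.+1)%N by rewrite ltnS (hB n) // /n; lia.
    by rewrite /root horner_prod (bigD1 (Ordinal hb)) //= !hornerE eP subrr mul0r.
  rewrite map_inj_uniq ?iota_uniq // => x y /eqP.
  by rewrite (Num.Theory.eqr_nat rat) eqn_add2l => /eqP.
have [b Pb] : exists b : nat, P = (b%:R)%:P.
  move/eqP: T0; rewrite prodf_seq_eq0 => /hasP[b _ /= /eqP eb].
  by exists b; apply/eqP; rewrite -subr_eq0 eb.
have bm : b = m.
  apply/eqP; rewrite -(Num.Theory.eqr_nat rat) em Pb lead_coefC.
  by have := size_polyC_leq1 (b%:R : rat); case: (size _) => [|[|//]] _; rewrite mul1r.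
exists M => n le; have [h hh] := hM n le.
by rewrite Pb hornerC bm => /eqP; rewrite Num.Theory.eqr_nat => /eqP ->.
Qed.

Section NodalJacobian.
Variable k : closedFieldType.
Local Notation R := {mpoly k[3]}.
Variables (f : R) (d : nat).
Hypotheses (char0 : [pchar k] =i pred0) (d0 : (0 < d)%N).
Hypothesis hf : f \is d.+1.-homog.

Lemma nodal_of_jac_at_most (v : 'rV[k]_3) N : singular_point f v ->
  jac_at_most f v N -> nodal_point f v.
Proof.
move=> [v0 fv dfv] hN; have [i vi] := point_coord v0.
have [j [l [ij jl il _]]] := ord3_others i.
have hf2 : f \is d.-1.+2.-homog by rewrite prednK.
have [a [b [c [ha hb hc ef]]]] := double_point_expansion ij jl il vi hf2 fv dfv.
apply: (nodal_of_discriminant ij jl il vi hf2 ha hb hc ef).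
exact: (discriminant_of_jac_at_most ij jl il vi ef char0 fv dfv hN).
Qed.

Lemma jac_at_most_of_nodal (v : 'rV[k]_3) : singular_point f v ->
    (forall w, singular_point f w -> same_point v w) -> nodal_point f v ->
  exists N, jac_at_most f v N.
Proof.
move=> [v0 fv dfv] uv nod; have [i vi] := point_coord v0.
have [j [l [ij jl il _]]] := ord3_others i.
have hf2 : f \is d.-1.+2.-homog by rewrite prednK.
have [a [b [c [ha hb hc ef]]]] := double_point_expansion ij jl il vi hf2 fv dfv.
have disc := discriminant_of_nodal ij jl il vi hf2 ha hb hc ef nod.
exact: (jac_at_most_of_discriminant ij jl il vi hf2 ef char0 disc uv).
Qed.

Lemma jac_at_most_uniq (v w : 'rV[k]_3) N : v != 0 -> jac_at_most f v N ->
  singular_point f w -> same_point v w.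
Proof.
move=> v0 hN [w0 _ dfw]; have [i vi] := point_coord v0.
exists (w 0 i / v 0 i); apply/rowP => a; rewrite mxE.
have hq : vlin v i a ^+ N.+1 \is N.+1.-homog.
  by have := dhomogMn N.+1 (vlin_homog v i a); rewrite mul1n.
have qv : (vlin v i a ^+ N.+1).@[v 0] = 0 by rewrite rmorphXn /= vlin_v // expr0n.
have := jac_eval (hN _ _ (leqnSn N) hq qv) dfw.
rewrite rmorphXn /= => /eqP; rewrite expf_eq0 /= vlin_eval subr_eq0 => /eqP ->.
by rewrite mulrAC [RHS]mulrAC [w 0 i * _]mulrC.
Qed.

End NodalJacobian.

(** * From the Bourbaki degree to a reduced point *)

Section Forward.
Variable k : closedFieldType.
Local Notation R := {mpoly k[3]}.
Variables (f : R) (d : nat).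
Hypotheses (char0 : [pchar k] =i pred0) (d0 : (0 < d)%N).
Hypotheses (hf : f \is d.+1.-homog) (firr : irreducible_elt f).

Lemma jac_at_most_of_bourbaki : bourbaki_degree f d (d ^ 2 - 1) ->
  exists (v : 'rV[k]_3) N, [/\ v != 0, forall a, (f^`M(a)).@[v 0] = 0 & jac_at_most f v N].
Proof.
have grad := gradient_neq0 char0 hf firr.
case=> [[fr d1]|[_]].
  (* In the free case d^2 - 1 = 0; but an irreducible conic has no syzygy of degree 0, so its module
     of syzygies is not free. *)
  have {}d1 : d = 1%N by nia.
  case: (@low_not_free _ _ _ d0 hf) => // e s lt hs.
  by apply: (conic_syzygy0 char0 hf firr d1); have <- : e = 0%N by lia.
move=> [e [eps [I [phi [[[_ emin] heps mineps] [hI _ _] [phiI phi0 phi_deg] degI]]]]].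
have eps0 : eps != 0.
  apply/eqP => eps0; apply: mineps; exists (fun=> 0).
  by rewrite eps0 big1 // => i _; rewrite scaler0.
have idI : is_ideal I by case: hI.
have hJ := jac_ideal f.
have HB := hilbert_bourbaki hf hI heps eps0 phiI phi0 phi_deg.
have le_ed : (e <= d)%N.
  rewrite leqNgt; apply/negP => lt; have [a /eqP[]] := koszul_syz_neq0 grad.
  exact: (emin _ _ lt (koszul_syz_homog hf a)).
(* The dimension count bounds the Hilbert function of I by e^2 + d^2, so it is eventually the degree
   d^2 - 1. *)
have [|N hN] := hilbert_poly_bounded (B := e ^ 2 + d ^ 2) (N := e) _ degI.
  move=> m h le hh; have [t ht] := hilbert_value_exists (m + d - e + d) hJ.
  have := HB (m + d - e)%N m h t _ _ hh ht; lia.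
have small n t : (N + d + d <= n)%N -> hilbert_value (jac f) n t ->
    (t + e * d = e ^ 2 + 1)%N.
  move=> le ht; have en : (n = n - d + d)%N by lia.
  have hh : hilbert_value I (n - d + e - d) (d ^ 2 - 1) by apply: hN; lia.
  rewrite en in ht; have dd : (0 < d ^ 2)%N by rewrite expn_gt0 d0.
  have := HB (n - d)%N _ _ _ _ _ hh ht; lia.
case: (pselect (exists2 v : 'rV[k]_3, v != 0 & forall a, (f^`M(a)).@[v 0] = 0)).
  move=> [v v0 dfv]; exists v, (N + d + d)%N; split=> //.
  apply: (jac_small_codim v0 dfv) => n t le ht.
  by have := small n t le ht; nia.
move=> smooth.
have [w w0|M hM] := projective_nullstellensatz (jac_homog hf).
  case: (pselect (exists2 p, jac f p & p.@[w 0] != 0)) => // hn.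
  case: smooth; exists w => // a; apply/eqP/negPn/negP => ne; apply: hn.
  by exists f^`M(a) => //; apply: jac_deriv.
have le_M n : (M <= n)%N -> forms_in (jac f) n by move=> le; apply: (forms_inS hJ hM).
(* J contains all forms of large degree, so any nonzero vector satisfies [jac_at_most]; hence e = d,
   and the count would require 1 = 0 for the codimension of J. *)
pose v : 'rV[k]_3 := const_mx 1.
have v0 : v != 0.
  by apply/eqP => /rowP/(_ ord0)/eqP; rewrite !mxE (negPf (oner_neq0 _)).
have hv : jac_at_most f v M by move=> n h le hh _; apply: (le_M n le h hh).
have ed : e = d.
  apply/eqP; rewrite eqn_leq le_ed leqNgt; apply/negP => lt.
  by case/eqP: eps0; apply: (low_syzygies char0 d0 hf firr v0 hv lt heps).
have := small (N + d + d + M)%N 0%N (leq_addr _ _) (forms_in_hilbert0 hJ (le_M _ (leq_addl _ _))).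
by rewrite ed; nia.
Qed.

End Forward.

(** * Construction of the Bourbaki ideal when e = d *)

Section Residual.
Variable k : fieldType.
Local Notation R := {mpoly k[3]}.
Variables (f : R) (al be : k).
Local Notation i1 := (lift ord0 ord0 : 'I_3).
Local Notation g1 := (f^`M(ord0) + al *: f^`M(ord_max)).
Local Notation g2 := (f^`M(i1) + be *: f^`M(ord_max)).

(** The coefficient of f_z once f_x and f_y are replaced by g1 and g2. Its image is the colon ideal
    ((g1, g2) : f_z), and its kernel consists of the relations between g1 and g2. *)
Definition syz_residual (s : syz f) : R^o :=
  syz_val s 0 ord_max - al *: syz_val s 0 ord0 - be *: syz_val s 0 i1.

Lemma syz_residual_linear : linear syz_residual.
Proof.
move=> a s t; rewrite /syz_residual.
have E i : syz_val (a *: s + t) 0 i = a * syz_val s 0 i + syz_val t 0 i.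
  by rewrite -[syz_val _]/(val _) linearP !mxE.
rewrite !E -!mul_mpolyC -[_ *: _ :> R^o]/(a * _); ring.
Qed.

HB.instance Definition _ :=
  GRing.isLinear.Build R (syz f) R^o *:%R syz_residual syz_residual_linear.

Lemma syz_residualP (s : syz f) :
  syz_val s 0 ord0 * g1 + syz_val s 0 i1 * g2 + (syz_residual s : R) * f^`M(ord_max) = 0.
Proof.
have /eqP := valP s; rewrite sum3 => e0.
rewrite -[RHS]e0 /syz_residual -!mul_mpolyC /=; ring.
Qed.

(** The Koszul syzygy of g1 and g2 in the original partials; the third entry collects their f_z
    terms. *)
Lemma generic_syz_proof :
  (\row_i (if i == ord0 then g2 else if i == i1 then - g1 else al *: g2 - be *: g1))
    \in syz_pred f.
Proof.
rewrite /in_mem /= /syz_pred sum3 !mxE /= -!mul_mpolyC; apply/eqP; ring.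
Qed.

Definition generic_syz : syz f := Syz generic_syz_proof.

Lemma syz_residual_eq0 :
    (forall a b, a * g1 + b * g2 = 0 -> exists c, a = c * g2 /\ b = - (c * g1)) ->
  forall s : syz f, syz_residual s = 0 <-> exists a : R, s = a *: generic_syz.
Proof.
move=> kz s; split=> [s0|[a ->]].
  have := syz_residualP s; rewrite s0 mul0r addr0 => /kz[c [ea eb]].
  exists c; apply/val_inj/rowP => i; rewrite -[val (_ *: _)]/(c *: val generic_syz) !mxE.
  case: (ord3P i) => -> /=; rewrite ?ea ?eb ?mulrN //.
  move/eqP: s0; rewrite /syz_residual -addrA -opprD subr_eq0 => /eqP ->.
  by rewrite ea eb -!mul_mpolyC; ring.
rewrite linearZ /= [X in _ *: X](_ : _ = 0) ?scaler0 //.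
rewrite /syz_residual !mxE /= -!mul_mpolyC; ring.
Qed.

(** The Koszul syzygies of f_x and of f_y with f_z have residuals g1 and g2, which places a regular
    pair in the Bourbaki ideal. *)
Lemma residual_generators :
  (exists s, syz_residual s = g1) /\ (exists s, syz_residual s = g2).
Proof.
have p1 : (\row_i (if i == ord0 then - f^`M(ord_max) else if i == i1 then 0 else f^`M(ord0)))
    \in syz_pred f.
  by rewrite /in_mem /= /syz_pred sum3 !mxE /=; apply/eqP; ring.
have p2 : (\row_i (if i == ord0 then 0 else if i == i1 then - f^`M(ord_max) else f^`M(i1)))
    \in syz_pred f.
  by rewrite /in_mem /= /syz_pred sum3 !mxE /=; apply/eqP; ring.
split; [exists (Syz p1) | exists (Syz p2)].
  by rewrite /syz_residual !mxE /= -!mul_mpolyC; ring.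
by rewrite /syz_residual !mxE /= -!mul_mpolyC; ring.
Qed.

Lemma syz_residual_homog n (s : syz f) : syz_homog n s -> (syz_residual s : R) \is n.-homog.
Proof. by move=> hs; rewrite /syz_residual !rpredB ?rpredZ ?hs. Qed.

Variable d : nat.
Hypothesis hf : f \is d.+1.-homog.

Lemma syz_residual_comp n (s : syz f) :
  (syz_residual (syz_comp hf n s) : R) = pihomog mdeg n (syz_residual s : R).
Proof. by rewrite /syz_residual !mxE !linearB !linearZ. Qed.

Lemma generic_syz_homog : syz_homog d generic_syz.
Proof.
have hd a : f^`M(a) \is d.-homog by apply: mderiv_homog.
have h1 : g1 \is d.-homog by rewrite rpredD ?rpredZ.
have h2 : g2 \is d.-homog by rewrite rpredD ?rpredZ.
move=> i; rewrite mxE; case: ifP => // _; case: ifP => _; first by rewrite rpredN.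
by rewrite rpredB ?rpredZ.
Qed.

End Residual.

Section Reverse.
Variable k : closedFieldType.
Local Notation R := {mpoly k[3]}.
Variables (f : R) (d : nat).
Hypotheses (char0 : [pchar k] =i pred0) (d1 : (1 < d)%N).
Hypotheses (hf : f \is d.+1.-homog) (firr : irreducible_elt f).
Local Notation i1 := (lift ord0 ord0 : 'I_3).

Lemma bourbaki_of_jac_at_most (v : 'rV[k]_3) N :
    v != 0 -> (forall a, (f^`M(a)).@[v 0] = 0) -> jac_at_most f v N ->
  bourbaki_degree f d (d ^ 2 - 1).
Proof.
move=> v0 dfv hN; have d0 := ltnW d1; have [i vi] := point_coord v0.
have low := low_syzygies char0 d0 hf firr v0 hN.
have [al [be [kz _]]] := generic_partials d0 hf hN vi.
set g1 := _ + _ in kz; set g2 := f^`M(i1) + _ in kz.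
have hd a : f^`M(a) \is d.-homog by apply: mderiv_homog.
have h2 : g2 \is d.-homog by rewrite rpredD ?rpredZ.
have g10 : g1 != 0.
  apply/eqP => g10; have [|c [c1 _]] := kz 1 0; first by rewrite g10 mulr0 mul0r addr0.
  have := congr1 (pihomog mdeg 0) c1; rewrite (pihomogM_lt _ h2 d0) pihomog_dE ?dhomog1 //.
  by move/eqP; rewrite oner_eq0.
right; split; first exact: (low_not_free d0 hf low (gradient_neq0 char0 hf firr)).
pose eps := generic_syz f al be; pose phi : {linear syz f -> R^o} := syz_residual al be.
pose I (p : R) := exists s : syz f, phi s = p.
have heps : syz_homog d eps := generic_syz_homog al be hf.
have eps0 : eps != 0.
  apply: contraNneq g10 => /(congr1 (fun s => syz_val s 0 i1)).
  by rewrite /= !mxE /= => /eqP; rewrite oppr_eq0.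
have hI : is_homog_ideal I.
  split; first split.
  - by exists 0; rewrite linear0.
  - by move=> _ _ [s <-] [t <-]; exists (s + t); rewrite linearD.
  - by move=> a _ [s <-]; exists (a *: s); rewrite linearZ.
  by move=> _ n [s <-]; exists (syz_comp hf n s); apply: syz_residual_comp.
have idI : is_ideal I by case: hI.
have phi0 := syz_residual_eq0 kz.
have phi_deg n (s : syz f) : syz_homog n s -> zhomog (n%:Z + d%:Z - d%:Z) (phi s : R).
  by move=> hs; rewrite addrK; apply: syz_residual_homog.
(* The count with e = d and Hilbert value 1 for J leaves 2 d^2 - d^2 - 1. *)
have hilbI n : (N + d <= n)%N -> hilbert_value I n (d ^ 2 - 1).
  move=> le; have [h hh] := hilbert_value_exists n idI.
  have [leN led] : (N <= n + d)%N /\ (d <= n)%N by lia.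
  have ht := jac_hilbert1 v0 dfv hN leN.
  rewrite (_ : (d ^ 2 - 1)%N = h) //.
  have := hilbert_bourbaki hf hI heps eps0 (fun p => iff_refl _) phi0 phi_deg led erefl hh ht.
  by nia.
have [Ig1 Ig2] : I g1 /\ I g2 := residual_generators f al be.
exists d, eps, I, phi; split.
- split=> //; last exact: (low_min_generator d0 hf low eps0 heps).
  by split; [exists eps | move=> e s; apply: low].
- split=> //.
    (* If 1 were in I, the degree 0 component of s would be a syzygy with residual 1, but there is
       none of degree below d. *)
    move=> [s s1]; have : (phi (syz_comp hf 0 s) : R) = pihomog mdeg 0 (phi s : R).
      exact: syz_residual_comp.
    rewrite s1 pihomog_dE ?dhomog1 // (low _ _ d0 (syz_comp_homog hf 0 s)) linear0.
    by move/eqP; rewrite eq_sym oner_eq0.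
  split=> [P hP IP|].
    by apply: (regular_pair_height g10 kz hP); apply: IP.
  (* For height at most two, a zero w of I keeps all powers of some X_a out of I. Without a zero the
     Hilbert function of I would end in 0, whereas d^2 - 1 > 0 as 1 < d. *)
  case: (pselect (exists2 w : 'rV[k]_3, w != 0 & forall p, I p -> p.@[w 0] = 0)).
    move=> [w w0 Iw]; have [a wa] := point_coord w0.
    apply: (prime_of_small_height (i := a) hI) => n /Iw /eqP.
    by apply/negP; apply: Xin_eval.
  move=> nw; have [w w0|M hM] := projective_nullstellensatz hI.
    case: (pselect (exists2 p, I p & p.@[w 0] != 0)) => // hn; case: nw.
    exists w => // p Ip; apply/eqP/negPn/negP => ne; apply: hn; by exists p.
  have := hilbert_value_uniq idI (hilbI _ (leq_addr M _))
    (forms_in_hilbert0 idI (forms_inS idI hM (leq_addl _ _))).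
  by nia.
- by split=> // p.
exists ((d ^ 2 - 1)%:R)%:P.
  exists (N + d)%N => n le; exists (d ^ 2 - 1)%N; first exact: hilbI.
  by rewrite hornerC.
rewrite lead_coefC; have := size_polyC_leq1 ((d ^ 2 - 1)%:R : rat).
by case: (size _) => [|[|//]] _; rewrite mul1r.
Qed.

End Reverse.

Theorem theorem3p8 (k : closedFieldType) (d : nat) (f : {mpoly k[3]})
    (char0 : [pchar k] =i pred0) (d_ge1 : (1 <= d)%N)
    (f_form : f \is d.+1.-homog) (f_irr : irreducible_elt f) :
  bourbaki_degree f d (d ^ 2 - 1) <->
  exists v : 'rV[k]_3,
    [/\ singular_point f v,
        forall w : 'rV[k]_3, singular_point f w -> same_point v w
      & nodal_point f v].
Proof.
split=> [hB|[v [sv uv nod]]].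
  have [v [N [v0 dfv hN]]] := jac_at_most_of_bourbaki char0 d_ge1 f_form f_irr hB.
  have sv : singular_point f v by split=> //; apply: (euler_zero char0 f_form dfv).
  exists v; split=> //; first by move=> w; apply: (jac_at_most_uniq v0 hN).
  exact: (nodal_of_jac_at_most char0 d_ge1 f_form sv hN).
have [N hN] := jac_at_most_of_nodal char0 d_ge1 f_form sv uv nod.
have [v0 fv dfv] := sv.
(* An irreducible conic has no singular point. *)
have d1 : (1 < d)%N.
  rewrite ltn_neqAle d_ge1 andbT; apply/eqP => d1.
  have hf2 : f \is 2.-homog by move: f_form; rewrite -d1.
  exact: (irreducible_conic_smooth f_irr hf2 v0 fv dfv).
exact: (bourbaki_of_jac_at_most char0 d1 f_form f_irr v0 dfv hN).
Qed.
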